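(* Let $n\ge1$, $0\le k\le n-1$, and let $\Bbbk$ be a field. The inflation functors $\mathrm{infl}\colon\mathcal A^{\Bbbk}_{n,m}\text{-fmod}\to\mathcal B_l^{\Bbbk}(n,m)\text{-fmod}$ ($m=k,k+1$) between categories of finite-dimensional graded left modules intertwine the functors $(\mathcal E'')^{OSz}_k,\mathcal F^{OSz}_k$ with $(\mathcal E')^{S}_k,\mathcal F^S_k$: there are natural isomorphisms of functors $$(\mathcal E'')^{OSz}_k\circ\mathrm{infl}\cong\mathrm{infl}\circ(\mathcal E')^S_k\colon\ \mathcal A^{\Bbbk}_{n,k}\text{-fmod}\to\mathcal B_l^{\Bbbk}(n,k+1)\text{-fmod},$$ $$\mathcal F^{OSz}_k\circ\mathrm{infl}\cong\mathrm{infl}\circ\mathcal F^S_k\colon\ \mathcal A^{\Bbbk}_{n,k+1}\text{-fmod}\to\mathcal B_l^{\Bbbk}(n,k)\text{-fmod}.$$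
   Context: **Ozsváth–Szabó algebra.** For integers $n\ge 0$, $0\le k\le n$: an I-state is a subset $\mathbf x\subset\{0,\dots,n\}$; it is a left I-state if $n\notin\mathbf x$. $V(n,k)$ (resp. $V_l(n,k)$) is the set of I-states (resp. left I-states) with $k$ elements, $\mathbf x=\{x_1<\dots<x_k\}$. $\mathbf x,\mathbf y\in V(n,k)$ are too far if $|x_i-y_i|>1$ for some $i$. For $1\le i\le n$ put $v_i^{\mathbf x}=|\mathbf x\cap\{i,\dots,n\}|$. $\mathcal B_0(n,k)$ is the $\mathbb Z[U_1,\dots,U_n]$-algebra which is free as a module on elements $f_{\mathbf x,\mathbf y}$ ($\mathbf x,\mathbf y\in V(n,k)$), with $f_{\mathbf x,\mathbf y}f_{\mathbf y,\mathbf z}=\prod_{i=1}^nU_i^{g_i}f_{\mathbf x,\mathbf z}$, $g_i=\tfrac12(|v_i^{\mathbf y}-v_i^{\mathbf z}|-|v_i^{\mathbf x}-v_i^{\mathbf z}|+|v_i^{\mathbf x}-v_i^{\mathbf y}|)$, and $f_{\mathbf x,\mathbf y}f_{\mathbf w,\mathbf z}=0$ for $\mathbf y\ne\mathbf w$. The $\mathbf I_{\mathbf x}=f_{\mathbf x,\mathbf x}$ are orthogonal idempotents with sum $1$. For $1\le i\le n$, $R_i=\sum f_{\mathbf x,(\mathbf x\setminus\{i-1\})\cup\{i\}}$ over $\mathbf x$ with $\mathbf x\cap\{i-1,i\}=\{i-1\}$, and $L_i=\sum f_{\mathbf x,(\mathbf x\setminus\{i\})\cup\{i-1\}}$ over $\mathbf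 x$ with $\mathbf x\cap\{i-1,i\}=\{i\}$. $\mathcal B(n,k)$ is the quotient of $\mathcal B_0(n,k)$ by the two-sided ideal generated by $R_{i-1}R_i$, $L_iL_{i-1}$ ($2\le i\le n$) and $U_i\mathbf I_{\mathbf x}$ ($1\le i\le n$, $\mathbf x\cap\{i-1,i\}=\varnothing$). $\mathcal B_l(n,k)=e\,\mathcal B(n,k)\,e$ with $e=\sum_{\mathbf x\in V_l(n,k)}\mathbf I_{\mathbf x}$. Grading: $\deg U_i=2$, $\deg f_{\mathbf x,\mathbf y}=\sum_i|v_i^{\mathbf x}-v_i^{\mathbf y}|$. **Integral Sartori algebra.** $R=\mathbb Z[x_1,\dots,x_n]$, $\deg x_i=2$. $D_{n,k}$ is the set of sequences $\mu=\mu_1\cdots\mu_n$ of $k$ symbols $\wedge$ and $n-k$ symbols $\vee$; $\vee_j^\mu$ is the position of the $j$-th $\vee$. $b_i^\mu$ is $1$ plus the number of $\wedge$'s strictly to the right of position $i$. With $h_j$ complete homogeneous symmetric polynomials, $I_{\mathbf b}=\langle h_{b_1}(x_1),h_{b_2}(x_1,x_2),\dots,h_{b_n}(x_1,\dots,x_n)\rangle\subset R$, $R_{\mathbf b}=R/I_{\mathbf b}$. $\lambda,\mu\in D_{n,k}$ are too far if for some $1\le j\le n-k-1$, $\vee_j^\mu\ge\vee_{j+1}^\lambda$ or $\vee_j^\lambda\ge\vee_{j+1}^\mu$. An $R$-map $R_{\mathbf b^\lambda}\to R_{\mathbf b^\mu}$ is written $(1\mapsto p)$. $\mathcal W^\alpha_{\lambda,\mu}\subset\mathrm{Hom}_R(R_{\mathbf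 b^\lambda},R_{\mathbf b^\mu})$ is the whole Hom space if $\lambda,\mu$ are too far, and otherwise the $R$-submodule generated by the maps $1\mapsto (x_{\alpha(j)}x_{\alpha(j)+1}\cdots x_{\beta(j)})(x_1^{c_1}\cdots x_n^{c_n})$, $1\le j\le n-k$, with $c_i=\max(b_i^\mu-b_i^\lambda,0)$, $\alpha(j)=\max(\vee_j^\lambda,\vee_j^\mu)$, $\beta(j)=\min(\vee_{j+1}^\mu,\vee_{j+1}^\lambda)-1$ for $j<n-k$, $\beta(n-k)=n$. Then $\mathcal A^{\mathbb Z}_{n,k}=\bigoplus_{\lambda,\mu\in D_{n,k}}\mathrm{Hom}_R(R_{\mathbf b^\lambda},R_{\mathbf b^\mu})/\mathcal W^\alpha_{\lambda,\mu}$ with product given by composition ($ab=a\circ b$), graded by $\deg(1\mapsto p)=\deg p-\sum_i(b_i^\mu-b_i^\lambda)$ for homogeneous $p$. $\mathbf 1_\lambda$ is the class of the identity of $R_{\mathbf b^\lambda}$. **The homomorphism.** $V_l(n,k)\leftrightarrow D_{n,k}$: $\mathbf x$ corresponds to the sequence with $\wedge$ exactly in positions $x_i+1$. Let $\mathbf x,\mathbf y$ correspond to $\mu,\lambda$. The $\mathbb Z[U_1,\dots,U_n]$-algebra homomorphism $\Xi\colon\mathcal B_l(n,k)\to\mathcal A^{\mathbb Z}_{n,k}$ ($U_i$ acting on $\mathcal A^{\mathbb Z}_{n,k}$ as $x_i$) sends $f_{\mathbf x,\mathbf y}$ to $0$ if $\mathbf x,\mathbf y$ are too far and otherwise to the class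 of $(1\mapsto\prod_ix_i^{c_i})\colon R_{\mathbf b^\lambda}\to R_{\mathbf b^\mu}$, $c_i=\max(v_i^{\mathbf x}-v_i^{\mathbf y},0)$. Put $\mathcal B_l^{\Bbbk}=\mathcal B_l\otimes\Bbbk$, $\mathcal A^{\Bbbk}_{n,k}=\mathcal A^{\mathbb Z}_{n,k}\otimes\Bbbk$. $\mathrm{infl}(M)$ is $M$ with $\mathcal B_l^{\Bbbk}(n,k)$ acting through $\Xi$. **OSz bimodules.** In $\mathcal B_l(n,k)$ put $e_k^\vee=\sum_{0\notin\mathbf x}\mathbf I_{\mathbf x}$, $e_k^\wedge=\sum_{0\in\mathbf x}\mathbf I_{\mathbf x}$. There is a surjective $\mathbb Z[U_1,\dots,U_n]$-algebra map $\Psi'\colon e_{k+1}^\wedge\mathcal B_l(n,k+1)e_{k+1}^\wedge\to e_k^\vee\mathcal B_l(n,k)e_k^\vee$, $f_{\mathbf x,\mathbf y}\mapsto f_{\mathbf x\setminus\{0\},\mathbf y\setminus\{0\}}$, and $b\mapsto\Psi'(e_{k+1}^\wedge be_{k+1}^\wedge)$ is a ring homomorphism $\mathcal B_l(n,k+1)\to e_k^\vee\mathcal B_l(n,k)e_k^\vee$. $\mathbf F_k^{OSz}=\mathcal B_l(n,k)e_k^\vee$, a $(\mathcal B_l(n,k),\mathcal B_l(n,k+1))$-bimodule with right action through it. $(\mathbf E'')_k^{OSz}=\mathrm{Hom}_{\mathcal B_l(n,k)}(\mathbf F_k^{OSz},\mathcal B_l(n,k))$ (left module maps), with $(b\varphi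 a)(p)=\varphi(pb)a$. **Sartori bimodules.** In $\mathcal A^{\mathbb Z}_{n,k}$ let $e_k^\vee$ (resp. $e_k^\wedge$) be the sum of $\mathbf 1_\lambda$ over $\lambda\in D_{n,k}$ with first symbol $\vee$ (resp. $\wedge$). For $\lambda\in D_{n,k+1}$ with first symbol $\wedge$, let $\lambda^{(\vee)}\in D_{n,k}$ be obtained by changing it to $\vee$; then $\mathbf b^{\lambda}=\mathbf b^{\lambda^{(\vee)}}$, and sending the class of $(1\mapsto p)$ to the class of $(1\mapsto p)$ gives a surjective ring map $\Psi\colon e_{k+1}^\wedge\mathcal A^{\mathbb Z}_{n,k+1}e_{k+1}^\wedge\to e_k^\vee\mathcal A^{\mathbb Z}_{n,k}e_k^\vee$; $a\mapsto\Psi(e_{k+1}^\wedge ae_{k+1}^\wedge)$ is a ring homomorphism on $\mathcal A^{\mathbb Z}_{n,k+1}$. $\mathbf F_k^S=\mathcal A^{\mathbb Z}_{n,k}e_k^\vee$, an $(\mathcal A^{\mathbb Z}_{n,k},\mathcal A^{\mathbb Z}_{n,k+1})$-bimodule with right action through it; $(\mathbf E')^S_k=\mathrm{Hom}_{\mathcal A^{\mathbb Z}_{n,k}}(\mathbf F_k^S,\mathcal A^{\mathbb Z}_{n,k})$ with $(b\varphi a)(p)=\varphi(pb)a$. The functors $\mathcal F^{OSz}_k,(\mathcal E'')^{OSz}_k,\mathcal F^S_k,(\mathcal E')^S_k$ are tensor products with the corresponding bimodules (tensored with $\Bbbk$). *)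

(* Defs.v *)
From HB Require Import structures.
From mathcomp Require Import all_boot all_order all_algebra.
From mathcomp Require Import boolp functions.
From mathcomp Require Import mpoly freeg.
From mathcomp Require Import zify.

Set Implicit Arguments.
Unset Strict Implicit.
Unset Printing Implicit Defensive.

Import GRing.Theory.
Local Open Scope ring_scope.
Local Open Scope quotient_scope.

(* Quotients of abelian groups, modules and (noncommutative) rings by   *)
(* the subgroup / submodule / two-sided ideal generated by a set.       *)

Section Span.
Variable V : zmodType.
Implicit Type S : V -> Prop.

Inductive span S : V -> Prop :=
| span0 : span S 0
| span_gen x of S x : span S x
| spanB x y of span S x & span S y : span S (x - y).

Definition spanb S : pred V := fun x => `[< span S x >].

Lemma spanb_zmod_closed S : zmod_closed (spanb S).
Proof.
split=> [|x y /asboolP xS /asboolP yS]; apply/asboolP; first exact: span0.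
exact: spanB.
Qed.
HB.instance Definition _ S := GRing.isZmodClosed.Build V (spanb S) (spanb_zmod_closed S).
Definition span_zmod S : zmodClosed V := GRing.ZmodClosed.clone V (spanb S) _.

Lemma spanN S x : span S x -> span S (- x).
Proof. by move=> xS; rewrite -sub0r; apply: spanB => //; exact: span0. Qed.

Lemma spanD S x y : span S x -> span S y -> span S (x + y).
Proof. by move=> xS yS; rewrite -[y]opprK; apply: spanB => //; exact: spanN. Qed.

Definition aquot S : zmodType := Quotient.quot (span_zmod S).
Definition cls S (x : V) : aquot S := \pi_(Quotient.quot (span_zmod S)) x.
Definition crep S (q : aquot S) : V := repr (q : Quotient.quot (span_zmod S)).

Lemma crepK S (q : aquot S) : cls S (crep q) = q.
Proof. exact: reprK. Qed.

Lemma clsP S x y : cls S x = cls S y <-> span S (x - y).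
Proof.
rewrite /cls; split=> [/eqP|xyS].
  by rewrite -Quotient.idealrBE => /asboolP.
by apply/eqP; rewrite -Quotient.idealrBE; apply/asboolP.
Qed.

Lemma cls_is_additive S : zmod_morphism (cls S).
Proof.
move=> x y; have D : {morph (cls S) : a b / a + b} := @Quotient.pi_add _ (span_zmod S).
have N : {morph (cls S) : a / - a} := @Quotient.pi_opp _ (span_zmod S).
by rewrite D N.
Qed.
HB.instance Definition _ S := GRing.isZmodMorphism.Build _ _ (cls S) (cls_is_additive S).

Lemma cls_gen S x : S x -> cls S x = 0.
Proof. by move=> xS; rewrite -(raddf0 (cls S)); apply/clsP; rewrite subr0; exact: span_gen. Qed.

Lemma crep_cls S x : span S (crep (cls S x) - x).
Proof. by apply/clsP; rewrite crepK. Qed.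

End Span.

Lemma span_morph (V W : zmodType) (T : W -> Prop) (f : V -> W) (S : V -> Prop) :
  zmod_morphism f ->
  (forall x, S x -> span T (f x)) -> forall x, span S x -> span T (f x).
Proof.
move=> fB fS x; elim=> [|{}x xS|{}x y _ IHx _ IHy].
- by rewrite -(subrr 0) fB subrr; exact: span0.
- exact: fS.
- by rewrite fB; exact: spanB.
Qed.

Section ModuleQuotient.
Variables (R : pzRingType) (V : lmodType R).
Implicit Type S : V -> Prop.

Definition lgen S : V -> Prop := fun v => exists r s, S s /\ v = r *: s.
Definition mquot S : Type := aquot (lgen S).
HB.instance Definition _ S := GRing.Zmodule.on (mquot S).

Lemma span_lgenZ S r x : span (lgen S) x -> span (lgen S) (r *: x).
Proof.
apply: (@span_morph _ _ _ ( *:%R r)) => [u v|]; first exact: scalerBr.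
move=> {}x [a [s [sS ->]]].
by apply: span_gen; exists (r * a), s; split=> [//|]; rewrite -scalerA.
Qed.

Definition mscale S (r : R) (q : mquot S) : mquot S := cls (lgen S) (r *: crep q).

Lemma mscaleE S r x : mscale r (cls (lgen S) x) = cls (lgen S) (r *: x).
Proof. by apply/clsP; rewrite -scalerBr; apply: span_lgenZ; exact: crep_cls. Qed.

Lemma mscaleA S (a b : R) (q : mquot S) : mscale a (mscale b q) = mscale (a * b) q.
Proof. by rewrite -[q]crepK !mscaleE scalerA. Qed.
Lemma mscale1 S : left_id 1 (@mscale S).
Proof. by move=> q; rewrite -[q]crepK mscaleE scale1r. Qed.
Lemma mscaleDr S : right_distributive (@mscale S) +%R.
Proof. by move=> a q r; rewrite -[q]crepK -[r]crepK -raddfD !mscaleE -raddfD scalerDr. Qed.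
Lemma mscaleDl S (q : mquot S) : {morph (fun a => mscale a q) : a b / a + b}.
Proof. by move=> a b; rewrite -[q]crepK !mscaleE -raddfD scalerDl. Qed.
HB.instance Definition _ S :=
  GRing.Zmodule_isLmodule.Build R (mquot S) (@mscaleA S) (@mscale1 S) (@mscaleDr S) (@mscaleDl S).

Definition mcls S (v : V) : mquot S := cls (lgen S) v.
Lemma mcls_is_additive S : zmod_morphism (mcls S).
Proof. exact: raddfB. Qed.
Lemma mcls_is_scalable S : scalable (mcls S).
Proof. by move=> r v; rewrite [RHS]mscaleE. Qed.
HB.instance Definition _ S := GRing.isZmodMorphism.Build _ _ (mcls S) (mcls_is_additive S).
HB.instance Definition _ S := GRing.isScalable.Build R V (mquot S) *:%R (mcls S) (mcls_is_scalable S).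

End ModuleQuotient.

Section RingQuotient.
Variable R : pzRingType.
Implicit Type S : R -> Prop.

Definition tgen S : R -> Prop := fun r => exists a s b, S s /\ r = a * s * b.
Definition rquot S : Type := aquot (tgen S).
HB.instance Definition _ S := GRing.Zmodule.on (rquot S).

Lemma span_tgenMl S r x : span (tgen S) x -> span (tgen S) (r * x).
Proof.
apply: (@span_morph _ _ _ ( *%R r)) => [u v|]; first exact: mulrBr.
move=> {}x [a [s [b [sS ->]]]].
by apply: span_gen; exists (r * a), s, b; split=> [//|]; rewrite /= !mulrA.
Qed.
Lemma span_tgenMr S r x : span (tgen S) x -> span (tgen S) (x * r).
Proof.
apply: (@span_morph _ _ _ ( *%R^~ r)) => [u v|]; first exact: mulrBl.
move=> {}x [a [s [b [sS ->]]]].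
by apply: span_gen; exists a, s, (b * r); split=> [//|]; rewrite /= !mulrA.
Qed.

Definition rmul S (p q : rquot S) : rquot S := cls (tgen S) (crep p * crep q).

Lemma rmulE S x y : rmul (cls (tgen S) x) (cls (tgen S) y) = cls (tgen S) (x * y).
Proof.
apply/clsP; set x' := crep _; set y' := crep _.
have -> : x' * y' - x * y = x' * (y' - y) + (x' - x) * y by rewrite mulrBr mulrBl addrA subrK.
by apply: spanD; [apply: span_tgenMl | apply: span_tgenMr]; exact: crep_cls.
Qed.

Lemma rmulA S : associative (@rmul S).
Proof. by move=> p q r; rewrite -[p]crepK -[q]crepK -[r]crepK !rmulE mulrA. Qed.
Lemma rmul1l S : left_id (cls (tgen S) 1) (@rmul S).
Proof. by move=> p; rewrite -[p]crepK rmulE mul1r. Qed.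
Lemma rmul1r S : right_id (cls (tgen S) 1) (@rmul S).
Proof. by move=> p; rewrite -[p]crepK rmulE mulr1. Qed.
Lemma rmulDl S : left_distributive (@rmul S) +%R.
Proof.
by move=> p q r; rewrite -[p]crepK -[q]crepK -[r]crepK -raddfD !rmulE -raddfD mulrDl.
Qed.
Lemma rmulDr S : right_distributive (@rmul S) +%R.
Proof.
by move=> p q r; rewrite -[p]crepK -[q]crepK -[r]crepK -raddfD !rmulE -raddfD mulrDr.
Qed.
HB.instance Definition _ S := GRing.Zmodule_isPzRing.Build (rquot S)
  (@rmulA S) (@rmul1l S) (@rmul1r S) (@rmulDl S) (@rmulDr S).

Definition rcls S (x : R) : rquot S := cls (tgen S) x.
Lemma rcls_is_additive S : zmod_morphism (rcls S).
Proof. exact: raddfB. Qed.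
Lemma rcls_is_monoid S : monoid_morphism (rcls S).
Proof. by split=> // x y; rewrite [RHS]rmulE. Qed.
HB.instance Definition _ S := GRing.isZmodMorphism.Build _ _ (rcls S) (rcls_is_additive S).
HB.instance Definition _ S := GRing.isMonoidMorphism.Build _ _ (rcls S) (rcls_is_monoid S).

End RingQuotient.

Section LHom.
Variables (R : pzRingType) (U V : lmodType R).

Definition lhom := {linear U -> V}.
HB.instance Definition _ := gen_eqMixin lhom.
HB.instance Definition _ := gen_choiceMixin lhom.

Definition lapp (f : lhom) : U -> V := (f : {linear U -> V}).
HB.instance Definition _ (f : lhom) := GRing.Linear.copy (lapp f) (f : {linear U -> V}).

Lemma lhomP (f g : lhom) : (forall u, lapp f u = lapp g u) -> f = g.
Proof.
case: f => f [[a] [b]]; case: g => g [[c] [d]] /funext /= fg.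
rewrite /lapp /= in fg; subst g.
by rewrite (Prop_irrelevance a c) (Prop_irrelevance b d).
Qed.

Definition lhom0 : lhom := \0.
Definition lhomN (f : lhom) : lhom := \- lapp f.
Definition lhomD (f g : lhom) : lhom := lapp f \+ lapp g.

Lemma lhomDA : associative lhomD.
Proof. by move=> f g h; apply: lhomP => u; exact: addrA. Qed.
Lemma lhomDC : commutative lhomD.
Proof. by move=> f g; apply: lhomP => u; exact: addrC. Qed.
Lemma lhom0D : left_id lhom0 lhomD.
Proof. by move=> f; apply: lhomP => u; exact: add0r. Qed.
Lemma lhomND : left_inverse lhom0 lhomN lhomD.
Proof. by move=> f; apply: lhomP => u; exact: addNr. Qed.
HB.instance Definition _ := GRing.isZmodule.Build lhom lhomDA lhomDC lhom0D lhomND.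

Lemma lapp_sum I (r : seq I) P (F : I -> lhom) u :
  lapp (\sum_(i <- r | P i) F i) u = \sum_(i <- r | P i) lapp (F i) u.
Proof. exact: (@big_morph _ _ (fun f : lhom => lapp f u)). Qed.

End LHom.

Section LHomComp.
Variable R : pzRingType.

Definition lcomp (U V W : lmodType R) (f : lhom V W) (g : lhom U V) : lhom U W :=
  lapp f \o lapp g.

End LHomComp.

Section LHomScale.
Variables (R : comPzRingType) (U V : lmodType R).

Definition lhomZ (r : R) (f : lhom U V) : lhom U V := r \*: lapp f.

Lemma lhomZA a b f : lhomZ a (lhomZ b f) = lhomZ (a * b) f.
Proof. by apply: lhomP => u; exact: scalerA. Qed.
Lemma lhomZ1 : left_id 1 lhomZ.
Proof. by move=> f; apply: lhomP => u; exact: scale1r. Qed.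
Lemma lhomZDr : right_distributive lhomZ +%R.
Proof. by move=> a f g; apply: lhomP => u; exact: scalerDr. Qed.
Lemma lhomZDl f : {morph (fun a => lhomZ a f) : a b / a + b}.
Proof. by move=> a b; apply: lhomP => u; exact: scalerDl. Qed.
HB.instance Definition _ :=
  GRing.Zmodule_isLmodule.Build R (lhom U V) lhomZA lhomZ1 lhomZDr lhomZDl.

End LHomScale.

Record idem (R : pzRingType) := Idem { idv : R; idemP : idv * idv = idv }.

Section Corner.
Variables (R : pzRingType) (E : idem R).
Local Notation e := (idv E).

Record corner := Corner { cval : R; cvalP : e * cval * e == cval }.
HB.instance Definition _ := [isSub for cval].
HB.instance Definition _ := [Choice of corner by <:].

Definition cornerb : pred R := fun x => e * x * e == x.
Lemma cornerb_zmod_closed : zmod_closed cornerb.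
Proof.
split=> [|x y /eqP xe /eqP ye]; rewrite /cornerb unfold_in; first by rewrite mulr0 mul0r.
by rewrite mulrBr mulrBl xe ye.
Qed.
HB.instance Definition _ := GRing.isZmodClosed.Build R cornerb cornerb_zmod_closed.
HB.instance Definition _ := GRing.SubChoice_isSubZmodule.Build R cornerb corner cornerb_zmod_closed.

Lemma cornerP (x : corner) : e * cval x = cval x /\ cval x * e = cval x.
Proof.
by split; rewrite -(eqP (cvalP x)); [rewrite !mulrA idemP | rewrite -!mulrA idemP].
Qed.

Lemma cproj_subproof (x : R) : e * (e * x * e) * e == e * x * e.
Proof. by rewrite !mulrA idemP -!mulrA idemP. Qed.
Definition cproj (x : R) : corner := Corner (cproj_subproof x).

Definition cone : corner := cproj 1.
Definition cmul (x y : corner) : corner := cproj (cval x * cval y).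

Lemma cval_mul x y : cval (cmul x y) = cval x * cval y.
Proof. by rewrite /= mulrA (cornerP x).1 -mulrA (cornerP y).2. Qed.
Lemma cval_one : cval cone = e.
Proof. by rewrite /= mulr1 idemP. Qed.

Lemma cmulA : associative cmul.
Proof. by move=> x y z; apply: val_inj; rewrite [LHS]cval_mul [RHS]cval_mul !cval_mul mulrA. Qed.
Lemma cmul1l : left_id cone cmul.
Proof. by move=> x; apply: val_inj; rewrite [LHS]cval_mul cval_one (cornerP x).1. Qed.
Lemma cmul1r : right_id cone cmul.
Proof. by move=> x; apply: val_inj; rewrite [LHS]cval_mul cval_one (cornerP x).2. Qed.
Lemma cmulDl : left_distributive cmul +%R.
Proof.
by move=> x y z; apply: val_inj; rewrite [LHS]cval_mul !(raddfD val) mulrDl; congr (_ + _); rewrite -cval_mul.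
Qed.
Lemma cmulDr : right_distributive cmul +%R.
Proof.
by move=> x y z; apply: val_inj; rewrite [LHS]cval_mul !(raddfD val) mulrDr; congr (_ + _); rewrite -cval_mul.
Qed.
HB.instance Definition _ := GRing.Zmodule_isPzRing.Build corner cmulA cmul1l cmul1r cmulDl cmulDr.

Lemma cvalM (x y : corner) : cval (x * y) = cval x * cval y.
Proof. exact: cval_mul. Qed.
Lemma cvalD (x y : corner) : cval (x + y) = cval x + cval y.
Proof. exact: (raddfD val). Qed.
Lemma cval1 : cval (1 : corner) = e.
Proof. exact: cval_one. Qed.

Record lideal := LIdeal { lval : R; lvalP : lval * e == lval }.
HB.instance Definition _ := [isSub for lval].
HB.instance Definition _ := [Choice of lideal by <:].

Definition lidealb : pred R := fun x => x * e == x.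
Lemma lidealb_zmod_closed : zmod_closed lidealb.
Proof.
split=> [|x y /eqP xe /eqP ye]; rewrite /lidealb unfold_in; first by rewrite mul0r.
by rewrite mulrBl xe ye.
Qed.
HB.instance Definition _ := GRing.SubChoice_isSubZmodule.Build R lidealb lideal lidealb_zmod_closed.

Lemma lidealP (x : lideal) : lval x * e = lval x. Proof. exact/eqP/lvalP. Qed.

Lemma lscale_subproof (r : R) (x : lideal) : r * lval x * e == r * lval x.
Proof. by rewrite -mulrA lidealP. Qed.
Definition lscale r x : lideal := LIdeal (lscale_subproof r x).

Lemma lscaleA a b x : lscale a (lscale b x) = lscale (a * b) x.
Proof. by apply: val_inj; exact: mulrA. Qed.
Lemma lscale1 : left_id 1 lscale.
Proof. by move=> x; apply: val_inj; exact: mul1r. Qed.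
Lemma lscaleDr : right_distributive lscale +%R.
Proof. by move=> a x y; apply: val_inj; exact: mulrDr. Qed.
Lemma lscaleDl x : {morph (fun a => lscale a x) : a b / a + b}.
Proof. by move=> a b; apply: val_inj; exact: mulrDl. Qed.
HB.instance Definition _ := GRing.Zmodule_isLmodule.Build R lideal lscaleA lscale1 lscaleDr lscaleDl.

Lemma lvalD (x y : lideal) : lval (x + y) = lval x + lval y.
Proof. exact: (raddfD val). Qed.

Lemma lmulr_subproof (x : lideal) (c : corner) : lval x * cval c * e == lval x * cval c.
Proof. by rewrite -mulrA (cornerP c).2. Qed.
Definition lmulr x c : lideal := LIdeal (lmulr_subproof x c).

End Corner.

(* Tensor product X (x)_S Y, for a right action ra of S on X and a left *)
(* action la of S on Y.                                                 *)

Section Tensor.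
Variables (X Y : zmodType) (S : Type) (ra : X -> S -> X) (la : S -> Y -> Y).

Definition fpair (x : X) (y : Y) : {freeg (X * Y)%type / int} := << (1 : int) *g (x, y) >>.

Inductive tens_rel : {freeg (X * Y)%type / int} -> Prop :=
| tens_relDl x x' y : tens_rel (fpair (x + x') y - fpair x y - fpair x' y)
| tens_relDr x y y' : tens_rel (fpair x (y + y') - fpair x y - fpair x y')
| tens_relA x s y : tens_rel (fpair (ra x s) y - fpair x (la s y)).

Definition tens : zmodType := aquot tens_rel.
Definition pure (x : X) (y : Y) : tens := cls tens_rel (fpair x y).

Lemma pureDl x x' y : pure (x + x') y = pure x y + pure x' y.
Proof.
apply/eqP; rewrite -subr_eq0 opprD addrA -!raddfB; apply/eqP; apply: cls_gen.
exact: tens_relDl.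
Qed.
Lemma pureDr x y y' : pure x (y + y') = pure x y + pure x y'.
Proof.
apply/eqP; rewrite -subr_eq0 opprD addrA -!raddfB; apply/eqP; apply: cls_gen.
exact: tens_relDr.
Qed.
Lemma pureA x s y : pure (ra x s) y = pure x (la s y).
Proof.
apply/eqP; rewrite -subr_eq0 -!raddfB; apply/eqP; apply: cls_gen.
exact: tens_relA.
Qed.
Lemma pureBl x x' y : pure (x - x') y = pure x y - pure x' y.
Proof. by apply/eqP; rewrite -subr_eq opprK -pureDl subrK. Qed.
Lemma pureBr x y y' : pure x (y - y') = pure x y - pure x y'.
Proof. by apply/eqP; rewrite -subr_eq opprK -pureDr subrK. Qed.
Lemma pure0l y : pure 0 y = 0.
Proof. by rewrite -(subrr 0) pureBl subrr. Qed.
Lemma pureNl x y : pure (- x) y = - pure x y.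
Proof. by rewrite -sub0r pureBl pure0l sub0r. Qed.

Lemma tens_ind (P : tens -> Prop) :
  P 0 -> (forall x y, P (pure x y)) -> (forall t u, P t -> P u -> P (t + u)) ->
  forall t, P t.
Proof.
move=> P0 Pp PD t; rewrite -[t]crepK -(freeg_sumE (crep t)) raddf_sum /=.
elim/big_rec: _ => // -[x y] u _ Pu; apply: (PD) => //.
set c := coeff _ _; suff PN : forall n : nat, P (cls tens_rel (fpair x y *+ n)) /\
    P (cls tens_rel (- (fpair x y *+ n))).
  have -> : << c *g (x, y) >> = fpair x y *~ c by rewrite /fpair freegU_mulz intz.
  by case: c => n; [exact: (PN n).1 | exact: (PN n.+1).2].
elim=> [|n [IH1 IH2]]; first by rewrite mulr0n oppr0 raddf0.
rewrite mulrS opprD !raddfD; split; apply: (PD) => //; first exact: Pp.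
by have := Pp (- x) y; rewrite pureNl -raddfN.
Qed.

Section Lift.
Variables (W : zmodType) (f : X -> Y -> W).
Let fz (p : X * Y) : zmodule W := f p.1 p.2.

Definition balanced : Prop :=
  [/\ forall x x' y, f (x + x') y = f x y + f x' y,
      forall x y y', f x (y + y') = f x y + f x y'
    & forall x s y, f (ra x s) y = f x (la s y)].

(* The additive map with x (x) y |-> f x y, meaningful when f is balanced. *)
Definition tlift (t : tens) : W :=
  fglift fz (crep t).

Hypothesis fbal : balanced.

Lemma fglift_rel z : span tens_rel z -> fglift fz z = 0.
Proof.
have FB := lift_is_additive fz.
have FU x y : fglift fz (fpair x y) = f x y.
  by rewrite /fpair liftU scale1r.
case: fbal => fDl fDr fA.
elim=> [|{}z [x x' y|x y y'|x s y]|{}z z' _ IH _ IH'].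
- by rewrite -(subrr 0) FB subrr.
- by rewrite !FB !FU /= fDl (addrAC _ (- _)) addrK subrr.
- by rewrite !FB !FU /= fDr (addrAC _ (- _)) addrK subrr.
- by rewrite !FB !FU /= fA subrr.
- by rewrite FB IH IH' subr0.
Qed.

Lemma tliftE x y : tlift (pure x y) = f x y.
Proof.
have FB := lift_is_additive fz.
apply/eqP; rewrite -subr_eq0; apply/eqP.
have -> : f x y = fglift fz (fpair x y).
  by rewrite /fpair liftU scale1r.
by rewrite -[LHS]FB; apply: fglift_rel; exact: crep_cls.
Qed.

Lemma tliftB : zmod_morphism tlift.
Proof.
have FB := lift_is_additive fz.
move=> t u; apply/eqP; rewrite -subr_eq0; apply/eqP; rewrite /tlift -!FB.
apply: fglift_rel; apply/clsP; by rewrite crepK raddfB /= !crepK.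
Qed.

Lemma tliftD t u : tlift (t + u) = tlift t + tlift u.
Proof. by have /= := tliftB (t + u) u; rewrite addrK => ->; rewrite subrK. Qed.

Lemma tlift0 : tlift 0 = 0.
Proof. by rewrite -(subrr 0) tliftB subrr. Qed.

End Lift.
End Tensor.

Section Extension.
Variable K : fieldType.

Definition zract (X : zmodType) (x : X) (m : int) : X := x *~ m.
Definition zlact (X : zmodType) (m : int) (x : X) : X := x *~ m.
Definition tensK (X : zmodType) : zmodType := tens (@zract X) (@zlact K).
Definition pureK (X : zmodType) (x : X) (c : K) : tensK X := pure (@zract X) (@zlact K) x c.

Definition biadditive (X Y Z : zmodType) (f : X -> Y -> Z) :=
  (forall x x' y, f (x + x') y = f x y + f x' y) /\
  (forall x y y', f x (y + y') = f x y + f x y').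

Lemma additive_mulrz (X Z : zmodType) (g : X -> Z) :
  (forall x y, g (x + y) = g x + g y) -> forall x m, g (x *~ m) = g x *~ m.
Proof.
move=> gD x m; have g0 : g 0 = 0 by apply: (addrI (g 0)); rewrite -gD !addr0.
have gN y : g (- y) = - g y by apply: (addrI (g y)); rewrite -gD !subrr.
have gn (n : nat) : g (x *+ n) = g x *+ n.
  by elim: n => [|n IH]; rewrite ?mulr0n // !mulrS gD IH.
by case: m => n; rewrite -?pmulrn ?NegzE ?mulrNz -?pmulrn ?gN gn.
Qed.

Lemma biadditive_bal (X Y Z : zmodType) (f : X -> Y -> Z) :
  biadditive f -> balanced (@zract X) (@zlact Y) f.
Proof.
move=> [fl fr]; split=> // x m y; rewrite /zract /zlact.
by rewrite (additive_mulrz (g := f^~ y)) ?(additive_mulrz (g := f x)).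
Qed.

Section Op.
Variables (X Y Z : zmodType) (f : X -> Y -> Z).

(* (x (x) c, y (x) d) |-> f x y (x) c d *)
Definition extop (t : tensK X) (u : tensK Y) : tensK Z :=
  tlift (fun x c => tlift (fun y d => pureK (f x y) (c * d)) u) t.

Hypothesis fbi : biadditive f.

Lemma extop_in x c : balanced (@zract Y) (@zlact K) (fun y d => pureK (f x y) (c * d)).
Proof.
case: fbi => _ fr; apply: biadditive_bal; split=> [y y' d|y d d'].
  by rewrite fr; exact: pureDl.
by rewrite mulrDr; exact: pureDr.
Qed.

Lemma extop_out (u : tensK Y) :
  balanced (@zract X) (@zlact K) (fun x c => tlift (fun y d => pureK (f x y) (c * d)) u).
Proof.
case: fbi => fl _; apply: biadditive_bal; split=> [x x' c|x c c'].
  elim/tens_ind: u => [|y d|t u IHt IHu].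
  - by rewrite !(tlift0 (extop_in _ _)) addr0.
  - by rewrite !(tliftE (extop_in _ _)) fl; exact: pureDl.
  - by rewrite !(tliftD (extop_in _ _)) IHt IHu addrACA.
elim/tens_ind: u => [|y d|t u IHt IHu].
- by rewrite !(tlift0 (extop_in _ _)) addr0.
- by rewrite !(tliftE (extop_in _ _)) mulrDl; exact: pureDr.
- by rewrite !(tliftD (extop_in _ _)) IHt IHu addrACA.
Qed.

Lemma extopE x c y d : extop (pureK x c) (pureK y d) = pureK (f x y) (c * d).
Proof. by rewrite /extop (tliftE (extop_out _)) (tliftE (extop_in _ _)). Qed.

Lemma extop_biadditive : biadditive extop.
Proof.
split=> [t t' u|t u u']; first exact: (tliftD (extop_out u)).
elim/tens_ind: t => [|x c|t t' IH IH'].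
- by rewrite /extop !(tlift0 (extop_out _)) addr0.
- by rewrite /extop !(tliftE (extop_out _)) (tliftD (extop_in _ _)).
- by rewrite /extop !(tliftD (extop_out _)) -!/(extop _ _) IH IH' addrACA.
Qed.

End Op.

Lemma additive_ext (X W : zmodType) (f g : tensK X -> W) :
  (forall t u, f (t + u) = f t + f u) -> (forall t u, g (t + u) = g t + g u) ->
  (forall x c, f (pureK x c) = g (pureK x c)) -> forall t, f t = g t.
Proof.
move=> fD gD fg; elim/tens_ind=> [|x c|t u IHt IHu]; first 1 last.
- exact: fg.
- by rewrite fD gD IHt IHu.
have f0 : f 0 = 0 by apply: (addrI (f 0)); rewrite -fD !addr0.
have g0 : g 0 = 0 by apply: (addrI (g 0)); rewrite -gD !addr0.
by rewrite f0 g0.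
Qed.

Section ExtMap.
Variables (X Y : zmodType) (f : {additive X -> Y}).

Definition extmap (t : tensK X) : tensK Y := tlift (fun x c => pureK (f x) c) t.

Lemma extmap_bal : balanced (@zract X) (@zlact K) (fun x c => pureK (f x) c).
Proof.
apply: biadditive_bal; split=> [x x' c|x c c']; last exact: pureDr.
by rewrite raddfD; exact: pureDl.
Qed.
Lemma extmapE x c : extmap (pureK x c) = pureK (f x) c.
Proof. exact: (tliftE extmap_bal). Qed.
Lemma extmapD t u : extmap (t + u) = extmap t + extmap u.
Proof. exact: (tliftD extmap_bal). Qed.
Lemma extmapB : zmod_morphism extmap.
Proof. exact: (tliftB extmap_bal). Qed.
End ExtMap.

Section ExtRing.
Variable R : pzRingType.

Definition extring : Type := tensK R.
HB.instance Definition _ := GRing.Zmodule.on extring.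

Definition emul : extring -> extring -> extring := extop *%R.
Definition eone : extring := pureK 1 1.

Lemma mul_biadditive : biadditive ( *%R : R -> R -> R).
Proof. by split=> *; rewrite (mulrDl, mulrDr). Qed.
Let bi := mul_biadditive.

Lemma emulDl : left_distributive emul +%R.
Proof. by move=> t u v; exact: (extop_biadditive bi).1. Qed.
Lemma emulDr : right_distributive emul +%R.
Proof. by move=> t u v; exact: (extop_biadditive bi).2. Qed.
Lemma emulA : associative emul.
Proof.
move=> t u v; move: t; apply: (@additive_ext R (tensK R)) => [t t'|t t'|x c].
- exact: emulDl.
- by rewrite -!emulDl.
move: u; apply: (@additive_ext R (tensK R)) => [u u'|u u'|y d].
- by rewrite -emulDr -emulDl.
- by rewrite -emulDl -emulDr.
move: v; apply: (@additive_ext R (tensK R)) => [v v'|v v'|z e].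
- by rewrite -!emulDr.
- by rewrite -!emulDr.
by rewrite /emul !(extopE bi) !mulrA.
Qed.
Lemma emul1l : left_id eone emul.
Proof.
apply: (@additive_ext R (tensK R)) => [t u|//|x c]; first exact: emulDr.
by rewrite /emul (extopE bi) !mul1r.
Qed.
Lemma emul1r : right_id eone emul.
Proof.
apply: (@additive_ext R (tensK R)) => [t u|//|x c]; first exact: emulDl.
by rewrite /emul (extopE bi) !mulr1.
Qed.
HB.instance Definition _ :=
  GRing.Zmodule_isPzRing.Build extring emulA emul1l emul1r emulDl emulDr.

Definition escal (c : K) : extring := pureK 1 c.

Lemma extmulE x c y d :
  (pureK x c : extring) * (pureK y d : extring) = pureK (x * y) (c * d).
Proof. exact: (extopE bi). Qed.

End ExtRing.

Section ExtMorphism.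
Variables (R S : pzRingType) (f : {rmorphism R -> S}).

Definition extmor (t : extring R) : extring S := extmap f t.

Lemma extmor_is_additive : zmod_morphism extmor.
Proof. exact: extmapB. Qed.
Lemma extmorD (t u : extring R) : extmor (t + u) = extmor t + extmor u.
Proof. exact: extmapD. Qed.
Lemma extmor_is_monoid : monoid_morphism extmor.
Proof.
split; first by rewrite [LHS]extmapE; congr pureK; exact: rmorph1.
move=> t u; move: t; apply: (@additive_ext R (tensK S)) => [t t'|t t'|x c].
- exact: etrans (congr1 extmor (mulrDl (t : extring R) t' u)) (extmorD _ _).
- exact: etrans (congr1 ( *%R^~ (extmor u)) (extmorD t t')) (mulrDl _ _ _).
move: u; apply: (@additive_ext R (tensK S)) => [u u'|u u'|y d].
- exact: etrans (congr1 extmor (mulrDr (pureK x c : extring R) u u')) (extmorD _ _).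
- exact: etrans (congr1 ( *%R (extmor (pureK x c))) (extmorD u u')) (mulrDr _ _ _).
rewrite [in LHS]extmulE /extmor !extmapE [RHS]extmulE; congr pureK; exact: rmorphM.
Qed.
HB.instance Definition _ := GRing.isZmodMorphism.Build _ _ extmor extmor_is_additive.
HB.instance Definition _ := GRing.isMonoidMorphism.Build _ _ extmor extmor_is_monoid.

End ExtMorphism.
End Extension.

(* Graded rings, bimodules and modules.  The records below only carry   *)
(* the homogeneous parts of each degree; that the parts of a module     *)
(* form a direct sum decomposition is required in [is_fmod].            *)

Record gring := GRingPack { gcar :> pzRingType; gdeg : int -> gcar -> Prop }.

Definition gcorner (R : gring) (e : idem R) : gring :=
  @GRingPack (corner e) (fun d x => gdeg d (cval x)).

Definition gext (K : fieldType) (R : gring) : gring :=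
  @GRingPack (extring K R) (fun d =>
    span (fun t : tensK K R => exists (b : R) c, gdeg d b /\ t = pureK b c)).

Record bimod (R S : gring) := Bimod {
  bcar :> lmodType R;
  bact : bcar -> S -> bcar;
  bdeg : int -> bcar -> Prop;
  bactDl : forall p q s, bact (p + q) s = bact p s + bact q s;
  bactDr : forall p s t, bact p (s + t) = bact p s + bact p t;
  bact1 : forall p, bact p 1 = p;
  bactA : forall p s t, bact (bact p s) t = bact p (s * t);
  bactZ : forall r p s, bact (r *: p) s = r *: bact p s }.

(* The (R, S)-bimodule R e, where S acts on the right through chi. *)
Section IdealBimod.
Variables (R S : gring) (e : idem R) (chi : {rmorphism S -> corner e}).

Definition ib_act (p : lideal e) (s : S) : lideal e := lmulr p (chi s).

Lemma ib_actDl p q s : ib_act (p + q) s = ib_act p s + ib_act q s.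
Proof. by apply: val_inj; exact: mulrDl. Qed.
Lemma ib_actDr p s t : ib_act p (s + t) = ib_act p s + ib_act p t.
Proof. by apply: val_inj; rewrite /= rmorphD cvalD; exact: mulrDr. Qed.
Lemma ib_act1 p : ib_act p 1 = p.
Proof. by apply: val_inj; rewrite /= rmorph1 cval1; exact: lidealP. Qed.
Lemma ib_actA p s t : ib_act (ib_act p s) t = ib_act p (s * t).
Proof. by apply: val_inj; rewrite /= rmorphM cvalM mulrA. Qed.
Lemma ib_actZ r p s : ib_act (r *: p) s = r *: ib_act p s.
Proof. by apply: val_inj; rewrite /= mulrA. Qed.

Definition ideal_bimod : bimod R S :=
  @Bimod R S (lideal e) ib_act (fun d p => gdeg d (lval p))
    ib_actDl ib_actDr ib_act1 ib_actA ib_actZ.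

End IdealBimod.

(* The (S, R)-bimodule Hom_R(P, R): (s phi r)(p) = phi (p s) r. *)
Section HomBimod.
Variables (R S : gring) (P : bimod R S).

Definition homb : Type := lhom P ((R : pzRingType)^o).
HB.instance Definition _ := GRing.Zmodule.on homb.

Definition hb_lfun (s : S) (phi : homb) (p : P) : R^o := lapp phi (bact p s).
Lemma hb_lfunB s phi : zmod_morphism (hb_lfun s phi).
Proof.
move=> p q; rewrite /hb_lfun -raddfB; congr (lapp _ _).
by apply: (addIr (bact q s)); rewrite -bactDl !subrK.
Qed.
Lemma hb_lfunZ s phi : scalable (hb_lfun s phi).
Proof. by move=> r p; rewrite /hb_lfun bactZ linearZ. Qed.
HB.instance Definition _ s phi := GRing.isZmodMorphism.Build _ _ (hb_lfun s phi) (hb_lfunB s phi).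
HB.instance Definition _ s phi := GRing.isScalable.Build R P R^o *:%R (hb_lfun s phi) (hb_lfunZ s phi).
Definition hb_scale s phi : homb := hb_lfun s phi.

Definition hb_rfun (phi : homb) (r : R) (p : P) : R^o := lapp phi p * r.
Lemma hb_rfunB phi r : zmod_morphism (hb_rfun phi r).
Proof. by move=> p q; rewrite /hb_rfun raddfB; exact: mulrBl. Qed.
Lemma hb_rfunZ phi r : scalable (hb_rfun phi r).
Proof. by move=> a p; rewrite /hb_rfun linearZ; exact/esym/mulrA. Qed.
HB.instance Definition _ phi r := GRing.isZmodMorphism.Build _ _ (hb_rfun phi r) (hb_rfunB phi r).
HB.instance Definition _ phi r := GRing.isScalable.Build R P R^o *:%R (hb_rfun phi r) (hb_rfunZ phi r).
Definition hb_act phi r : homb := hb_rfun phi r.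

Lemma hb_scaleA a b phi : hb_scale a (hb_scale b phi) = hb_scale (a * b) phi.
Proof. by apply: lhomP => p; rewrite /= /hb_scale /lapp /= /hb_lfun /lapp /= /hb_lfun bactA. Qed.
Lemma hb_scale1 : left_id 1 hb_scale.
Proof. by move=> phi; apply: lhomP => p; rewrite /lapp /= /hb_lfun bact1. Qed.
Lemma hb_scaleDr : right_distributive hb_scale +%R.
Proof. by move=> a f g; apply: lhomP => p. Qed.
Lemma hb_scaleDl phi : {morph (fun a => hb_scale a phi) : a b / a + b}.
Proof.
by move=> a b; apply: lhomP => p; rewrite [LHS]/lapp /= /hb_lfun bactDr raddfD.
Qed.
HB.instance Definition _ :=
  GRing.Zmodule_isLmodule.Build S homb hb_scaleA hb_scale1 hb_scaleDr hb_scaleDl.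

Lemma hb_actDl (p q : homb) s : hb_act (p + q) s = hb_act p s + hb_act q s.
Proof. by apply: lhomP => x; exact: mulrDl. Qed.
Lemma hb_actDr (p : homb) s t : hb_act p (s + t) = hb_act p s + hb_act p t.
Proof. by apply: lhomP => x; exact: mulrDr. Qed.
Lemma hb_act1 (p : homb) : hb_act p 1 = p.
Proof. by apply: lhomP => x; exact: mulr1. Qed.
Lemma hb_actA (p : homb) s t : hb_act (hb_act p s) t = hb_act p (s * t).
Proof. by apply: lhomP => x; exact/esym/mulrA. Qed.
Lemma hb_actZ r (p : homb) s : hb_act (r *: p) s = r *: hb_act p s.
Proof. by apply: lhomP. Qed.

Definition hom_bimod : bimod S R :=
  @Bimod S R homb hb_act
    (fun d phi => forall j (p : P), bdeg j p -> gdeg (j + d) (lapp phi p : R))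
    hb_actDl hb_actDr hb_act1 hb_actA hb_actZ.

End HomBimod.

Section ExtBimod.
Variables (K : fieldType) (R S : gring) (P : bimod R S).

Definition extmod : Type := tensK K P.
HB.instance Definition _ := GRing.Zmodule.on extmod.

Lemma scale_biadditive : biadditive ( *:%R : R -> P -> P).
Proof. by split=> *; rewrite (scalerDl, scalerDr). Qed.
Lemma bact_biadditive : biadditive (bact (b := P)).
Proof. by split=> *; rewrite (bactDl, bactDr). Qed.
Let bil := scale_biadditive.
Let bir := bact_biadditive.

Definition em_scale : extring K R -> extmod -> extmod := @extop K R P P *:%R.
Definition em_act : extmod -> extring K S -> extmod := @extop K P S P (bact (b := P)).

Lemma em_scaleDr : right_distributive em_scale +%R.
Proof. by move=> t u v; exact: (extop_biadditive K bil).2. Qed.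
Lemma em_scaleDl u : {morph (fun a => em_scale a u) : a b / a + b}.
Proof. by move=> a b; exact: (extop_biadditive K bil).1. Qed.
Lemma em_actDl p q s : em_act (p + q) s = em_act p s + em_act q s.
Proof. exact: (extop_biadditive K bir).1. Qed.
Lemma em_actDr p s t : em_act p (s + t) = em_act p s + em_act p t.
Proof. exact: (extop_biadditive K bir).2. Qed.

Lemma em_scaleA a b u : em_scale a (em_scale b u) = em_scale (a * b) u.
Proof.
move: a; apply: (@additive_ext K R (tensK K P)) => [t t'|t t'|x c].
- exact: em_scaleDl.
- exact: etrans (congr1 (em_scale^~ u) (mulrDl (t : extring K R) t' b)) (em_scaleDl _ _ _).
move: b; apply: (@additive_ext K R (tensK K P)) => [t t'|t t'|y d].
- exact: etrans (congr1 (em_scale _) (em_scaleDl _ _ _)) (em_scaleDr _ _ _).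
- exact: etrans (congr1 (em_scale^~ u) (mulrDr (pureK x c : extring K R) t t')) (em_scaleDl _ _ _).
move: u; apply: (@additive_ext K P (tensK K P)) => [t t'|t t'|z e].
- exact: etrans (congr1 (em_scale _) (em_scaleDr _ _ _)) (em_scaleDr _ _ _).
- exact: em_scaleDr.
by rewrite extmulE /em_scale !(extopE bil) scalerA mulrA.
Qed.

Lemma em_scale1 : left_id 1 em_scale.
Proof.
apply: (@additive_ext K P (tensK K P)) => [t t'|//|x c]; first exact: em_scaleDr.
by rewrite /em_scale (extopE bil) scale1r mul1r.
Qed.
HB.instance Definition _ := GRing.Zmodule_isLmodule.Build (extring K R) extmod
  em_scaleA em_scale1 em_scaleDr em_scaleDl.

Lemma em_act1 p : em_act p 1 = p.
Proof.
move: p; apply: (@additive_ext K P (tensK K P)) => [t t'|//|x c]; first exact: em_actDl.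
by rewrite /em_act (extopE bir) bact1 mulr1.
Qed.

Lemma em_actA p s t : em_act (em_act p s) t = em_act p (s * t).
Proof.
move: p; apply: (@additive_ext K P (tensK K P)) => [u u'|u u'|x c].
- exact: etrans (congr1 (em_act^~ t) (em_actDl _ _ _)) (em_actDl _ _ _).
- exact: em_actDl.
move: s; apply: (@additive_ext K S (tensK K P)) => [s s'|s s'|y d].
- exact: etrans (congr1 (em_act^~ t) (em_actDr _ _ _)) (em_actDl _ _ _).
- exact: etrans (congr1 (em_act _) (mulrDl (s : extring K S) s' t)) (em_actDr _ _ _).
move: t; apply: (@additive_ext K S (tensK K P)) => [t t'|t t'|z e].
- exact: em_actDr.
- exact: etrans (congr1 (em_act _) (mulrDr (pureK y d : extring K S) t t')) (em_actDr _ _ _).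
by rewrite extmulE /em_act !(extopE bir) bactA mulrA.
Qed.

Lemma em_actZ r (p : extmod) s : em_act (r *: p) s = r *: em_act p s.
Proof.
rewrite /GRing.scale /=.
move: r; apply: (@additive_ext K R (tensK K P)) => [t t'|t t'|x c].
- exact: etrans (congr1 (em_act^~ s) (em_scaleDl _ _ _)) (em_actDl _ _ _).
- exact: em_scaleDl.
move: p; apply: (@additive_ext K P (tensK K P)) => [t t'|t t'|y d].
- exact: etrans (congr1 (em_act^~ s) (em_scaleDr _ _ _)) (em_actDl _ _ _).
- exact: etrans (congr1 (em_scale _) (em_actDl _ _ _)) (em_scaleDr _ _ _).
move: s; apply: (@additive_ext K S (tensK K P)) => [t t'|t t'|z e].
- exact: em_actDr.
- exact: etrans (congr1 (em_scale _) (em_actDr _ _ _)) (em_scaleDr _ _ _).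
by rewrite /em_act /em_scale (extopE bil) !(extopE bir) (extopE bil) bactZ mulrA.
Qed.

Definition ext_bimod : bimod (gext K R) (gext K S) :=
  @Bimod (gext K R) (gext K S) extmod em_act
    (fun d => span (fun t : tensK K P => exists (p : P) c, bdeg d p /\ t = pureK p c))
    em_actDl em_actDr em_act1 em_actA em_actZ.

End ExtBimod.

Record gmod (R : gring) := GMod { mcar :> lmodType R; hdeg : int -> mcar -> Prop }.

Record gmor (R : gring) (M N : gmod R) := GMor {
  mfun :> {linear M -> N};
  mfunP : forall d x, hdeg d x -> hdeg d (mfun x) }.

Lemma gid_subproof (R : gring) (M : gmod R) d (x : M) : hdeg d x -> hdeg d (idfun x).
Proof. by []. Qed.
Definition gid (R : gring) (M : gmod R) : gmor M M := GMor (mfun := idfun) (@gid_subproof R M).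

Lemma gcomp_subproof (R : gring) (M N L : gmod R) (g : gmor N L) (f : gmor M N) d (x : M) :
  hdeg d x -> hdeg d ((g \o f) x).
Proof. by move=> /(mfunP f) /(mfunP g). Qed.
Definition gcomp (R : gring) (M N L : gmod R) (g : gmor N L) (f : gmor M N) : gmor M L :=
  GMor (mfun := g \o f) (gcomp_subproof g f).

Record gfunctor (R S : gring) := GFunctor {
  fobj :> gmod R -> gmod S;
  fmap : forall M N : gmod R, gmor M N -> gmor (fobj M) (fobj N);
  fmap_id : forall M x, fmap (gid M) x = x;
  fmap_comp : forall (M N L : gmod R) (g : gmor N L) (f : gmor M N) x,
    fmap (gcomp g f) x = fmap g (fmap f x) }.

Section FunctorComp.
Variables (R S T : gring) (G : gfunctor S T) (F : gfunctor R S).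

Definition fc_map (M N : gmod R) (f : gmor M N) : gmor (G (F M)) (G (F N)) :=
  fmap G (fmap F f).

Lemma gmor_ext (Q : gring) (M N : gmod Q) (f g : gmor M N) : (forall x, f x = g x) -> f = g.
Proof.
case: f => f fP; case: g => g gP /= fg.
have e : f = g by exact: (@lhomP Q M N f g fg).
by subst g; rewrite (Prop_irrelevance fP gP).
Qed.

Lemma fc_id M x : fc_map (gid M) x = x.
Proof.
rewrite /fc_map; have -> : fmap F (gid M) = gid (F M) by apply: gmor_ext => y; exact: fmap_id.
exact: fmap_id.
Qed.
Lemma fc_comp (M N L : gmod R) (g : gmor N L) (f : gmor M N) x :
  fc_map (gcomp g f) x = fc_map g (fc_map f x).
Proof.
rewrite /fc_map; have -> : fmap F (gcomp g f) = gcomp (fmap F g) (fmap F f).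
  by apply: gmor_ext => y; exact: fmap_comp.
exact: fmap_comp.
Qed.

Definition fcomp : gfunctor R T := @GFunctor R T (fun M => G (F M)) fc_map fc_id fc_comp.
End FunctorComp.

Section Inflation.
Variables (R S : gring) (f : {rmorphism R -> S}).

Section Obj.
Variable M : gmod S.
Definition inflm : Type := M.
HB.instance Definition _ := GRing.Zmodule.on inflm.
Definition infl_scale (r : R) (m : inflm) : inflm := f r *: (m : M).
Lemma infl_scaleA a b m : infl_scale a (infl_scale b m) = infl_scale (a * b) m.
Proof. by rewrite /infl_scale rmorphM; exact: scalerA. Qed.
Lemma infl_scale1 : left_id 1 infl_scale.
Proof. by move=> m; rewrite /infl_scale rmorph1; exact: scale1r. Qed.
Lemma infl_scaleDr : right_distributive infl_scale +%R.
Proof. by move=> a m m'; exact: scalerDr. Qed.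
Lemma infl_scaleDl m : {morph (fun a => infl_scale a m) : a b / a + b}.
Proof. by move=> a b; rewrite /infl_scale rmorphD; exact: scalerDl. Qed.
HB.instance Definition _ :=
  GRing.Zmodule_isLmodule.Build R inflm infl_scaleA infl_scale1 infl_scaleDr infl_scaleDl.
Definition infl_obj : gmod R := @GMod R inflm (fun d (m : inflm) => hdeg d (m : M)).
End Obj.

Section Mor.
Variables (M N : gmod S) (g : gmor M N).
Definition infl_fun (m : inflm M) : inflm N := g m.
Lemma infl_funB : zmod_morphism infl_fun.
Proof. by move=> x y; exact: (raddfB g). Qed.
Lemma infl_funZ : scalable infl_fun.
Proof. by move=> r x; exact: (linearZ_LR g (f r) x). Qed.
HB.instance Definition _ := GRing.isZmodMorphism.Build _ _ infl_fun infl_funB.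
HB.instance Definition _ :=
  GRing.isScalable.Build R (inflm M) (inflm N) *:%R infl_fun infl_funZ.
Lemma infl_fun_deg d (x : infl_obj M) : hdeg d x -> hdeg (g := infl_obj N) d (infl_fun x).
Proof. exact: (@mfunP S M N g d x). Qed.
Definition infl_map : gmor (infl_obj M) (infl_obj N) :=
  @GMor R (infl_obj M) (infl_obj N) infl_fun infl_fun_deg.
End Mor.

Definition infl : gfunctor S R :=
  @GFunctor S R infl_obj infl_map (fun _ _ => erefl) (fun _ _ _ _ _ _ => erefl).

End Inflation.

(* The functor P (x)_S - ; the degree d part of P (x)_S M is spanned by *)
(* the p (x) m with deg p + deg m = d.                                  *)
Section TensorFunctor.
Variables (R S : gring) (P : bimod R S).

Section Obj.
Variable M : gmod S.
Definition tmod : Type := tens (bact (b := P)) ( *:%R : S -> M -> M).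
HB.instance Definition _ := GRing.Zmodule.on tmod.
Definition tpure (p : P) (m : M) : tmod := pure (bact (b := P)) *:%R p m.

Definition tm_scale (r : R) : tmod -> tmod := tlift (fun p m => tpure (r *: p) m).

Lemma tm_bal r : balanced (bact (b := P)) *:%R (fun p (m : M) => tpure (r *: p) m : tens _ _).
Proof.
split=> [p p' m|p m m'|p s m]; first by rewrite scalerDr; exact: pureDl.
  exact: pureDr.
by rewrite -bactZ; exact: pureA.
Qed.

Lemma tm_scaleE r p m : tm_scale r (tpure p m) = tpure (r *: p) m.
Proof. exact: (tliftE (tm_bal r)). Qed.
Lemma tm_scaleDr : right_distributive tm_scale +%R.
Proof. by move=> a; exact: (tliftD (tm_bal a)). Qed.
Lemma tm_scale0 a : tm_scale a 0 = 0.
Proof. exact: (tlift0 (tm_bal a)). Qed.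
Lemma tmod_ind (Q : tmod -> Prop) :
  Q 0 -> (forall p m, Q (tpure p m)) -> (forall t u, Q t -> Q u -> Q (t + u)) -> forall t, Q t.
Proof. exact: tens_ind. Qed.
Lemma tm_scaleA a b m : tm_scale a (tm_scale b m) = tm_scale (a * b) m.
Proof.
elim/tmod_ind: m => [|p m|t u IHt IHu]; first by rewrite !tm_scale0.
  by rewrite !tm_scaleE scalerA.
by rewrite !tm_scaleDr IHt IHu.
Qed.
Lemma tm_scale1 : left_id 1 tm_scale.
Proof.
elim/tmod_ind=> [|p m|t u IHt IHu]; first by rewrite !tm_scale0.
  by rewrite !tm_scaleE scale1r.
by rewrite !tm_scaleDr IHt IHu.
Qed.
Lemma tm_scaleDl m : {morph (fun a => tm_scale a m) : a b / a + b}.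
Proof.
move=> a b; elim/tmod_ind: m => [|p m|t u IHt IHu]; first by rewrite !tm_scale0 addr0.
  by rewrite !tm_scaleE scalerDl; exact: pureDl.
by rewrite !tm_scaleDr IHt IHu addrACA.
Qed.
HB.instance Definition _ :=
  GRing.Zmodule_isLmodule.Build R tmod tm_scaleA tm_scale1 tm_scaleDr tm_scaleDl.

Definition tdeg (d : int) : tmod -> Prop :=
  span (fun t : tens (bact (b := P)) ( *:%R : S -> M -> M) =>
    exists i j p m, [/\ i + j = d, bdeg i p, hdeg j m & t = tpure p m]).
Definition tens_obj : gmod R := @GMod R tmod tdeg.
End Obj.

Section Mor.
Variables (M N : gmod S) (g : gmor M N).
Definition tm_fun : tmod M -> tmod N := tlift (fun p m => tpure p (g m)).

Lemma tmf_bal : balanced (bact (b := P)) *:%R (fun p (m : M) => tpure p (g m) : tens _ _).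
Proof.
split=> [p p' m|p m m'|p s m]; first exact: pureDl.
  by rewrite raddfD; exact: pureDr.
by rewrite linearZ; exact: pureA.
Qed.
Lemma tm_funE p m : tm_fun (tpure p m) = tpure p (g m).
Proof. exact: (tliftE tmf_bal). Qed.
Lemma tm_funB : zmod_morphism tm_fun.
Proof. exact: (tliftB tmf_bal). Qed.
Lemma tm_funD t u : tm_fun (t + u) = tm_fun t + tm_fun u.
Proof. exact: (tliftD tmf_bal). Qed.
Lemma tm_fun0 : tm_fun 0 = 0.
Proof. exact: (tlift0 tmf_bal). Qed.
Lemma tm_funZ : scalable tm_fun.
Proof.
move=> r; rewrite /GRing.scale /=; elim/tmod_ind=> [|p m|t u IHt IHu].
- by rewrite tm_scale0 tm_fun0 tm_scale0.
- by rewrite tm_scaleE !tm_funE tm_scaleE.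
- by rewrite tm_scaleDr !tm_funD IHt IHu tm_scaleDr.
Qed.
HB.instance Definition _ := GRing.isZmodMorphism.Build _ _ tm_fun tm_funB.
HB.instance Definition _ := GRing.isScalable.Build R (tmod M) (tmod N) *:%R tm_fun tm_funZ.
Lemma tm_fun_deg d (x : tens_obj M) : hdeg d x -> hdeg (g := tens_obj N) d (tm_fun x).
Proof.
apply: span_morph; first exact: tm_funB.
move=> _ [i [j [p [m [ij pi mj ->]]]]]; apply: span_gen.
by exists i, j, p, (g m); split=> //; [exact: mfunP | exact: tm_funE].
Qed.
Definition tens_map : gmor (tens_obj M) (tens_obj N) :=
  @GMor R (tens_obj M) (tens_obj N) tm_fun tm_fun_deg.
End Mor.

Lemma tens_map_id M x : tens_map (gid M) x = x.
Proof.
move: x; apply: tmod_ind => [|p m|t u IHt IHu]; first exact: tm_fun0.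
  exact: tm_funE.
by rewrite [LHS]tm_funD; congr (_ + _).
Qed.
Lemma tens_map_comp (M N L : gmod S) (g : gmor N L) (f : gmor M N) x :
  tens_map (gcomp g f) x = tens_map g (tens_map f x).
Proof.
move: x; apply: tmod_ind => [|p m|t u IHt IHu].
- by rewrite /= !tm_fun0.
- by rewrite /= !tm_funE.
- by move: IHt IHu; rewrite /= !tm_funD => -> ->.
Qed.

Definition tens_functor : gfunctor S R :=
  @GFunctor S R tens_obj tens_map tens_map_id tens_map_comp.

End TensorFunctor.

Section FMod.
Variables (K : fieldType) (R : gring).

Definition is_fmod (M : gmod (gext K R)) : Prop :=
  [/\ exists (r : nat) (m : 'I_r -> M), forall x : M,
        exists c : 'I_r -> K, x = \sum_(i < r) (escal R (c i) : gext K R) *: m i,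
      forall d, hdeg d (0 : M) /\ forall x y : M, hdeg d x -> hdeg d y -> hdeg d (x - y),
      forall i j (a : gext K R) (x : M), gdeg i a -> hdeg j x -> hdeg (i + j) (a *: x),
      forall x : M, exists (s : seq int) (h : int -> M),
        (forall d, hdeg d (h d)) /\ x = \sum_(d <- s) h d
    & forall (s : seq int) (h : int -> M), uniq s -> (forall d, hdeg d (h d)) ->
        \sum_(d <- s) h d = 0 -> forall d, d \in s -> h d = 0].

Record fmod := FMod { fm_car :> gmod (gext K R); fm_prop : is_fmod fm_car }.

End FMod.

Definition preserves_fmod (K : fieldType) (R S : gring)
    (F : gfunctor (gext K R) (gext K S)) : Prop :=
  forall M : fmod K R, is_fmod (F M).

Definition nat_iso (K : fieldType) (R S : gring)
    (F G : gfunctor (gext K R) (gext K S)) : Prop :=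
  exists (eta : forall M : fmod K R, gmor (F M) (G M))
         (eta' : forall M : fmod K R, gmor (G M) (F M)),
    (forall M, cancel (eta M) (eta' M) /\ cancel (eta' M) (eta M)) /\
    (forall (M N : fmod K R) (f : gmor M N) x,
       eta N (fmap F f x) = fmap G f (eta M x)).

(* Indices run over 'I_n: the index i : 'I_n stands for i + 1 in 1..n,  *)
(* so that 'X_i is U_{i+1} or x_{i+1}.                                  *)

(* p is zero or homogeneous of degree d, for deg 'X_i = 2. *)
Definition poly_deg (n : nat) (d : int) (p : {mpoly int[n]}) : Prop :=
  p = 0 \/ exists m : nat, d = (2 * m)%N%:Z /\ p \is m.-homog.

Section OSz.
Variables n k : nat.
Local Notation polyU := {mpoly int[n]}.

(* I-states: k-element subsets of {0..n}. *)
Definition istate := {x : {set 'I_n.+1} | #|x| == k}.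
Implicit Types x y z w : istate.

Definition left_istate : pred istate := fun x => ord_max \notin val x.

Definition has0 : pred istate := fun x => ord0 \in val x.

(* The increasing enumeration x_1 < ... < x_k. *)
Definition ienum x : seq nat := [seq val j | j <- enum (val x)].

Definition ifar x y : bool :=
  [exists i : 'I_k, 1 < `|nth 0%N (ienum x) i - nth 0%N (ienum y) i|]%N.

(* v_{i+1}^x = |x n {i+1..n}| *)
Definition iv x (i : 'I_n) : nat := #|[set j in val x | (i < j)%N]|.

(* Both the division by 2 and the natural subtraction are exact. *)
Definition gexp x y z (i : 'I_n) : nat :=
  (`|iv y i - iv z i| + `|iv x i - iv y i| - `|iv x i - iv z i|)%N./2.

Definition gmono x y z : polyU := \prod_(i < n) 'X_i ^+ gexp x y z i.

(* The Z[U]-module with basis f_{x,y}: the coefficient of f_{x,y} in a is a (x, y). *)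
Definition B0 : Type := {ffun istate * istate -> polyU}.
HB.instance Definition _ := GRing.Zmodule.on B0.

(* p f_{x,y} *)
Definition fel x y (p : polyU) : B0 := [ffun u => if u == (x, y) then p else 0].

Definition bone : B0 := [ffun u => (u.1 == u.2)%:R].
Definition bmul (a b : B0) : B0 :=
  [ffun u => \sum_y a (u.1, y) * b (y, u.2) * gmono u.1 y u.2].

Lemma gexp_cocycle x y z w i :
  (gexp x y z i + gexp x z w i = gexp y z w i + gexp x y w i)%N.
Proof. rewrite /gexp; lia. Qed.

Lemma gmono_cocycle x y z w :
  gmono x y z * gmono x z w = gmono y z w * gmono x y w.
Proof.
rewrite /gmono -!big_split /=; apply: eq_bigr => i _.
by rewrite -!exprD gexp_cocycle.
Qed.

Lemma gmonoxx x z : gmono x x z = 1.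
Proof.
rewrite /gmono big1 // => i _; suff -> : gexp x x z i = 0%N by rewrite expr0.
rewrite /gexp; lia.
Qed.
Lemma gmonozz x z : gmono x z z = 1.
Proof.
rewrite /gmono big1 // => i _; suff -> : gexp x z z i = 0%N by rewrite expr0.
rewrite /gexp; lia.
Qed.

Lemma bmulA : associative bmul.
Proof.
move=> a b c; apply/ffunP=> -[x w]; rewrite !ffunE /=.
under eq_bigr => y _ do rewrite ffunE /= mulr_sumr mulr_suml.
under [RHS]eq_bigr => z _ do rewrite ffunE /= mulr_suml mulr_suml.
rewrite exchange_big /=; apply: eq_bigr => z _; apply: eq_bigr => y _.
have := gmono_cocycle x y z w; set g1 := gmono x y z; set g2 := gmono x z w.
set g3 := gmono y z w; set g4 := gmono x y w => E.
transitivity (a (x, y) * b (y, z) * c (z, w) * (g3 * g4)); first by rewrite !mulrA.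
by rewrite -E !mulrA (mulrAC _ _ g1).
Qed.

Lemma bmul1l : left_id bone bmul.
Proof.
move=> a; apply/ffunP=> -[x z]; rewrite !ffunE /= (bigD1 x) //= big1 => [|y yx].
  by rewrite ffunE eqxx mul1r gmonoxx mulr1 addr0.
by rewrite ffunE /= eq_sym (negbTE yx) !mul0r.
Qed.
Lemma bmul1r : right_id bone bmul.
Proof.
move=> a; apply/ffunP=> -[x z]; rewrite !ffunE /= (bigD1 z) //= big1 => [|y yx].
  by rewrite ffunE eqxx mulr1 gmonozz mulr1 addr0.
by rewrite ffunE /= (negbTE yx) mulr0 mul0r.
Qed.
Lemma bmulDl : left_distributive bmul +%R.
Proof.
move=> a b c; apply/ffunP=> -[x z]; rewrite !ffunE -big_split /=.
by apply: eq_bigr => y _; rewrite ffunE !mulrDl.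
Qed.
Lemma bmulDr : right_distributive bmul +%R.
Proof.
move=> a b c; apply/ffunP=> -[x z]; rewrite !ffunE -big_split /=.
by apply: eq_bigr => y _; rewrite ffunE mulrDr mulrDl.
Qed.
HB.instance Definition _ := GRing.Zmodule_isPzRing.Build B0 bmulA bmul1l bmul1r bmulDl bmulDr.

(* The sum of the idempotents I_x over the x satisfying Q. *)
Definition isum (Q : pred istate) : B0 := \sum_(x | Q x) fel x x 1.

Lemma isumE (Q : pred istate) x y : isum Q (x, y) = ((x == y) && Q x)%:R.
Proof.
rewrite /isum sum_ffunE; under eq_bigr => z _ do rewrite ffunE.
rewrite -big_mkcondr; have [/andP[/eqP <- Qx]|nxy] := boolP ((x == y) && Q x).
  rewrite (big_pred1 x) // => z; rewrite /= xpair_eqE andbb [z == x]eq_sym.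
  by case: eqVneq => [<-|_]; rewrite ?Qx ?andbF.
rewrite big_pred0 // => z; apply: contraNF nxy; rewrite xpair_eqE.
by case/and3P => Qz /eqP -> /eqP ->; rewrite eqxx.
Qed.

Lemma isumM (P Q : pred istate) : isum P * isum Q = isum (predI P Q).
Proof.
apply/ffunP=> -[x z]; rewrite isumE ffunE /= (bigD1 x) //= big1 => [|y yx].
  rewrite !isumE eqxx gmonoxx mulr1 addr0 /=.
  by have [->|xz] := eqVneq x z; rewrite -natrM mulnb // andbF.
by rewrite isumE eq_sym (negbTE yx) !mul0r.
Qed.

(* For i : 'I_n, [ilo i] and [ihi i] are the elements i and i + 1 of {0..n}. *)
Definition ilo (i : 'I_n) : 'I_n.+1 := widen_ord (leqnSn n) i.
Definition ihi (i : 'I_n) : 'I_n.+1 := fintype.lift ord0 i.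

(* R_{i+1} and L_{i+1} *)
Definition Rgen (i : 'I_n) : B0 :=
  \sum_(x : istate | val x :&: [set ilo i; ihi i] == [set ilo i])
    \sum_(y : istate | val y == ihi i |: (val x :\ ilo i)) fel x y 1.
Definition Lgen (i : 'I_n) : B0 :=
  \sum_(x : istate | val x :&: [set ilo i; ihi i] == [set ihi i])
    \sum_(y : istate | val y == ilo i |: (val x :\ ihi i)) fel x y 1.

Inductive Brel : B0 -> Prop :=
| Brel_R (i j : 'I_n) of val j = (val i).+1 : Brel (Rgen i * Rgen j)
| Brel_L (i j : 'I_n) of val j = (val i).+1 : Brel (Lgen j * Lgen i)
| Brel_U (i : 'I_n) x of val x :&: [set ilo i; ihi i] = set0 : Brel (fel x x 'X_i).

Definition BOSz : Type := rquot Brel.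
HB.instance Definition _ := GRing.PzRing.on BOSz.

Definition B0_deg (d : int) (a : B0) : Prop :=
  forall x y, poly_deg (d - (\sum_(i < n) `|iv x i - iv y i|)%N%:Z) (a (x, y)).
Definition BOSz_deg (d : int) (b : BOSz) : Prop := exists a, B0_deg d a /\ b = rcls Brel a.

Definition gBOSz : gring := @GRingPack BOSz BOSz_deg.

Lemma el_left_idem : rcls Brel (isum left_istate) * rcls Brel (isum left_istate) =
  rcls Brel (isum left_istate).
Proof.
rewrite -rmorphM isumM; congr (rcls _ _); apply/ffunP=> -[x y].
by rewrite !isumE /= andbb.
Qed.
Definition el_left : idem gBOSz := @Idem gBOSz _ el_left_idem.

Definition BlOSz : gring := gcorner el_left.

(* The class of p f_{x,y}, for left I-states x and y. *)
Definition fBl x y (p : polyU) : BlOSz := cproj el_left (rcls Brel (fel x y p)).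

(* The sum of the I_x over the left I-states x satisfying Q. *)
Definition isumBl (Q : pred istate) : BlOSz := cproj el_left (rcls Brel (isum (predI left_istate Q))).

Lemma isumBl_idem Q : isumBl Q * isumBl Q = isumBl Q.
Proof.
have E : cval (isumBl Q) = rcls Brel (isum (predI left_istate Q)).
  rewrite -[LHS]/(rcls Brel _ * rcls Brel _ * rcls Brel _) -!rmorphM !isumM.
  congr (rcls _ _); apply/ffunP=> -[x y]; rewrite !isumE /=.
  by case: (x == y) (left_istate x) (Q x) => -[] [].
apply: val_inj; rewrite [LHS]cvalM -[RHS]/(cval _) E -(rmorphM (rcls Brel)) isumM.
congr (rcls _ _); apply/ffunP=> -[x y]; rewrite !isumE /=.
by case: (x == y) (left_istate x) (Q x) => -[] [].
Qed.

Definition eBvee : idem BlOSz := Idem (isumBl_idem (predC has0)).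
Definition eBwedge : idem BlOSz := Idem (isumBl_idem has0).

End OSz.

Section CyclicModules.
Variable n : nat.
Local Notation Rx := {mpoly int[n]}.

(* h_d (x_1, ..., x_m) *)
Definition hsym (d m : nat) : Rx :=
  \sum_(c : 'X_{1..n < d.+1} | (mdeg c == d) && [forall i : 'I_n, (m <= i)%N ==> (c i == 0%N)])
    'X_[c].

Definition Ib_gen (b : 'I_n -> nat) : Rx^o -> Prop :=
  fun p => exists i : 'I_n, p = hsym (b i) i.+1.

(* R_b = R / I_b *)
Definition Rb (b : 'I_n -> nat) : lmodType Rx := mquot (Ib_gen b).
Definition Rbcls (b : 'I_n -> nat) (p : Rx) : Rb b := mcls (Ib_gen b) p.

Definition maps_ok (b b' : 'I_n -> nat) (p : Rx) : Prop :=
  forall q : Rx^o, span (lgen (Ib_gen b)) q -> span (lgen (Ib_gen b')) (q * p : Rx^o).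

Definition mapsto_fun (b b' : 'I_n -> nat) (p : Rx) (z : Rb b) : Rb b' :=
  if `[< maps_ok b b' p >] then Rbcls b' ((crep z : Rx) * p) else 0.

Lemma mapsto_funE b b' p q : maps_ok b b' p ->
  mapsto_fun b' p (Rbcls b q) = Rbcls b' (q * p).
Proof.
move=> ok; rewrite /mapsto_fun asboolT //; apply/clsP.
by rewrite -(mulrBl p); apply: ok; exact: crep_cls.
Qed.
Lemma mapsto_funB b b' p : zmod_morphism (mapsto_fun (b := b) b' p).
Proof.
move=> z w; have [ok|nok] := pselect (maps_ok b b' p); last first.
  by rewrite /mapsto_fun asboolF // subr0.
have [q ->] : exists q, z = Rbcls b q by exists (crep z); rewrite [RHS]crepK.
have [r ->] : exists q, w = Rbcls b q by exists (crep w); rewrite [RHS]crepK.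
have E q' r' b0 : Rbcls b0 q' - Rbcls b0 r' = Rbcls b0 (q' - r') by rewrite -[LHS]raddfB.
by rewrite E !mapsto_funE // E mulrBl.
Qed.
Lemma mapsto_funZ b b' p : scalable (mapsto_fun (b := b) b' p).
Proof.
move=> a z; have [ok|nok] := pselect (maps_ok b b' p); last first.
  by rewrite /mapsto_fun asboolF // scaler0.
have [q ->] : exists q, z = Rbcls b q by exists (crep z); rewrite [RHS]crepK.
have E b0 q' : a *: Rbcls b0 q' = Rbcls b0 (a * q') by exact: mscaleE.
by rewrite E !mapsto_funE // E mulrA.
Qed.
HB.instance Definition _ b b' p :=
  GRing.isZmodMorphism.Build _ _ (mapsto_fun (b := b) b' p) (@mapsto_funB b b' p).
HB.instance Definition _ b b' p :=
  GRing.isScalable.Build Rx (Rb b) (Rb b') *:%R (mapsto_fun (b := b) b' p) (@mapsto_funZ b b' p).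

(* The R-linear map (1 |-> p), and 0 by convention if there is no such map. *)
Definition mapsto (b b' : 'I_n -> nat) (p : Rx) : lhom (Rb b) (Rb b') := mapsto_fun (b := b) b' p.

Lemma mapsto1 b : mapsto b b 1 = (idfun : {linear Rb b -> Rb b}).
Proof.
apply: lhomP => z; rewrite /lapp /=.
have -> : z = Rbcls b (crep z) by rewrite [RHS]crepK.
by rewrite mapsto_funE ?mulr1 // => q; rewrite mulr1.
Qed.
Lemma mapsto0 b b' : mapsto b b' 0 = 0.
Proof.
apply: lhomP => z; rewrite /lapp /= /mapsto_fun.
by case: asboolP => // _; rewrite mulr0; exact: (raddf0 (mcls _)).
Qed.

End CyclicModules.

Section Sartori.
Variables n k : nat.
Local Notation Rx := {mpoly int[n]}.

(* Sequences of k wedges (true) and n - k vees (false). *)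
Definition wedgeseq := {t : n.-tuple bool | count id t == k}.
Implicit Types la mu nu : wedgeseq.

(* The position (in 1..n) of the j-th vee, for 1 <= j <= n - k. *)
Definition vee_pos mu (j : nat) : nat :=
  nth 0%N [seq i.+1 | i <- iota 0 n & ~~ nth false (val mu) i] j.-1.

Definition bseq mu (i : 'I_n) : nat := (count id (drop i.+1 (val mu))).+1.

Definition dfar la mu : bool :=
  has (fun j => (vee_pos la j.+1 <= vee_pos mu j) || (vee_pos mu j.+1 <= vee_pos la j))%N
    (iota 1 (n - k - 1)).

Definition homR la mu := lhom (Rb (bseq la)) (Rb (bseq mu)).

Definition alpha_pos la mu (j : nat) : nat := maxn (vee_pos la j) (vee_pos mu j).
Definition beta_pos la mu (j : nat) : nat :=
  if (j < n - k)%N then (minn (vee_pos mu j.+1) (vee_pos la j.+1)).-1 else n.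

Definition Wpoly la mu (j : nat) : Rx :=
  (\prod_(i < n | (alpha_pos la mu j <= i.+1 <= beta_pos la mu j)%N) 'X_i) *
  (\prod_(i < n) 'X_i ^+ (bseq mu i - bseq la i)).

Definition Wgen la mu : homR la mu -> Prop :=
  fun f => exists j : nat, (1 <= j <= n - k)%N /\ f = mapsto (bseq la) (bseq mu) (Wpoly la mu j).

Definition Wsub la mu : homR la mu -> Prop :=
  if dfar la mu then fun=> True else span (lgen (Wgen (la := la) (mu := mu))).

(* The ring of all families of maps R_{b^la} -> R_{b^mu}. *)
Definition Hring : Type := forall la mu, homR la mu.
HB.instance Definition _ := gen_eqMixin Hring.
HB.instance Definition _ := gen_choiceMixin Hring.

Lemma HringP (a b : Hring) : (forall la mu, a la mu = b la mu) -> a = b.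
Proof. by move=> ab; apply: functional_extensionality_dep => la;
  apply: functional_extensionality_dep => mu. Qed.

Definition hzero : Hring := fun la mu => 0.
Definition hopp (a : Hring) : Hring := fun la mu => - a la mu.
Definition hadd (a b : Hring) : Hring := fun la mu => a la mu + b la mu.
Lemma haddA : associative hadd.
Proof. by move=> a b c; apply: HringP => la mu; exact: addrA. Qed.
Lemma haddC : commutative hadd.
Proof. by move=> a b; apply: HringP => la mu; exact: addrC. Qed.
Lemma hadd0 : left_id hzero hadd.
Proof. by move=> a; apply: HringP => la mu; exact: add0r. Qed.
Lemma haddN : left_inverse hzero hopp hadd.
Proof. by move=> a; apply: HringP => la mu; exact: addNr. Qed.
HB.instance Definition _ := GRing.isZmodule.Build Hring haddA haddC hadd0 haddN.

Lemma haddE (a b : Hring) la mu z :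
  lapp ((a + b) la mu) z = lapp (a la mu) z + lapp (b la mu) z.
Proof. exact: erefl. Qed.

(* The family whose only entry is (1 |-> p) : R_{b^la} -> R_{b^mu}. *)
Definition hel la mu (p : Rx) : Hring := fun la' mu' =>
  if (la' == la) && (mu' == mu) then mapsto (bseq la') (bseq mu') p else 0.

(* The sum of the identity maps over the la satisfying Q. *)
Definition hsum (Q : pred wedgeseq) : Hring := fun la mu =>
  if (la == mu) && Q la then mapsto (bseq la) (bseq mu) 1 else 0.

Definition hone : Hring := hsum predT.
Definition hmul (a b : Hring) : Hring := fun la nu => \sum_mu lcomp (a mu nu) (b la mu).

Lemma hmulE a b la nu z : lapp (hmul a b la nu) z = \sum_mu lapp (a mu nu) (lapp (b la mu) z).
Proof. by rewrite lapp_sum. Qed.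

Lemma hsumE Q la mu z :
  lapp (hsum Q la mu) z = if (la == mu) && Q la then lapp (mapsto (bseq la) (bseq mu) 1) z else 0.
Proof. by rewrite /hsum; case: ifP. Qed.

Lemma hsum_mull Q (a : Hring) la mu z :
  lapp (hmul (hsum Q) a la mu) z = if Q mu then lapp (a la mu) z else 0.
Proof.
rewrite hmulE (bigD1 mu) //= big1 => [|nu nm]; last by rewrite hsumE (negbTE nm).
by rewrite hsumE eqxx addr0 andTb; case: ifP => // _; rewrite mapsto1.
Qed.
Lemma hsum_mulr Q (a : Hring) la mu z :
  lapp (hmul a (hsum Q) la mu) z = if Q la then lapp (a la mu) z else 0.
Proof.
rewrite hmulE (bigD1 la) //= big1 => [|nu nm]; last first.
  by rewrite hsumE eq_sym (negbTE nm) /= raddf0.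
by rewrite hsumE eqxx addr0 andTb; case: ifP => _; rewrite ?mapsto1 // raddf0.
Qed.

Lemma hmulA : associative hmul.
Proof.
move=> a b c; apply: HringP => la nu; apply: lhomP => z; rewrite !hmulE.
transitivity (\sum_mu \sum_ka lapp (a mu nu) (lapp (b ka mu) (lapp (c la ka) z))).
  by apply: eq_bigr => mu _; rewrite hmulE (raddf_sum (lapp (a mu nu))).
by rewrite exchange_big; apply: eq_bigr => ka _; rewrite hmulE.
Qed.
Lemma hmul1l : left_id hone hmul.
Proof. by move=> a; apply: HringP => la nu; apply: lhomP => z; rewrite hsum_mull. Qed.
Lemma hmul1r : right_id hone hmul.
Proof. by move=> a; apply: HringP => la nu; apply: lhomP => z; rewrite hsum_mulr. Qed.
Lemma hmulDl : left_distributive hmul +%R.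
Proof.
move=> a b c; apply: HringP => la nu; apply: lhomP => z.
rewrite haddE !hmulE -big_split.
by apply: eq_bigr => mu _; exact: haddE.
Qed.
Lemma hmulDr : right_distributive hmul +%R.
Proof.
move=> a b c; apply: HringP => la nu; apply: lhomP => z.
rewrite haddE !hmulE -big_split.
by apply: eq_bigr => mu _; rewrite haddE; exact: (raddfD (lapp (a mu nu))).
Qed.
HB.instance Definition _ := GRing.Zmodule_isPzRing.Build Hring hmulA hmul1l hmul1r hmulDl hmulDr.

Definition Wfam (a : Hring) : Prop := forall la mu, Wsub (a la mu).

(* The direct sum of the groups Hom / Wsub.  The Wsub are stable under   *)
(* composition on both sides (this is what makes the product on the      *)
(* quotient well defined), so dividing by the two-sided ideal they       *)
(* generate is dividing by their sum.                                    *)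
Definition ASar : Type := rquot Wfam.
HB.instance Definition _ := GRing.PzRing.on ASar.

Definition H_deg (d : int) (a : Hring) : Prop :=
  forall la mu, exists p : Rx, a la mu = mapsto (bseq la) (bseq mu) p /\
    poly_deg (d + \sum_(i < n) ((bseq mu i)%:Z - (bseq la i)%:Z)) p.
Definition ASar_deg (d : int) (a : ASar) : Prop := exists h, H_deg d h /\ a = rcls Wfam h.

Definition AZ : gring := @GRingPack ASar ASar_deg.

(* The class of (1 |-> p) : R_{b^la} -> R_{b^mu}. *)
Definition Ael la mu (p : Rx) : AZ := rcls Wfam (hel la mu p).

(* The sum of the idempotents 1_la over the la satisfying Q. *)
Definition hsumA (Q : pred wedgeseq) : AZ := rcls Wfam (hsum Q).

Lemma hsumA_idem Q : hsumA Q * hsumA Q = hsumA Q.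
Proof.
rewrite -rmorphM; congr (rcls _ _); apply: HringP => la mu; apply: lhomP => z.
rewrite hsum_mull hsumE; case: eqP => [e|_]; last by rewrite if_same.
have -> : Q mu = Q la by rewrite e.
by case: (Q la).
Qed.

Definition first_wedge : pred wedgeseq := fun la => nth false (val la) 0.

Definition eAvee : idem AZ := Idem (hsumA_idem (predC first_wedge)).
Definition eAwedge : idem AZ := Idem (hsumA_idem first_wedge).

End Sartori.

(* The left I-state x corresponds to mu. *)
Definition corresp (n k : nat) (x : istate n k) (mu : wedgeseq n k) : Prop :=
  left_istate x /\ forall i : 'I_n, tnth (val mu) i = (ilo i \in val x).

(* For a ring morphism Xi this says that Xi is Z[U]-linear, U_i acting on *)
(* the target as x_i, and gives its values on the f_{x,y}; these          *)
(* determine Xi.  The same applies to [is_PsiB] and [is_PsiA].            *)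
Definition is_Xi (n k : nat) (Xi : BlOSz n k -> AZ n k) : Prop :=
  forall (x y : istate n k) (mu la : wedgeseq n k) (p : {mpoly int[n]}),
    corresp x mu -> corresp y la ->
    Xi (fBl x y p) =
      if ifar x y then 0 else Ael la mu (p * \prod_(i < n) 'X_i ^+ (iv x i - iv y i)).

Definition removes0 (n k : nat) (x : istate n k.+1) (x' : istate n k) : Prop :=
  ord0 \in val x /\ val x' = val x :\ ord0.

Definition is_PsiB (n k : nat)
    (Psi : corner (eBwedge n k.+1) -> corner (eBvee n k)) : Prop :=
  forall (x y : istate n k.+1) (x' y' : istate n k) (p : {mpoly int[n]}),
    left_istate x -> left_istate y -> removes0 x x' -> removes0 y y' ->
    Psi (cproj _ (fBl x y p)) = cproj _ (fBl x' y' p).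

(* la' is obtained from la by changing its first symbol from wedge to vee. *)
Definition flips_first (n k : nat) (la : wedgeseq n k.+1) (la' : wedgeseq n k) : Prop :=
  exists s : seq bool, val (val la) = true :: s /\ val (val la') = false :: s.

Definition is_PsiA (n k : nat)
    (Psi : corner (eAwedge n k.+1) -> corner (eAvee n k)) : Prop :=
  forall (la mu : wedgeseq n k.+1) (la' mu' : wedgeseq n k) (p : {mpoly int[n]}),
    flips_first la la' -> flips_first mu mu' ->
    Psi (cproj _ (Ael la mu p)) = cproj _ (Ael la' mu' p).

Section Functors.
Variables (K : fieldType) (n k : nat).

Definition bimod_FOSz (chi : {rmorphism BlOSz n k.+1 -> corner (eBvee n k)}) :
  bimod (BlOSz n k) (BlOSz n k.+1) := ideal_bimod chi.
Definition bimod_EOSz (chi : {rmorphism BlOSz n k.+1 -> corner (eBvee n k)}) :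
  bimod (BlOSz n k.+1) (BlOSz n k) := hom_bimod (bimod_FOSz chi).
Definition bimod_FS (chi : {rmorphism AZ n k.+1 -> corner (eAvee n k)}) :
  bimod (AZ n k) (AZ n k.+1) := ideal_bimod chi.
Definition bimod_ES (chi : {rmorphism AZ n k.+1 -> corner (eAvee n k)}) :
  bimod (AZ n k.+1) (AZ n k) := hom_bimod (bimod_FS chi).

Definition F_OSz chi : gfunctor (gext K (BlOSz n k.+1)) (gext K (BlOSz n k)) :=
  tens_functor (ext_bimod K (bimod_FOSz chi)).
Definition E_OSz chi : gfunctor (gext K (BlOSz n k)) (gext K (BlOSz n k.+1)) :=
  tens_functor (ext_bimod K (bimod_EOSz chi)).
Definition F_S chi : gfunctor (gext K (AZ n k.+1)) (gext K (AZ n k)) :=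
  tens_functor (ext_bimod K (bimod_FS chi)).
Definition E_S chi : gfunctor (gext K (AZ n k)) (gext K (AZ n k.+1)) :=
  tens_functor (ext_bimod K (bimod_ES chi)).

Definition inflK (m : nat) (Xi : {rmorphism BlOSz n m -> AZ n m}) :
  gfunctor (gext K (AZ n m)) (gext K (BlOSz n m)) :=
  @infl (gext K (BlOSz n m)) (gext K (AZ n m)) (extmor (K := K) Xi).

End Functors.

(* Main.v *)
Require Import Defs.
From HB Require Import structures.
From mathcomp Require Import all_boot all_order all_algebra.
From mathcomp Require Import boolp functions.
From mathcomp Require Import mpoly freeg.
From mathcomp Require Import zify ring.
Import Defs.

Set Implicit Arguments.
Unset Strict Implicit.
Unset Printing Implicit Defensive.

Import GRing.Theory.
Local Open Scope ring_scope.

(** Write B for the left Ozsvath-Szabo algebra with k elements, A for the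
    Sartori algebra, e for the idempotent of the states without 0, and S, S'
    for the two algebras with k + 1 elements; chi : S -> eBe and its analogue
    S' -> eAe are the ring maps through which S and S' act.  Everything follows
    from two facts about Xi: it is a surjection of graded rings, compatible
    with e and chi, and its kernel is known.

    The functor E.  A left module map on Be is determined by its value at e, so
    Hom_B(Be, B) = eB, and evaluation at e identifies E(M) with e M, on which S
    acts through chi ([teval]).  Since Xi maps e to e and commutes with chi, the
    group e M is the same whether M is regarded as a module over A or over B
    ([dual_nat_iso]).

    The functor F.  The map Be (x)_S M -> Ae (x)_S' M induced by Xi is
    surjective.  It is injective because the kernel of Xi in Be is the right
    S-submodule generated by the q chi(s), with q in Be and Xi(s) = 0
    ([lideal_ker]): such elements die in the tensor product, as s acts on M by
    Xi(s) ([ideal_nat_iso]).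

    The kernel of Xi.  For two positive sequences b, b' with steps 0 and -1, all
    R-linear maps R_b -> R_b' are multiples of (1 |-> x^c), c = max(b' - b, 0),
    and the annihilator of this map is I_min(b, b') ([mono_hom], [mono_ann],
    [mono_gen]).  This is proved by lowering the larger sequence one corner at
    a time, and rests on the regularity of monic polynomials modulo the
    triangular ideals I_b ([monic_regular_but]).  So a matrix of polynomials
    defines both an element of B and a family of maps ([toB], [toH]), and Xi
    relates the two.  What the Sartori algebra divides out is already zero in
    B: f_xy vanishes when x, y are too far ([crossing_eq0]), and so does
    U_a ... U_b f_xy when [a, b] is an interval between vees ([interval_eq0]).
    Hence the kernel of Xi is the two-sided ideal generated by the elements
    h_(b_i)(U_1, ..., U_i) I_x ([Xi_ker]).

    The kernel in Be.  For y without 0 the element h_(b_i)(U_1, ..., U_i) f_xy,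
    with b attached to x, has to be written with relations at states z without
    0, since these are the ones that lift along chi.  If 0 is not in x, take
    z = x.  If 0 is in x and x, y are not too far, then x starts with
    0, ..., m - 1 and omits m, while y starts with 1, ..., m.  For i > m take
    for z the state that agrees with y up to m and with x afterwards: it lies
    between x and y and has the same b_i as x.  For i <= m the recursion
    h_d(i) = h_d(i + 1) - U_(i+1) h_(d-1)(i + 1) and the relations at y lead to
    larger i, and the process ends at an interval element that is zero
    ([Yp_run], [Yp_below], [Yp_wedge_vee]).

    Finite dimension is preserved by F on the side of B because Be is generated
    as a right S-module by the finitely many f_xy e ([lideal_fg]); gradings are
    carried through quotients, corners and tensor products as families of
    projections ([components]).  On the side of A it is transported along the
    isomorphism. *)

(** * Complete homogeneous polynomials one variable at a time *)

Section OneVariable.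
Variables (n : nat) (j : 'I_n).
Local Notation R := {mpoly int[n]}.

Definition up_var (l : 'I_n) : {poly R} := if l == j then 'X else ('X_l)%:P.

Fact up_exists : {f : {rmorphism R -> {poly R}} |
  (forall c, f c%:MP = c%:MP%:P) /\ (forall l, f 'X_l = up_var l)}.
Proof.
exists (mmap (polyC \o @mpolyC n int) up_var); split=> [c|l]; first exact: mmapC.
by rewrite /= mmapX mmap1U.
Qed.

(** x_j becomes the variable of a polynomial whose coefficients are again
    polynomials in x_1, ..., x_n: division by what is monic in x_j becomes
    available. *)
Definition up : {rmorphism R -> {poly R}} := sval up_exists.

Definition ev (P : {poly R}) : R := P.['X_j].

Lemma upC c : up c%:MP = c%:MP%:P. Proof. exact: (svalP up_exists).1. Qed.
Lemma upX l : up 'X_l = up_var l. Proof. exact: (svalP up_exists).2. Qed.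

Lemma up_ind (P : R -> Prop) :
  (forall c, P c%:MP) -> (forall l, P 'X_l) ->
  (forall p q, P p -> P q -> P (p + q)) -> (forall p q, P p -> P q -> P (p * q)) ->
  forall p, P p.
Proof.
move=> PC PX PD PM p; rewrite [p]mpolyE; elim/big_ind: _ => //.
  by have := PC 0; rewrite mpolyC0.
move=> m _; rewrite -mul_mpolyC; apply: (PM) => //.
rewrite mpolyXE_id; elim/big_ind: _ => // [|l _].
  by have := PC 1; rewrite mpolyC1.
elim: (m l) => [|d IH]; first by have := PC 1; rewrite mpolyC1 expr0.
by rewrite exprS; apply: (PM).
Qed.

Lemma upK p : ev (up p) = p.
Proof.
rewrite /ev; elim/up_ind: p => [c|l|p q IHp IHq|p q IHp IHq].
- by rewrite upC hornerC.
- rewrite upX /up_var; case: eqP => [E|_]; first by rewrite E hornerX.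
  by rewrite hornerC.
- by rewrite rmorphD hornerD; congr (_ + _).
- by rewrite rmorphM hornerM; congr (_ * _).
Qed.

End OneVariable.

Section CompleteSymmetric.
Variable n : nat.
Local Notation R := {mpoly int[n]}.

Lemma mcoeff_hsym d m c : (hsym n d m)@_c =
  ((mdeg c == d) && [forall i : 'I_n, (m <= i)%N ==> (c i == 0%N)])%:R.
Proof.
rewrite /hsym raddf_sum /=; under eq_bigr => e _ do rewrite mcoeffX.
have [/andP[dc /forallP cm]|nc] := boolP (_ && _).
  have lt : (mdeg c < d.+1)%N by rewrite (eqP dc).
  rewrite (bigD1 (BMultinom lt)) /=; last by rewrite dc; apply/forallP.
  rewrite eqxx big1 ?addr0 // => e /andP[_ ne].
  by case: eqP => // ec; case/eqP: ne; apply: val_inj.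
rewrite big1 // => e ce; case: eqP => // ec.
by rewrite -ec ce in nc.
Qed.

Lemma hsym0 m : hsym n 0 m = 1.
Proof.
apply/mpolyP => c; rewrite mcoeff_hsym mcoeff1 mdeg_eq0.
case: eqP => //= ->; congr (_%:R); apply/eqP; rewrite eqb1.
by apply/forallP => i; rewrite mnm0E eqxx implybT.
Qed.

Lemma hsymS0 d : hsym n d.+1 0 = 0.
Proof.
apply/mpolyP => c; rewrite mcoeff_hsym mcoeff0.
case: eqP => //= dc; case: forallP => // c0.
suff c00 : c = 0%MM by rewrite c00 mdeg0 in dc.
by apply/mnmP => i; rewrite mnm0E; apply/eqP/c0.
Qed.

(** Sorting the monomials of h_(d+1)(x_1, ..., x_(i+1)) by whether they involve
    the last variable x_(i+1), which is the one of index i. *)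
Lemma hsymS d (i : 'I_n) :
  hsym n d.+1 i.+1 = hsym n d.+1 i + 'X_i * hsym n d i.+1.
Proof.
apply/mpolyP => c; rewrite mcoeffD !mcoeff_hsym.
have [ci|ci] := posnP (c i).
  have -> : ('X_i * hsym n d i.+1)@_c = 0.
    rewrite mcoeffM big1 // => -[e f] /= /eqP ecf.
    rewrite mcoeffX; case: eqP => [ie|]; last by rewrite mul0r.
    have := congr1 (fun m : 'X_{1..n} => m i) ecf.
    by rewrite /= ci mnmDE -ie mnm1E eqxx.
  rewrite addr0; congr (_ && _)%:R.
  apply/idP/idP => /forallP h; apply/forallP => l; apply/implyP => il.
    have := h l; move: il; rewrite leq_eqVlt => /orP[/eqP il|->] // _.
    have -> : l = i by apply: val_inj; rewrite /= -il.
    by rewrite ci.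
  by have /implyP := h l; apply; exact: ltnW.
have -> : [forall l : 'I_n, (i <= l)%N ==> (c l == 0%N)] = false.
  by apply/forallP => /(_ i); rewrite leqnn /= gtn_eqF.
rewrite andbF add0r.
pose e := (c - U_(i))%MM.
have ce : c = (U_(i) + e)%MM.
  rewrite /e addmC submK //; apply/mnm_lepP => l; rewrite mnm1E.
  by case: eqP => // <-.
rewrite [in RHS]mulrC [in RHS]ce addmC addmC mcoeffMX mcoeff_hsym.
rewrite ce mdegD mdeg1 add1n eqSS; congr (_ && _)%:R.
apply: eq_forallb => l; have [il|//] := boolP (i < l)%N.
have /negbTE il' : i != l by rewrite -val_eqE /= neq_ltn il.
by rewrite mnmDE mnm1E il'.
Qed.

Lemma hsym_homog d m : hsym n d m \is d.-homog.
Proof.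
apply/dhomogP => c; rewrite mcoeff_msupp mcoeff_hsym.
by have [//|_] := eqVneq (mdeg c) d; rewrite eqxx.
Qed.

Lemma up_hsym (j : 'I_n) d m : (m <= j)%N -> up j (hsym n d m) = (hsym n d m)%:P.
Proof.
elim: m d => [|m IHm] d mj; first by case: d => [|d]; rewrite ?hsym0 ?hsymS0 ?rmorph0 ?rmorph1.
elim: d => [|d IHd]; first by rewrite hsym0 !rmorph1.
pose i := Ordinal (ltn_trans mj (ltn_ord j)).
rewrite -[m.+1]/(val i).+1 hsymS /= rmorphD rmorphM /= IHm 1?ltnW // IHd upX /up_var.
by rewrite -val_eqE /= ltn_eqF // -polyCM -polyCD.
Qed.

(** By [hsymS] the leading term in the last variable is its d-th power. *)
Lemma up_hsym_monic (j : 'I_n) d : up j (hsym n d j.+1) \is monic.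
Proof.
elim: d => [|d IHd]; first by rewrite hsym0 rmorph1 monic1.
rewrite hsymS rmorphD rmorphM /= upX /up_var eqxx up_hsym //.
rewrite monicE lead_coefDr; first by rewrite -monicE monicMl // monicX.
rewrite mulrC size_mulX ?monic_neq0 // ltnS.
apply: leq_trans (size_polyC_leq1 _) _.
by rewrite size_poly_gt0 monic_neq0.
Qed.

End CompleteSymmetric.

(** * Regularity modulo ideals with monic triangular generators *)

Section TriangularIdeals.
Variables (n : nat) (R : comNzRingType).

(** The ideal generated by the g l with l in Q; varying Q allows adding the
    generators one at a time. *)
Definition in_gens (Q : pred 'I_n) (g : 'I_n -> R) (p : R) : Prop :=
  exists q : 'I_n -> R, p = \sum_(l | Q l) q l * g l.

Section Closure.
Variables (Q : pred 'I_n) (g : 'I_n -> R).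

Lemma in_gens0 : in_gens Q g 0.
Proof. by exists (fun=> 0); rewrite big1 // => l _; rewrite mul0r. Qed.

Lemma in_gensD p q : in_gens Q g p -> in_gens Q g q -> in_gens Q g (p + q).
Proof.
move=> [a ->] [b ->]; exists (fun l => a l + b l).
by rewrite -big_split /=; apply: eq_bigr => l _; rewrite mulrDl.
Qed.

Lemma in_gensMl r p : in_gens Q g p -> in_gens Q g (r * p).
Proof.
move=> [a ->]; exists (fun l => r * a l).
by rewrite mulr_sumr; apply: eq_bigr => l _; rewrite mulrA.
Qed.

Lemma in_gensN p : in_gens Q g p -> in_gens Q g (- p).
Proof. by move=> gp; rewrite -mulN1r; apply: in_gensMl. Qed.

Lemma in_gensB p q : in_gens Q g p -> in_gens Q g q -> in_gens Q g (p - q).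
Proof. by move=> gp gq; apply: in_gensD => //; apply: in_gensN. Qed.

Lemma in_gens_sum (I : Type) (r : seq I) (P : pred I) (F : I -> R) :
  (forall i, P i -> in_gens Q g (F i)) -> in_gens Q g (\sum_(i <- r | P i) F i).
Proof.
by move=> gF; elim/big_ind: _ => //; [exact: in_gens0 | exact: in_gensD].
Qed.

Lemma in_gens_gen l : Q l -> in_gens Q g (g l).
Proof.
move=> Ql; exists (fun l' => (l' == l)%:R).
by rewrite (bigD1 l) //= eqxx mul1r big1 ?addr0 // => k /andP[_ /negbTE ->]; rewrite mul0r.
Qed.
End Closure.

Lemma in_gens_sub (Q Q' : pred 'I_n) g g' p :
  (forall l, Q l -> in_gens Q' g' (g l)) -> in_gens Q g p -> in_gens Q' g' p.
Proof. by move=> h [a ->]; apply: in_gens_sum => l /h; exact: in_gensMl. Qed.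

Section Regular.
Variables (X : 'I_n -> R) (up : 'I_n -> {rmorphism R -> {poly R}}).
Hypothesis upK : forall j p, (up j p).[X j] = p.
Variable g : 'I_n -> R.

(** The case met below is g l = h_(b l)(x_1, ..., x_l): it involves no
    variable after x_l, and is monic as a polynomial in x_l. *)
Hypothesis g_low : forall l j : 'I_n, (l < j)%N -> up j (g l) = (g l)%:P.
Hypothesis g_monic : forall l, up l (g l) \is monic.

Lemma in_gens_coef (Q : pred 'I_n) (j : 'I_n) p t :
  (forall l, Q l -> (l < j)%N) -> in_gens Q g p -> in_gens Q g (up j p)`_t.
Proof.
move=> Qj [a ->]; rewrite rmorph_sum coef_sum; apply: in_gens_sum => l Ql.
rewrite rmorphM /= g_low ?Qj // coefMC.
by apply: in_gensMl; exact: in_gens_gen.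
Qed.

(** Induction on the size of P: the leading coefficient of P is that of G P, so
    it lies in the ideal, and the leading term of P can be split off. *)
Lemma monic_regular (Q : pred 'I_n) (G P : {poly R}) : G \is monic ->
  (forall t, in_gens Q g (G * P)`_t) -> forall t, in_gens Q g P`_t.
Proof.
move=> Gm; have [d dP] := ubnP (size P); elim: d P dP => // d IH P dP GP.
have [P0|Pn0] := eqVneq P 0; first by move=> t; rewrite P0 coef0; exact: in_gens0.
have Ll : in_gens Q g (lead_coef P).
  by rewrite -(lead_coef_monicM P Gm); exact: GP.
have sP : (0 < size P)%N by rewrite size_poly_gt0.
pose M := lead_coef P *: 'X^((size P).-1).
have cM t : in_gens Q g (M`_t).
  by rewrite coefZ coefXn mulrC; exact: in_gensMl.
have IHP : forall t, in_gens Q g (P - M)`_t.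
  apply: IH => [|t].
    apply: leq_ltn_trans (_ : ((size P).-1 < d)%N); last by rewrite prednK.
    apply/leq_sizeP => t; rewrite coefB coefZ coefXn leq_eqVlt => /orP[/eqP <-|lt].
      by rewrite eqxx mulr1 subrr.
    by rewrite gtn_eqF // mulr0 subr0 nth_default // -ltnS -(prednK sP).
  rewrite mulrBr coefB; apply: in_gensB => //.
  rewrite -scalerAr coefZ mulrC; exact: in_gensMl.
by move=> t; rewrite -[P](subrK M) coefD; apply: in_gensD.
Qed.

Lemma ev_in_gens (Q : pred 'I_n) j (P : {poly R}) :
  (forall t, in_gens Q g P`_t) -> in_gens Q g P.[X j].
Proof.
move=> cP; rewrite horner_coef; apply: in_gens_sum => t _.
by rewrite mulrC; apply: in_gensMl.
Qed.

Lemma rmodp_in_gens (Q : pred 'I_n) (G P : {poly R}) : G \is monic ->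
  (forall t, in_gens Q g P`_t) ->
  forall t, in_gens Q g (Pdiv.CommonRing.rmodp P G)`_t.
Proof.
move=> Gm cP t; rewrite -[P]coefK poly_def Pdiv.RingMonic.rmodp_sum // coef_sum.
apply: in_gens_sum => s _; rewrite Pdiv.RingMonic.rmodpZ // coefZ mulrC.
exact: in_gensMl.
Qed.

Lemma monic_regular_below (Q : pred 'I_n) (i : 'I_n) f p :
  (forall l, Q l -> (l < i)%N) -> up i f \is monic ->
  in_gens Q g (f * p) -> in_gens Q g p.
Proof.
move=> Qi fm fp; rewrite -(upK i p); apply: ev_in_gens => t.
by apply: (monic_regular fm) => {}t; rewrite -rmorphM; exact: in_gens_coef.
Qed.

(** Division by the monic g j is linear over the polynomials free of x_j, so
    that regularity survives adding g j to the ideal. *)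
Lemma regular_add (Q : pred 'I_n) (j : 'I_n) f p :
  (forall l, Q l -> (l < j)%N) -> up j f = f%:P ->
  (forall q, in_gens Q g (f * q) -> in_gens Q g q) ->
  in_gens (predU1 j Q) g (f * p) -> in_gens (predU1 j Q) g p.
Proof.
move=> Qj fj freg [a fpE].
have jQ : ~~ Q j by apply/negP => /Qj; rewrite ltnn.
(* The normal form of q modulo g j. *)
pose N q := (Pdiv.CommonRing.rmodp (up j q) (up j (g j))).[X j].
have QU q : in_gens Q g q -> in_gens (predU1 j Q) g q.
  by apply: in_gens_sub => l Ql; apply: in_gens_gen; rewrite /= Ql orbT.
have pN q : in_gens (predU1 j Q) g (q - N q).
  rewrite -{1}(upK j q) {1}(Pdiv.RingMonic.rdivp_eq (g_monic j) (up j q)).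
  rewrite /N hornerD addrK hornerM upK.
  by apply: in_gensMl; apply: in_gens_gen; rewrite /= eqxx.
suff Np : in_gens Q g (N p) by rewrite -(subrK (N p) p); apply: in_gensD; [exact: pN|exact: QU].
apply: freg; have -> : f * N p = N (f * p).
  by rewrite /N rmorphM /= fj mul_polyC Pdiv.RingMonic.rmodpZ // hornerZ.
have -> : N (f * p) = N (\sum_(l | Q l) a l * g l).
  rewrite fpE (bigD1 j) /=; last by rewrite eqxx.
  rewrite /N rmorphD rmorphM /= Pdiv.RingMonic.rmodpD // Pdiv.RingMonic.rmodp_mull // add0r.
  congr (Pdiv.CommonRing.rmodp (up j _) _).[_]; apply: eq_bigl => l /=.
  by case: eqP => [->|_]; rewrite ?(negbTE jQ) ?andbF ?andbT.
apply: ev_in_gens; apply: rmodp_in_gens => // t.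
by apply: in_gens_coef => //; exists a.
Qed.

(** The relations after x_i cut out a free module over what precedes them, and
    the relation g i itself is left out; so a polynomial that is monic in x_i
    stays regular. *)
Lemma monic_regular_but (i : 'I_n) f p :
  up i f \is monic -> (forall j : 'I_n, (i < j)%N -> up j f = f%:P) ->
  in_gens (predC1 i) g (f * p) -> in_gens (predC1 i) g p.
Proof.
move=> fm flow.
have eqQ (Q Q' : pred 'I_n) q : Q =1 Q' -> in_gens Q g q -> in_gens Q' g q.
  by move=> QQ [a ->]; exists a; apply: eq_bigl.
suff H m : (i < m)%N -> (m <= n)%N -> forall q,
    in_gens (fun l : 'I_n => (l < m)%N && (l != i)) g (f * q) ->
    in_gens (fun l : 'I_n => (l < m)%N && (l != i)) g q.
  have E : predC1 i =1 (fun l : 'I_n => (l < n)%N && (l != i)) by move=> l; rewrite ltn_ord.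
  by move/(eqQ _ _ _ E)/(H n (ltn_ord i) (leqnn n)); apply: eqQ => l; rewrite E.
elim: m => // m IH; rewrite ltnS leq_eqVlt => /orP[/eqP im _|im mn] q.
  have E (l : 'I_n) : (l < m.+1)%N && (l != i) = (l < i)%N.
    by rewrite -im -val_eqE ltnS /= andbC ltn_neqAle.
  move/(eqQ _ _ _ E)/(monic_regular_below (fun l lt => lt) fm).
  by apply: eqQ => l; rewrite E.
pose j := Ordinal mn.
have E (l : 'I_n) : (l < m.+1)%N && (l != i) = predU1 j (fun l : 'I_n => (l < m)%N && (l != i)) l.
  rewrite /= ltnS leq_eqVlt -!val_eqE /=; case: eqP => [->|//] /=.
  by rewrite gtn_eqF.
move/(eqQ _ _ _ E)/(regular_add _ (flow j im) (IH im (ltnW mn))) => H.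
by apply: (eqQ _ _ _ (fsym E)); apply: H => l /andP[].
Qed.

End Regular.
End TriangularIdeals.

(** * Maps between the cyclic modules R_b, on the level of polynomials *)

Section StepSequences.
Variable n : nat.
Local Notation R := {mpoly int[n]}.
Implicit Types (b e : 'I_n -> nat) (p q : R).

(** The shape of the sequences b^mu. *)
Definition stepseq b : Prop :=
  (forall i, 0 < b i)%N /\ forall i j : 'I_n, j = i.+1 :> nat -> (b j <= b i <= (b j).+1)%N.

Definition hgen b (l : 'I_n) : R := hsym n (b l) l.+1.

Definition mono (c : 'I_n -> nat) : R := \prod_(i < n) 'X_i ^+ c i.

Lemma eq_hgen Q b b' p : b =1 b' -> in_gens Q (hgen b) p -> in_gens Q (hgen b') p.
Proof.
by move=> bb; apply: in_gens_sub => l Ql; rewrite /hgen bb; exact: (in_gens_gen (hgen b')).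
Qed.

Lemma up_hgen_low b (l j : 'I_n) : (l < j)%N -> up j (hgen b l) = (hgen b l)%:P.
Proof. exact: up_hsym. Qed.
Lemma up_hgen_monic b l : up l (hgen b l) \is monic.
Proof. exact: up_hsym_monic. Qed.
Lemma upK' (j : 'I_n) p : (up j p).['X_j] = p.
Proof. exact: upK. Qed.

Lemma regular_but b (i : 'I_n) f p :
  up i f \is monic -> (forall j : 'I_n, (i < j)%N -> up j f = f%:P) ->
  in_gens (predC1 i) (hgen b) (f * p) -> in_gens (predC1 i) (hgen b) p.
Proof. exact: (monic_regular_but upK' (up_hgen_low b) (up_hgen_monic b)). Qed.

(** By [hsymS], h_m(x_1, ..., x_i) with m > b_i reduces to the same degree in
    fewer variables, where it is still at least b_(i-1) as b_(i-1) <= b_i + 1,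
    and to a smaller degree in the same variables. *)
Lemma hsym_in_gens b (i : 'I_n) m : stepseq b -> (b i <= m)%N ->
  in_gens predT (hgen b) (hsym n m i.+1).
Proof.
move=> [b0 bS]; case: i => i; elim: i m => [|i IHi] m lt.
  elim: m => [|m IHm] im; first by have := b0 (Ordinal lt); lia.
  have [->|] := eqVneq m.+1 (b (Ordinal lt)); first exact: (in_gens_gen (hgen b)).
  move=> ne; rewrite (hsymS m (Ordinal lt)) hsymS0 add0r.
  by apply: in_gensMl; apply: IHm; move: im ne; set u := b _; lia.
have ltp : (i < n)%N by exact: ltn_trans lt.
have := bS (Ordinal ltp) (Ordinal lt) erefl.
elim: m => [|m IHm] bb im; first by have := b0 (Ordinal lt); lia.
have [->|] := eqVneq m.+1 (b (Ordinal lt)); first exact: (in_gens_gen (hgen b)).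
move=> ne; rewrite (hsymS m (Ordinal lt)).
have im' : (b (Ordinal lt) <= m)%N by move: im ne; set u := b _; lia.
apply: in_gensD; last by apply: in_gensMl; exact: IHm.
by apply: (IHi m.+1 ltp); move: bb im'; set u := b _; set v := b _; lia.
Qed.

Section Corner.
Variables (b : 'I_n -> nat) (i : 'I_n) (d : nat).
Let b' l := if l == i then d else b l.
Hypothesis bs : stepseq b.
Hypothesis bs' : stepseq b'.
Hypothesis bi : b i = d.+1.

(** If b stays a step sequence when lowered at i, then b_(i-1) = b_i, so this
    polynomial is the generator of index i - 1. *)
Lemma corner_below : in_gens (predC1 i) (hgen b) (hsym n d.+1 i).
Proof.
case: (posnP i) => [->|ipos]; first by rewrite hsymS0; exact: in_gens0.
have lt : (i.-1 < n)%N by apply: leq_ltn_trans (leq_pred _) (ltn_ord i).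
pose i' := Ordinal lt; have ii' : (i : nat) = i'.+1 by rewrite /= prednK.
have ne : i' != i by rewrite -val_eqE /=; lia.
have := bs.2 _ _ ii'; have := bs'.2 _ _ ii'; rewrite /b' eqxx (negbTE ne) bi => h1 h2.
have -> : hsym n d.+1 i = hgen b i'.
  by rewrite /hgen ii'; congr hsym; move: h1 h2; set u := b _; lia.
exact: (in_gens_gen (hgen b)).
Qed.

Lemma gens_but p : in_gens (predC1 i) (hgen b) p -> in_gens predT (hgen b') p.
Proof.
apply: in_gens_sub => l li; have -> : hgen b l = hgen b' l by rewrite /hgen /b' (negbTE li).
exact: (in_gens_gen (hgen b')).
Qed.

Lemma gens_but' p : in_gens (predC1 i) (hgen b) p -> in_gens predT (hgen b) p.
Proof. by apply: in_gens_sub => l _; exact: (in_gens_gen (hgen b)). Qed.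

Lemma gens_split p : in_gens predT (hgen b) p ->
  exists q, in_gens (predC1 i) (hgen b) (p - q * 'X_i * hsym n d i.+1).
Proof.
move=> [a ->]; exists (a i); rewrite (bigD1 i) //= /(hgen b i) bi hsymS mulrDr mulrA.
rewrite addrAC addrK; apply: in_gensD; last by exists a.
by apply: in_gensMl; exact: corner_below.
Qed.

(** From [hsymS]: x_i h_d(x_1, ..., x_i) = h_(d+1)(x_1, ..., x_i) - h_(d+1)(x_1,
    ..., x_(i-1)), and the two terms are generators for b. *)
Lemma corner_mul p : in_gens predT (hgen b') p -> in_gens predT (hgen b) (p * 'X_i).
Proof.
move=> [a ->]; rewrite mulr_suml; apply: in_gens_sum => l _; rewrite -mulrA.
apply: in_gensMl; have [->|li] := eqVneq l i; last first.
  by rewrite mulrC; apply: in_gensMl; rewrite /hgen /b' (negbTE li); exact: (in_gens_gen (hgen b)).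
have -> : hgen b' i * 'X_i = hgen b i - hsym n d.+1 i.
  by rewrite /hgen /b' eqxx bi hsymS addrC addKr mulrC.
apply: in_gensB; first exact: (in_gens_gen (hgen b)).
exact/gens_but'/corner_below.
Qed.

Lemma up_X_monic : up i 'X_i \is monic.
Proof. by rewrite upX /up_var eqxx monicX. Qed.
Lemma up_X_low (j : 'I_n) : (i < j)%N -> up j 'X_i = ('X_i)%:P.
Proof. by move=> ij; rewrite upX /up_var -val_eqE /= ltn_eqF. Qed.

(** Modulo the generators other than i, membership in the ideal of b turns p x_i
    into a multiple of x_i h_d; since x_i is regular there, it cancels. *)
Lemma corner_div p : in_gens predT (hgen b) (p * 'X_i) -> in_gens predT (hgen b') p.
Proof.
move=> /gens_split[q]; rewrite mulrAC -mulrBl mulrC => h.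
have := regular_but up_X_monic up_X_low h => /gens_but h'.
rewrite -(subrK (q * hsym n d i.+1) p); apply: in_gensD => //; apply: in_gensMl.
have -> : hsym n d i.+1 = hgen b' i by rewrite /hgen /b' eqxx.
exact: (in_gens_gen (hgen b')).
Qed.

(** Here it is h_d(x_1, ..., x_i), monic in x_i, that cancels. *)
Lemma corner_hom p : in_gens predT (hgen b) (p * hsym n d i.+1) ->
  exists q, in_gens predT (hgen b) (p - q * 'X_i).
Proof.
move=> /gens_split[q]; rewrite -mulrBl mulrC => h; exists q.
apply/gens_but'/(regular_but _ _ h); first exact: up_hsym_monic.
by move=> j ij; exact: up_hsym.
Qed.

End Corner.

(** Among the places where b exceeds e, one where b is largest, and then the
    rightmost one, can be lowered. *)
Lemma exists_corner e b (l0 : 'I_n) : stepseq e -> stepseq b ->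
  (forall l, e l <= b l)%N -> (e l0 < b l0)%N ->
  exists (i : 'I_n) (d : nat), [/\ b i = d.+1, (e i <= d)%N &
    stepseq (fun l => if l == i then d else b l)].
Proof.
move=> [e0 eS] [b0 bS] eb lt0.
(* The weight b l * n + l orders the places by b first, then by position. *)
case: (@arg_maxnP _ l0 (fun l => e l < b l)%N (fun l : 'I_n => b l * n + l)%N lt0) => i lti imax.
have wmax (l : 'I_n) : (e l < b l)%N -> (b l < b i)%N || (b l == b i) && (l <= i)%N.
  move=> /imax; have := ltn_ord l; have := ltn_ord i.
  set u := b l; set v := b i; rewrite /= => ? ? ?; nia.
exists i, (b i).-1; rewrite prednK ?b0 //; split=> //; first by move: (e i) (b i) lti; lia.
split=> [l|l j jl]; first by case: eqP => [_|_]; [move: (e0 i) lti; set u := e i; set v := b i; lia | exact: b0].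
have := bS _ _ jl; have := eS _ _ jl.
have [li|li] := eqVneq l i; have [ji|ji] := eqVneq j i.
- by move: jl; rewrite li ji; lia.
- have := wmax j; rewrite li in jl *; have := lti; have := eb j; rewrite jl ltnn andbF orbF.
  set u := b j; set v := b i; set w := e j; set t := e i; lia.
- have := wmax l; rewrite ji in jl *; have := lti; have := eb l.
  set u := b l; set v := b i; set w := e l; set t := e i; lia.
- by [].
Qed.

Lemma mono_corner e b (i : 'I_n) d : b i = d.+1 -> (e i <= d)%N ->
  mono (fun l => (b l - e l)%N) =
  mono (fun l => ((if l == i then d else b l) - e l)%N) * 'X_i.
Proof.
move=> bi ei; rewrite /mono (bigD1 i) //= (bigD1 (P := predT) i) //= eqxx bi subSn // exprSr.
rewrite mulrAC; congr (_ * _ * _); apply: eq_bigr => l /negbTE -> //.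
Qed.

Lemma mono_eq0 e b : (forall l, b l <= e l)%N -> mono (fun l => (b l - e l)%N) = 1.
Proof.
move=> be; rewrite /mono big1 // => l _.
by have /eqP -> : (b l - e l == 0)%N by rewrite subn_eq0.
Qed.

(** A step sequence above e is reached from e by raising one corner at a time. *)
Lemma stepseq_ind e (P : ('I_n -> nat) -> Prop) : stepseq e ->
  (forall b, stepseq b -> b =1 e -> P b) ->
  (forall b i d, stepseq b -> (forall l, e l <= b l)%N -> b i = d.+1 -> (e i <= d)%N ->
     stepseq (fun l => if l == i then d else b l) ->
     P (fun l => if l == i then d else b l) -> P b) ->
  forall b, stepseq b -> (forall l, e l <= b l)%N -> P b.
Proof.
move=> es P0 PS b; have [m] := ubnP (\sum_l b l)%N.
elim: m b => // m IH b bm bs eb.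
have [/forallP be|/forallPn[l]] := boolP [forall l, b l <= e l]%N.
  by apply: P0 => // l; apply/eqP; rewrite eqn_leq be eb.
rewrite -ltnNge => lt.
have [i [d [bi ei b's]]] := exists_corner es bs eb lt.
apply: (PS b i d) => //; apply: IH => // [|l'].
  rewrite ltnS in bm; apply: leq_trans bm.
  rewrite [X in (_ < X)%N](bigD1 i) //= (bigD1 i) //= eqxx bi addSn ltnS leq_add2l.
  by apply: leq_sum => l' /negbTE ->.
by case: eqP => [->|_].
Qed.

Section Comparison.
Variables e b : 'I_n -> nat.
Hypotheses (es : stepseq e) (bs : stepseq b) (eb : forall l, (e l <= b l)%N).
Let c l := (b l - e l)%N.

Lemma mul_mono_le p :
  in_gens predT (hgen e) p -> in_gens predT (hgen b) (p * mono c).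
Proof.
rewrite /c; move: p; move: b bs eb; apply: (stepseq_ind es) => [b' _ be p|b' i d b's eb' bi ei ds IH p].
  rewrite mono_eq0; last by move=> l; rewrite be.
  by rewrite mulr1; apply: eq_hgen => l; rewrite be.
by rewrite (mono_corner bi ei) mulrA => /IH; exact: corner_mul.
Qed.

Lemma div_mono_le p :
  in_gens predT (hgen b) (p * mono c) -> in_gens predT (hgen e) p.
Proof.
rewrite /c; move: p; move: b bs eb; apply: (stepseq_ind es) => [b' _ be p|b' i d b's eb' bi ei ds IH p].
  rewrite mono_eq0; last by move=> l; rewrite be.
  by rewrite mulr1; apply: eq_hgen => l; rewrite be.
by rewrite (mono_corner bi ei) mulrA => /corner_div h; apply: IH; exact: h.
Qed.

Lemma hom_mono_le p :
  (forall l, in_gens predT (hgen b) (p * hgen e l)) ->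
  exists q, in_gens predT (hgen b) (p - q * mono c).
Proof.
rewrite /c; move: p; move: b bs eb; apply: (stepseq_ind es) => [b' _ be p _|b' i d b's eb' bi ei ds IH p pe].
  exists p; rewrite mono_eq0; last by move=> l; rewrite be.
  by rewrite mulr1 subrr; exact: in_gens0.
have [r rp] : exists r, in_gens predT (hgen b') (p - r * 'X_i).
  apply: (corner_hom b's ds bi); have [a ->] := hsym_in_gens es ei.
  rewrite mulr_sumr; apply: in_gens_sum => l _; rewrite mulrCA.
  exact: in_gensMl.
have [q qr] : exists q, in_gens predT (hgen (fun l => if l == i then d else b' l))
    (r - q * mono (fun l => ((if l == i then d else b' l) - e l)%N)).
  apply: IH => l; apply: (corner_div b's ds bi).
  have -> : r * hgen e l * 'X_i = p * hgen e l - hgen e l * (p - r * 'X_i) by ring.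
  by apply: in_gensB => //; exact: in_gensMl.
exists q; rewrite (mono_corner bi ei).
have := corner_mul b's ds bi qr; rewrite mulrBl mulrA => h.
by have := in_gensD rp h; rewrite addrA subrK.
Qed.

End Comparison.

Section Homs.
Variables b b' : 'I_n -> nat.
Hypotheses (bs : stepseq b) (bs' : stepseq b').
Let e l := minn (b l) (b' l).
Let c l := (b' l - b l)%N.

Lemma stepseq_min : stepseq e.
Proof.
move: bs bs' => [b0 bS] [b'0 b'S]; split=> [l|l j jl].
  by rewrite /e leq_min b0 b'0.
have := bS _ _ jl; have := b'S _ _ jl; rewrite /e.
set u := b l; set v := b j; set u' := b' l; set v' := b' j; lia.
Qed.

Let emono : mono (fun l => (b' l - e l)%N) = mono c.
Proof. by apply: eq_bigr => l _; congr (_ ^+ _); rewrite /e /c; set u := b l; set v := b' l; lia. Qed.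

Let eb l : (e l <= b l)%N. Proof. exact: geq_minl. Qed.
Let eb' l : (e l <= b' l)%N. Proof. exact: geq_minr. Qed.

(** The map 1 |-> x^c from R_b to R_b', for c = max(b' - b, 0), is well
    defined, ... *)
Lemma mono_hom p : in_gens predT (hgen b) p -> in_gens predT (hgen b') (p * mono c).
Proof.
move=> bp; rewrite -emono; apply: (mul_mono_le stepseq_min bs' eb').
by apply: in_gens_sub bp => l _; apply: (hsym_in_gens stepseq_min).
Qed.

(** ... its annihilator is the ideal attached to min(b, b'), ... *)
Lemma mono_ann p : in_gens predT (hgen b') (p * mono c) -> in_gens predT (hgen e) p.
Proof. by rewrite -emono; exact: (div_mono_le stepseq_min bs' eb'). Qed.

(** ... and it generates all R-linear maps from R_b to R_b'. *)
Lemma mono_gen p : (forall l, in_gens predT (hgen b') (p * hgen b l)) ->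
  exists q, in_gens predT (hgen b') (p - q * mono c).
Proof.
move=> pb; rewrite -emono; apply: (hom_mono_le stepseq_min bs' eb') => l.
have [le|le] := leqP (b l) (b' l).
  by have -> : hgen e l = hgen b l by rewrite /hgen /e (minn_idPl le).
have -> : hgen e l = hgen b' l by rewrite /hgen /e (minn_idPr (ltnW le)).
by apply: in_gensMl; exact: (in_gens_gen (hgen b')).
Qed.

End Homs.
End StepSequences.

(** * I-states as lattice paths *)

Section Heights.
Variables n k : nat.
Implicit Types x y z : istate n k.

(** The I-state as a lattice path, from height k at 0 down to 0 at n + 1; the
    v_i^x are its values at 1, ..., n. *)
Definition ht x (i : nat) : nat := #|[set j in val x | (i <= j)%N]|.

Lemma ivE x (i : 'I_n) : iv x i = ht x i.+1.
Proof. by []. Qed.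

Lemma ht0 x : ht x 0 = k.
Proof. by rewrite -(eqP (valP x)); apply: eq_card => j; rewrite inE andbT. Qed.

Lemma ht_end x i : (n < i)%N -> ht x i = 0%N.
Proof.
move=> ni; apply: eq_card0 => j; rewrite inE [(i <= j)%N]leqNgt.
by rewrite (leq_trans (ltn_ord j) ni) andbF.
Qed.

Lemma htS x (j : 'I_n.+1) : ht x j = ((j \in val x) + ht x j.+1)%N.
Proof.
rewrite /ht (cardD1 j) inE leqnn andbT; congr (_ + _)%N.
apply: eq_card => l; rewrite !inE [(j <= l)%N]leq_eqVlt -(inj_eq val_inj) eq_sym.
by case: eqP => [->|_] //=; rewrite ltnn andbF.
Qed.

Lemma ht_step x i : (ht x i.+1 <= ht x i <= (ht x i.+1).+1)%N.
Proof.
have [lt|le] := ltnP i n.+1; last by rewrite !ht_end // ltnW.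
by rewrite (htS x (Ordinal lt)) /=; case: (_ \in _); rewrite ?leqnn ?leqnSn.
Qed.

Lemma ht_mem x (j : 'I_n.+1) : (j \in val x) = (ht x j != ht x j.+1).
Proof. by rewrite htS; case: (j \in _) => /=; rewrite ?eqxx // add1n eqn_leq ltnn. Qed.

Lemma left_istateE x : left_istate x = (ht x n == 0%N).
Proof.
rewrite /left_istate ht_mem /= (@ht_end x n.+1) // negbK.
by [].
Qed.

Lemma has0E x : has0 x = (ht x 1 != k).
Proof. by rewrite /has0 ht_mem /= ht0 eq_sym. Qed.

Lemma ht_exists (w : nat -> nat) : w 0 = k -> w n.+1 = 0%N ->
  (forall i, (i <= n)%N -> (w i.+1 <= w i <= (w i.+1).+1)%N) ->
  exists z, forall i, (i <= n.+1)%N -> ht z i = w i.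
Proof.
move=> w0 wn wS; pose s := [set j : 'I_n.+1 | w j != w j.+1].
have H d i : (d + i = n.+1)%N -> #|[set j in s | (i <= j)%N]| = w i.
  elim: d i => [|d IH] i; first by rewrite add0n => ->; rewrite wn; apply: eq_card0 => j;
    rewrite !inE [(n < j)%N]ltnNge -ltnS ltn_ord andbF.
  rewrite addSnnS => di; have lt : (i < n.+1)%N by rewrite -di leq_addl.
  have {}IH := IH _ di; pose j := Ordinal lt.
  rewrite (cardD1 j) !inE /= leqnn andbT.
  have -> : #|[predD1 [set j in s | (i <= j)%N] & j]| = w i.+1.
    rewrite -IH; apply: eq_card => l; rewrite !inE [(i <= l)%N]leq_eqVlt -(inj_eq val_inj) /= [(i == l :> nat)]eq_sym.
    by case: eqP => [->|_] //=; rewrite ltnn andbF.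
  by have := wS i; rewrite -ltnS lt => /(_ isT); case: eqVneq => /=; lia.
have cs : #|s| == k by rewrite -w0 -(H n.+1) ?addn0 //; apply/eqP/eq_card => j; rewrite !inE andbT.
by exists (Sub s cs) => i le; rewrite /ht SubK (H (n.+1 - i)%N) // subnK.
Qed.

(** A corner of the path pushed down: y is x with i + 1 replaced by i. *)
Definition pushed_down (i : 'I_n) x y : Prop :=
  ht x i.+1 = (ht y i.+1).+1 /\ forall m, m != i.+1 -> ht x m = ht y m.

Lemma pushed_downP (i : 'I_n) x y : pushed_down i x y ->
  [/\ ilo i \notin val x, ihi i \in val x, ilo i \in val y, ihi i \notin val y &
      val y = ilo i |: (val x :\ ihi i) /\ val x = ihi i |: (val y :\ ilo i)].
Proof.
move=> [xi xy]; have ni : (i : nat) != i.+1 by rewrite neq_ltn ltnSn.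
have ni2 : i.+2 != i.+1 by rewrite gtn_eqF.
have X0 := ht_step x i; have Y0 := ht_step y i; have Y1 := ht_step y i.+1.
have X1 := ht_step x i.+1; have E0 := xy _ ni; have E2 := xy _ ni2.
have mlx : ilo i \notin val x by rewrite ht_mem /= negbK; lia.
have mhx : ihi i \in val x by rewrite ht_mem /= /bump /= add1n; lia.
have mly : ilo i \in val y by rewrite ht_mem /=; lia.
have mhy : ihi i \notin val y by rewrite ht_mem /= /bump /= add1n negbK; lia.
have lohi : ilo i != ihi i by rewrite -(inj_eq val_inj) /= /bump /= add1n.
have mj (j : 'I_n.+1) : j != ilo i -> j != ihi i -> (j \in val x) = (j \in val y).
  rewrite -!(inj_eq val_inj) /= /bump /= add1n => ji ji'.
  by rewrite !ht_mem !xy // eqSS.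
split=> //; split; apply/setP => j; rewrite !inE.
  have [->|jl] := eqVneq j (ilo i); first by rewrite mly.
  by have [->|jh] := eqVneq j (ihi i); [rewrite (negbTE mhy) | rewrite /= mj].
have [->|jh] := eqVneq j (ihi i); first by rewrite mhx.
by have [->|jl] := eqVneq j (ilo i); [rewrite (negbTE mlx) | rewrite /= mj].
Qed.

(** Too far, in terms of heights: at i + 1 one path is still above the other one
    at i.  The distance of the elements of I-states and that of the vees of
    sequences are both compared with this relation. *)
Definition crossing x y : Prop :=
  exists i, (0 < i < n)%N /\ ((ht y i < ht x i.+1) \/ (ht x i < ht y i.+1))%N.

Lemma crossingC x y : crossing x y -> crossing y x.
Proof. by move=> [i [hi [h|h]]]; exists i; split=> //; [right|left]. Qed.

End Heights.

(** * Vanishing elements of the Ozsvath-Szabo algebra *)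

Lemma mul_chain (S : pzRingType) (a a' e e' l l' : S) :
  e * l = a -> e' * l' = a' -> a * e' = a -> a * a' = e * (l * l').
Proof. by move=> <- <- h; rewrite !mulrA h. Qed.

Lemma mul2_eq (S : pzRingType) (a b c d e : S) : a * b = d -> d * c = e -> a * b * c = e.
Proof. by move=> -> ->. Qed.

Lemma morph_mull0 (S T : pzRingType) (f : {rmorphism S -> T}) (t u : S) :
  f u = 0 -> f (t * u) = 0.
Proof. by move=> h; rewrite rmorphM h mulr0. Qed.

Lemma morph_mulr0 (S T : pzRingType) (f : {rmorphism S -> T}) (t u : S) :
  f u = 0 -> f (u * t) = 0.
Proof. by move=> h; rewrite rmorphM h mul0r. Qed.

Section Relations.
Variables n k : nat.
Local Notation istate := (istate n k).
Local Notation polyU := {mpoly int[n]}.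
Implicit Types x y z : istate.

Lemma felE x y (p : polyU) u v : fel x y p (u, v) = if (u == x) && (v == y) then p else 0.
Proof. by rewrite ffunE xpair_eqE. Qed.

Lemma felD x y (p q : polyU) : fel x y (p + q) = fel x y p + fel x y q.
Proof. by apply/ffunP => u; rewrite !ffunE; case: eqP; rewrite ?addr0. Qed.
Lemma fel0 x y : fel x y (0 : polyU) = 0.
Proof. by apply/ffunP => u; rewrite !ffunE if_same. Qed.
Lemma felN x y (p : polyU) : fel x y (- p) = - fel x y p.
Proof. by apply/ffunP => u; rewrite !ffunE; case: eqP; rewrite ?oppr0. Qed.
Lemma felB x y (p q : polyU) : fel x y (p - q) = fel x y p - fel x y q.
Proof. by rewrite felD felN. Qed.
Lemma fel_sum x y (I : Type) (r : seq I) (P : pred I) (F : I -> polyU) :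
  fel x y (\sum_(i <- r | P i) F i) = \sum_(i <- r | P i) fel x y (F i).
Proof. by apply: (big_morph (fel x y)); [exact: felD | exact: fel0]. Qed.

Lemma B0_mulE (a b : B0 n k) x z :
  (a * b) (x, z) = \sum_y a (x, y) * b (y, z) * gmono x y z.
Proof. exact: ffunE. Qed.

Lemma fel_mull x y (p : polyU) (a : B0 n k) u z :
  (fel x y p * a) (u, z) = if u == x then p * a (y, z) * gmono x y z else 0.
Proof.
rewrite B0_mulE; have [->|ux] := eqVneq u x; last first.
  by rewrite big1 // => w _; rewrite felE (negbTE ux) !mul0r.
rewrite (bigD1 y) //= felE !eqxx big1 ?addr0 // => w wy.
by rewrite felE (negbTE wy) andbF !mul0r.
Qed.

Lemma fel_mul x y z (p q : polyU) :
  fel x y p * fel y z q = fel x z (p * q * gmono x y z).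
Proof.
apply/ffunP => -[u w]; rewrite fel_mull !felE eqxx /=.
by case: (u == x) => //; have [->|] := eqVneq w z; rewrite //= mulr0 mul0r.
Qed.

Lemma fel_mul0 x y y' z (p q : polyU) : y != y' -> fel x y p * fel y' z q = 0.
Proof.
move=> yy; apply/ffunP => -[u w]; rewrite fel_mull felE (negbTE yy) /= mulr0 mul0r if_same.
by rewrite ffunE.
Qed.

Lemma fel_mulr1 x y (p : polyU) : fel x y p * fel y y 1 = fel x y p.
Proof. by rewrite fel_mul gmonozz !mulr1. Qed.

Lemma B0_sum (a : B0 n k) : a = \sum_x \sum_y fel x y (a (x, y)).
Proof.
apply/ffunP => -[u v]; rewrite sum_ffunE (bigD1 u) //= [X in _ + X]big1 => [|x xu].
  rewrite addr0 sum_ffunE (bigD1 v) //= big1 => [|y yv].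
    by rewrite felE !eqxx addr0.
  by rewrite felE [v == y]eq_sym (negbTE yv) andbF.
rewrite sum_ffunE big1 // => y _; rewrite felE.
by rewrite [u == x]eq_sym (negbTE xu).
Qed.

Lemma setI_pair (T : finType) (A : {set T}) a b : a != b ->
  (A :&: [set a; b] == [set a]) = (a \in A) && (b \notin A).
Proof.
move=> ab; apply/eqP/andP => [/setP E|[aA bA]].
  by have := E a; have := E b; rewrite !inE !eqxx eq_sym (negbTE ab) orbT !andbT => ->.
apply/setP => j; rewrite !inE; have [->|_] := eqVneq j a; first by rewrite aA.
by have [->|_] := eqVneq j b; rewrite ?(negbTE bA) ?andbF.
Qed.

Lemma ilo_ihi (i : 'I_n) : ilo i != ihi i.
Proof. by rewrite -(inj_eq val_inj) /= /bump /= add1n ltn_eqF. Qed.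

Lemma fel_sumE (P : pred istate) (Q : rel istate) x y :
  (\sum_(u | P u) \sum_(v | Q u v) fel u v (1 : polyU)) (x, y) = (P x && Q x y)%:R.
Proof.
rewrite sum_ffunE big_mkcond /= (bigD1 x) //= [X in _ + X]big1 ?addr0 => [|u ux].
  case: ifP => // _; rewrite sum_ffunE big_mkcond (bigD1 y) //= big1 ?addr0 => [|v vy].
    by case: ifP => //; rewrite felE !eqxx.
  by case: ifP => // _; rewrite felE [y == v]eq_sym (negbTE vy) andbF.
case: ifP => // _; rewrite sum_ffunE big1 // => v _.
by rewrite felE [x == u]eq_sym (negbTE ux).
Qed.

Lemma LgenE (i : 'I_n) x y : Lgen k i (x, y) =
  [&& ihi i \in val x, ilo i \notin val x & val y == ilo i |: (val x :\ ihi i)]%:R.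
Proof. by rewrite fel_sumE setUC setI_pair 1?eq_sym ?ilo_ihi // andbA. Qed.

Lemma RgenE (i : 'I_n) x y : Rgen k i (x, y) =
  [&& ilo i \in val x, ihi i \notin val x & val y == ihi i |: (val x :\ ilo i)]%:R.
Proof. by rewrite fel_sumE setI_pair ?ilo_ihi // andbA. Qed.

Lemma pushed_down_L (i : 'I_n) x y : pushed_down i x y ->
  fel x x 1 * Lgen k i = fel x y 1.
Proof.
move=> /pushed_downP[lx hx ly hy [yE xE]]; apply/ffunP => -[u v].
rewrite fel_mull felE; case: eqP => //= _.
by rewrite gmonoxx mulr1 mul1r LgenE hx lx -yE (inj_eq val_inj); case: (v == y).
Qed.

Lemma pushed_down_R (i : 'I_n) x y : pushed_down i x y ->
  fel y y 1 * Rgen k i = fel y x 1.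
Proof.
move=> /pushed_downP[lx hx ly hy [yE xE]]; apply/ffunP => -[u v].
rewrite fel_mull felE; case: eqP => //= _.
by rewrite gmonoxx mulr1 mul1r RgenE ly hy -xE (inj_eq val_inj); case: (v == x).
Qed.

Lemma gmono_ht x y z : gmono x y z =
  mono (fun i => ((maxn (ht x i.+1) (ht y i.+1) - minn (ht x i.+1) (ht y i.+1)) +
    (maxn (ht y i.+1) (ht z i.+1) - minn (ht y i.+1) (ht z i.+1)) -
    (maxn (ht x i.+1) (ht z i.+1) - minn (ht x i.+1) (ht z i.+1)))./2).
Proof.
apply: eq_bigr => i _; congr (_ ^+ _); rewrite /gexp !ivE.
set a := ht x _; set b := ht y _; set c := ht z _; lia.
Qed.

Lemma gmono_between x y z :
  (forall i, (i < n)%N -> (minn (ht x i.+1) (ht z i.+1) <= ht y i.+1 <= maxn (ht x i.+1) (ht z i.+1))%N) ->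
  gmono x y z = 1.
Proof.
move=> h; rewrite gmono_ht /mono big1 // => i _; have := h _ (ltn_ord i).
set a := ht x _; set b := ht y _; set c := ht z _ => bet.
set e := (_./2); have -> : e = 0%N by rewrite /e; lia.
exact: expr0.
Qed.

(** Along a path that stays between its ends no factor U_i appears. *)
Lemma fel_between x y z (p q : polyU) :
  (forall i, (i < n)%N -> (minn (ht x i.+1) (ht z i.+1) <= ht y i.+1 <= maxn (ht x i.+1) (ht z i.+1))%N) ->
  fel x y p * fel y z q = fel x z (p * q).
Proof. by move=> h; rewrite fel_mul gmono_between // mulr1. Qed.

Lemma fel_between1 x y z :
  (forall i, (i < n)%N -> (minn (ht x i.+1) (ht z i.+1) <= ht y i.+1 <= maxn (ht x i.+1) (ht z i.+1))%N) ->
  fel x y 1 * fel y z 1 = fel x z (1 : polyU).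
Proof. by move=> h; rewrite (fel_between 1 1 h) mulr1. Qed.

Local Notation cl := (rcls (@Brel n k)).

Lemma rcls_Brel (a : B0 n k) : Brel a -> cl a = 0.
Proof.
move=> ra; apply: cls_gen; exists 1, a, 1; split=> //; by rewrite mul1r mulr1.
Qed.

(** The path that is the median of x, y and a staircase with one step at c. *)
Lemma median_exists x y (c r : nat) : exists z, forall i, (i <= n.+1)%N ->
  ht z i = maxn (minn (ht x i) (ht y i))
                (minn (if (i <= r)%N then c.+1 else c) (maxn (ht x i) (ht y i))).
Proof.
apply: ht_exists => [||i _].
- by rewrite !ht0 minnn maxnn; lia.
- by rewrite !ht_end // minnn maxnn minn0.
have := ht_step x i; have := ht_step y i.
set a := ht x i; set b := ht x i.+1; set e := ht y i; set f := ht y i.+1.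
by case: ifP; case: ifP; lia.
Qed.

(** Between x and y there is a chain x, z, z', z'', y without factors U_i whose
    middle part performs L_i, L_(i-1) in a row; the reversed chain performs
    R_(i-1), R_i. *)
Lemma crossing_up_eq0 x y i : (0 < i < n)%N -> (ht y i < ht x i.+1)%N ->
  cl (fel x y 1) = 0 /\ cl (fel y x 1) = 0.
Proof.
move=> /andP[i0 lin] lt; set c := ht y i.
(* The staircases drop from c + 1 to c just after i + 1, i and i - 1, so that
   z, z', z'' differ by pushing down two neighbouring corners in turn. *)
have [z zE] := median_exists x y c i.+1; have [z' z'E] := median_exists x y c i.
have [z'' z''E] := median_exists x y c i.-1.
have lin1 : (i.-1 < n)%N by lia.
have h1 : (i.+1 <= n.+1)%N by lia.
have h0 : (i <= n.+1)%N by lia.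
pose j := Ordinal lin; pose j' := Ordinal lin1.
have X0 := ht_step x i; have Y0 := ht_step y i.
have X1 := ht_step x i.+1; have Y1 := ht_step y i.+1.
have X2 := ht_step x i.-1; have Y2 := ht_step y i.-1; rewrite prednK // in X2 Y2.
have pd : pushed_down j z z'.
  split=> [|m mi].
    rewrite /= (zE _ h1) (z'E _ h1) leqnn ltnn.
    by move: lt X0 Y0; rewrite /c; lia.
  have [mn|mn] := leqP m n.+1; last by rewrite !ht_end // ltnW.
  by rewrite zE // z'E // [in LHS]leq_eqVlt (negbTE mi) ltnS.
have pd' : pushed_down j' z' z''.
  rewrite /pushed_down /= prednK //.
  split=> [|m mi].
    rewrite (z'E _ h0) (z''E _ h0) leqnn.
    have -> : (i <= i.-1)%N = false by lia.
    by move: lt X0 Y0; rewrite /c; lia.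
  have [mn|mn] := leqP m n.+1; last by rewrite !ht_end // ltnW.
  by rewrite z'E // z''E //; have -> : (m <= i)%N = (m <= i.-1)%N by lia.
have fL : fel z z' 1 * fel z' z'' 1 = fel z z 1 * (Lgen k j * Lgen k j').
  exact: (mul_chain (pushed_down_L pd) (pushed_down_L pd') (fel_mulr1 z z' 1)).
have fR : fel z'' z' 1 * fel z' z 1 = fel z'' z'' 1 * (Rgen k j' * Rgen k j).
  exact: (mul_chain (pushed_down_R pd') (pushed_down_R pd) (fel_mulr1 z'' z' 1)).
have bet m : (m < n)%N -> [/\
    (minn (ht x m.+1) (ht y m.+1) <= ht z m.+1 <= maxn (ht x m.+1) (ht y m.+1))%N,
    (minn (ht x m.+1) (ht y m.+1) <= ht z'' m.+1 <= maxn (ht x m.+1) (ht y m.+1))%N &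
    (minn (ht z m.+1) (ht z'' m.+1) <= ht z' m.+1 <= maxn (ht z m.+1) (ht z'' m.+1))%N].
  move=> mn; have mn' : (m.+1 <= n.+1)%N by exact: ltnW.
  rewrite (zE _ mn') (z'E _ mn') (z''E _ mn').
  set a := ht x _; set b := ht y _.
  by case: ifP; case: ifP; case: ifP; split; lia.
have betx m : (m < n)%N ->
    (minn (ht x m.+1) (ht z'' m.+1) <= ht z m.+1 <= maxn (ht x m.+1) (ht z'' m.+1))%N /\
    (minn (ht y m.+1) (ht z m.+1) <= ht z'' m.+1 <= maxn (ht y m.+1) (ht z m.+1))%N.
  move=> mn; have mn' : (m.+1 <= n.+1)%N by exact: ltnW.
  rewrite (zE _ mn') (z''E _ mn').
  have [e|ne] := eqVneq m i; [|have [e|ne'] := eqVneq m.+1 i].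
  - rewrite e leqnn; have -> : (i < i.-1)%N = false by lia.
    by move: lt X0 Y0; rewrite /c; lia.
  - rewrite e leqnSn; have -> : (i <= i.-1)%N = false by lia.
    by move: lt X0 Y0; rewrite /c; lia.
  - have -> : (m.+1 <= i.+1)%N = (m.+1 <= i.-1)%N by lia.
    by case: ifP; lia.
have fzz'' : fel z z' 1 * fel z' z'' 1 = fel z z'' (1 : polyU).
  by apply: fel_between1 => m /bet[].
have fz''z : fel z'' z' 1 * fel z' z 1 = fel z'' z (1 : polyU).
  by apply: fel_between1 => m /bet[_ _]; rewrite minnC maxnC.
have E1 : fel x z 1 * fel z z'' 1 * fel z'' y 1 = fel x y (1 : polyU).
  apply: mul2_eq; apply: fel_between1 => m mn; first by have [] := betx m mn.
  by have [_] := bet m mn.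
have E2 : fel y z'' 1 * fel z'' z 1 * fel z x 1 = fel y x (1 : polyU).
  apply: mul2_eq; apply: fel_between1 => m mn; first by have [] := betx m mn.
  by have [h _ _] := bet m mn; rewrite [minn (ht y _) _]minnC [maxn (ht y _) _]maxnC.
have jj : val j = (val j').+1 by rewrite /= prednK.
have L0 : cl (Lgen k j * Lgen k j') = 0 by apply: rcls_Brel; exact: Brel_L.
have R0 : cl (Rgen k j' * Rgen k j) = 0 by apply: rcls_Brel; exact: Brel_R.
have z0 (S T : pzRingType) (f : {rmorphism S -> T}) (t u v w w' : S) :
    t * u * v = w -> u = w' -> f w' = 0 -> f w = 0.
  by move=> <- -> h; apply/morph_mulr0/morph_mull0.
split.
  exact: (z0 _ _ _ _ _ _ _ _ E1 (esym fzz'') (etrans (congr1 cl fL) (morph_mull0 _ L0))).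
exact: (z0 _ _ _ _ _ _ _ _ E2 (esym fz''z) (etrans (congr1 cl fR) (morph_mull0 _ R0))).
Qed.

Lemma fel_scale_eq0 x y (p q : polyU) : cl (fel x y p) = 0 -> cl (fel x y (q * p)) = 0.
Proof.
have <- : fel x x q * fel x y p = fel x y (q * p) by rewrite fel_mul gmonoxx mulr1.
exact: morph_mull0.
Qed.

Lemma crossing_eq0 x y (p : polyU) : crossing x y -> cl (fel x y p) = 0.
Proof.
move=> [i [hi h]]; have <- : p * 1 = p := mulr1 p; apply: fel_scale_eq0.
by case: h => h; [exact: (crossing_up_eq0 hi h).1 | exact: (crossing_up_eq0 hi h).2].
Qed.

(** Take the detour through z that is min(x, y) up to a, one above the common
    path on the interval from a + 1 to b, and max(x, y) afterwards.  It costs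
    U_(a+1) ... U_b, and z contains neither a - 1 nor a, so that the remaining
    variable U_a kills it. *)
Lemma interval_eq0 x y (a b : nat) : (0 < a)%N -> (a <= b <= n)%N ->
  (forall m, (a <= m <= b)%N -> ht x m = ht y m) ->
  (forall m, (a <= m < b)%N -> ht x m = (ht x m.+1).+1) ->
  minn (ht x a.-1) (ht y a.-1) = ht x a ->
  maxn (ht x b.+1) (ht y b.+1) = ht x b ->
  cl (fel x y (\prod_(i < n | (a <= i.+1 <= b)%N) 'X_i)) = 0.
Proof.
move=> a0 /andP[ab bn] xy xd xa xb.
pose w m := if (m <= a)%N then minn (ht x m) (ht y m) else
  if (m <= b)%N then (ht x m).+1 else maxn (ht x m) (ht y m).
have [||i le_in|z zE] := @ht_exists n k w.
- by rewrite /w leq0n !ht0 minnn.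
- have -> : w n.+1 = maxn (ht x n.+1) (ht y n.+1).
    rewrite /w; have -> : (n.+1 <= a)%N = false by lia.
    by have -> : (n.+1 <= b)%N = false by lia.
  by rewrite !ht_end.
- have X0 := ht_step x i; have Y0 := ht_step y i.
  rewrite /w; have [ia|ia] := leqP i.+1 a; first by rewrite (ltnW ia); lia.
  have [ia'|ia'] := leqP i a.
    have {ia ia'}ia : i = a by lia.
    rewrite ia in X0 Y0 *; have [ab'|ab'] := leqP a.+1 b.
      have := xd a; have := xy a; lia.
    have eab : a = b by lia.
    by have := xy a; rewrite eab in X0 Y0 *; lia.
  have [ib|ib] := leqP i.+1 b.
    by rewrite (ltnW ib); have := xd i; lia.
  have [ib'|ib'] := leqP i b; last by lia.
  have {ib ib'}ib : i = b by lia.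
  by rewrite ib in X0 Y0 *; lia.
have an : (a.-1 < n)%N by lia.
(* The ordinal a - 1 stands for the variable U_a and the places a - 1, a. *)
pose j := Ordinal an.
have zj : val z :&: [set ilo j; ihi j] = set0.
  have zlo : ilo j \notin val z.
    rewrite ht_mem negbK /= prednK // !zE; try lia.
    by rewrite /w leqnn leq_pred xa; have := xy a; lia.
  have zhi : ihi j \notin val z.
    rewrite ht_mem negbK /= /bump /= add1n prednK // !zE; try lia.
    rewrite /w leqnn ltnn; have := xy a; have := xd a.
    have [ab'|ab'] := leqP a.+1 b; first by lia.
    have eab : a = b by lia.
    by move: xb; rewrite -eab => h _ xy'; rewrite h -xy' ?leqnn ?minnn.
  apply/setP => l; rewrite !inE; have [->|_] := eqVneq l (ilo j); first by rewrite (negbTE zlo).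
  by have [->|_] := eqVneq l (ihi j); rewrite ?(negbTE zhi) ?andbF.
have U0 : cl (fel z z 'X_j) = 0 by apply: rcls_Brel; exact: Brel_U.
have -> : fel x y (\prod_(i < n | (a <= i.+1 <= b)%N) 'X_i) = fel x z 1 * fel z z 'X_j * fel z y 1.
  rewrite !fel_mul gmonozz mul1r !mulr1; congr (fel _ _ _).
  rewrite (bigD1 j) /=; last by rewrite prednK // leqnn.
  congr (_ * _); rewrite big_mkcond gmono_ht; apply: eq_bigr => i _.
  rewrite -(inj_eq val_inj) /= (zE i.+1 (ltnW (ltn_ord i))).
  rewrite /w; have := xy i.+1; have := ltn_ord i; set u := ht x _; set v := ht y _ => lin xyi.
  rewrite -[RHS]/('X_i ^+ _); set e := (_./2).
  have -> : e = ((a <= i.+1 <= b)%N && (nat_of_ord i != a.-1)) :> nat.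
    rewrite /e; clear -xyi a0 ab bn lin; case: ifP => ia; first by lia.
    case: ifP => ib; last by lia.
    have -> : v = u by rewrite xyi //; lia.
    by lia.
  by case: (_ && _); [exact/esym/expr1 | exact/esym/expr0].
by apply/morph_mulr0/morph_mull0.
Qed.

End Relations.

(** * Left I-states and sequences of wedges and vees *)

Lemma sorted_nth_leq (s : seq nat) r p : sorted ltn s -> (r < size s)%N ->
  (nth 0%N s r <= p)%N = (r < count (fun a => a <= p)%N s)%N.
Proof.
elim: s r => // a s IH r /= as_; have ss := path_sorted as_.
have {as_}as_ : all (ltn a) s by rewrite (path_sortedE ltn_trans) in as_; case/andP: as_.
case: r => [|r] /=; last rewrite ltnS => rs.
  move=> _; case: (leqP a p) => //= pa; rewrite add0n; apply/esym/negbTE; rewrite -leqNgt leqn0.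
  rewrite -(@eq_in_count _ pred0) ?count_pred0 // => b /(allP as_) /= ab.
  by rewrite leqNgt (ltn_trans pa ab).
rewrite IH //; case: (leqP a p) => //= pa; rewrite add0n.
suff -> : count (fun a => a <= p)%N s = 0%N by [].
rewrite -(@eq_in_count _ pred0) ?count_pred0 // => b /(allP as_) /= ab.
by rewrite leqNgt (ltn_trans pa ab).
Qed.

Section Sequences.
Variables n k : nat.
Implicit Types (x y : istate n k) (la mu : wedgeseq n k).

Fact st_card mu : #|[set j : 'I_n.+1 | nth false (val mu) j]| == k.
Proof.
apply/eqP; rewrite -[RHS](eqP (valP mu)) -sum1dep_card big_mkcond big_ord_recr /=.
rewrite nth_default ?size_tuple // addn0 -sum1_count (big_nth false) size_tuple.
by rewrite big_mkord [RHS]big_mkcond.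
Qed.

Definition st mu : istate n k :=
  Sub [set j : 'I_n.+1 | nth false (val mu) j] (st_card mu).

Lemma st_mem mu (j : 'I_n.+1) : (j \in val (st mu)) = nth false (val mu) j.
Proof. by rewrite SubK inE. Qed.

Lemma st_left mu : left_istate (st mu).
Proof. by rewrite /left_istate st_mem nth_default // size_tuple. Qed.

Lemma st_corresp mu : corresp (st mu) mu.
Proof. by split; [exact: st_left | move=> i; rewrite st_mem (tnth_nth false)]. Qed.

Lemma corresp_st x mu : corresp x mu -> x = st mu.
Proof.
move=> [xl xmu]; apply: val_inj; apply/setP => j; rewrite st_mem.
have [jn|jn] := ltnP j n.
  rewrite -(tnth_nth false (val mu) (Ordinal jn)) xmu.
  by have -> : ilo (Ordinal jn) = j by exact: val_inj.
rewrite nth_default ?size_tuple //; have -> : j = ord_max.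
  by apply: val_inj => /=; have := ltn_ord j; lia.
exact: (negbTE xl).
Qed.

Lemma left_st x : left_istate x -> exists mu, x = st mu.
Proof.
move=> xl; pose t := [tuple (ilo i \in val x) | i < n].
have ct : count id t == k.
  apply/eqP; rewrite -[RHS](eqP (valP x)) count_map -sum1_count big_enum_cond /=.
  rewrite -sum1_card [RHS]big_mkcond big_ord_recr /=.
  have /negbTE -> : ord_max \notin val x by [].
  by rewrite addn0 big_mkcond.
exists (Sub t ct); apply: corresp_st; split=> // i.
by rewrite SubK tnth_mktuple.
Qed.

Lemma st_inj : injective st.
Proof.
move=> la mu e; apply: val_inj; apply: eq_from_tnth => i.
by rewrite (st_corresp la).2 (st_corresp mu).2 e.
Qed.

Lemma ht_left mu : ht (st mu) n = 0%N.
Proof. by have := st_left mu; rewrite left_istateE => /eqP. Qed.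

Lemma ht_st mu i : (i <= n)%N -> ht (st mu) i = count id (drop i (val mu)).
Proof.
move=> le; have [d] := ubnP (n - i); elim: d i le => // d IH i.
rewrite leq_eqVlt => /orP[/eqP -> _|lt dn].
  by rewrite ht_left drop_oversize ?size_tuple.
rewrite (drop_nth false) ?size_tuple //= -IH ?(htS _ (widen_ord (leqnSn n) (Ordinal lt))) ?st_mem //.
by lia.
Qed.

Lemma bseqE mu (i : 'I_n) : bseq mu i = (ht (st mu) i.+1).+1.
Proof. by rewrite ht_st. Qed.

Lemma bseq_iv mu (i : 'I_n) : bseq mu i = (iv (st mu) i).+1.
Proof. exact: bseqE. Qed.

Lemma bseq_step mu : stepseq (bseq mu).
Proof.
split=> [i|i j ji]; first by rewrite bseqE.
by rewrite !bseqE ji !ltnS; exact: ht_step.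
Qed.

Lemma ht_bound mu i : (i <= n)%N -> (k <= i + ht (st mu) i)%N.
Proof.
move=> _; elim: i => [|i IH]; first by rewrite ht0.
by have := ht_step (st mu) i; lia.
Qed.

Lemma count_vees mu p : (p <= n)%N ->
  count (fun i => ~~ nth false (val mu) i) (iota 0 p) = (p + ht (st mu) p - k)%N.
Proof.
elim: p => [|p IH] pn; first by rewrite ht0 subnn.
rewrite -addn1 iotaD count_cat IH ?(ltnW pn) //= add0n addn0.
have := htS (st mu) (widen_ord (leqnSn n) (Ordinal pn)); rewrite st_mem /=.
have := ht_bound mu (ltnW pn); rewrite addn1.
by case: (nth _ _ _) => /=; lia.
Qed.

Lemma vees_bound mu p : (p <= n)%N -> (p + ht (st mu) p <= n)%N.
Proof.
move=> le; have [d] := ubnP (n - p); elim: d p le => // d IH p.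
rewrite leq_eqVlt => /orP[/eqP -> _|lt dn]; first by rewrite ht_left addn0.
have := IH p.+1 lt; have := ht_step (st mu) p; lia.
Qed.

(** The j-th vee is at p or before exactly when at least j of the first p
    symbols are vees, and their number is p + ht p - k by [count_vees]. *)
Lemma vee_pos_le mu j p : (0 < j <= n - k)%N -> (p <= n)%N ->
  (vee_pos mu j <= p)%N = (j + k <= p + ht (st mu) p)%N.
Proof.
move=> /andP[j0 jk] pn; rewrite /vee_pos.
set vs := [seq i <- iota 0 n | ~~ nth false (val mu) i].
have szv : size vs = (n - k)%N by rewrite size_filter count_vees // ht_left addn0.
rewrite sorted_nth_leq ?size_map ?szv; last by rewrite prednK.
  rewrite count_map count_filter.
  have -> : count (predI (preim S (fun a => a <= p)%N) (fun i => ~~ nth false (val mu) i)) (iota 0 n)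
          = count (fun i => ~~ nth false (val mu) i) (iota 0 p).
    have -> : iota 0 n = iota 0 p ++ iota p (n - p) by rewrite -[X in iota 0 X](subnKC pn) iotaD.
    rewrite count_cat [X in (_ + X)%N](_ : _ = 0%N).
      rewrite addn0; apply: eq_in_count => i; rewrite mem_iota add0n /= => /= ->.
      by [].
    rewrite -(@eq_in_count _ pred0) ?count_pred0 // => i; rewrite mem_iota /= => /andP[pi _].
    by rewrite ltnNge pi.
  by rewrite count_vees // prednK //; have := ht_bound mu pn; lia.
rewrite (@sorted_map _ _ S) /=.
apply: (sorted_filter ltn_trans); exact: iota_ltn_sorted.
Qed.

Lemma vee_pos_range mu j : (0 < j <= n - k)%N -> (0 < vee_pos mu j <= n)%N.
Proof.
move=> hj; rewrite vee_pos_le // ht_left ltnNge vee_pos_le // ht0; lia.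
Qed.

Lemma dfar_crossing la mu : dfar la mu -> crossing (st la) (st mu).
Proof.
have H la' mu' j : (0 < j < n - k)%N -> (vee_pos la' j.+1 <= vee_pos mu' j)%N ->
    exists i, (0 < i < n)%N /\ (ht (st mu') i < ht (st la') i.+1)%N.
  move=> hj; have hj1 : (0 < j.+1 <= n - k)%N by lia.
  have hj0 : (0 < j <= n - k)%N by lia.
  have /andP[p0 pn] := vee_pos_range la' hj1.
  have : (vee_pos la' j.+1 <= vee_pos la' j.+1)%N by [].
  rewrite {1}vee_pos_le //; set p := vee_pos la' _ in p0 pn * => Np pv.
  have : ~~ (vee_pos mu' j <= p.-1)%N by lia.
  rewrite vee_pos_le //; last by lia.
  rewrite -ltnNge => Nq; exists p.-1; rewrite prednK //.
  have := ht_step (st la') 0; rewrite ht0.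
  have [p1|p1] := eqVneq p 1%N; first by rewrite p1 in Np Nq *; lia.
  by split; lia.
move=> /hasP[j]; rewrite mem_iota => hj; have {}hj : (0 < j < n - k)%N by lia.
case/orP=> /(H _ _ _ hj)[i [hi lt]]; exists i; split=> //; [by left | by right].
Qed.

Lemma crossing_dfar la mu : crossing (st la) (st mu) -> dfar la mu.
Proof.
have H la' mu' i : (0 < i < n)%N -> (ht (st mu') i < ht (st la') i.+1)%N ->
    exists2 j, (0 < j < n - k)%N & (vee_pos la' j.+1 <= vee_pos mu' j)%N.
  move=> hi lt; have i1n : (i.+1 <= n)%N by lia.
  have b1 := vees_bound la' i1n; have i0n : (i <= n)%N by lia.
  have b0 := ht_bound mu' i0n.
  pose j := (i + ht (st la') i.+1 - k)%N.
  have hj : (0 < j < n - k)%N by rewrite /j; lia.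
  exists j => //; have h1 : (vee_pos la' j.+1 <= i.+1)%N by rewrite vee_pos_le //; rewrite /j; lia.
  have h2 : ~~ (vee_pos mu' j <= i)%N by rewrite vee_pos_le //; rewrite /j; lia.
  by lia.
move=> [i [hi h]]; apply/hasP; case: h => /(H _ _ _ hi)[j hj le]; exists j.
- by rewrite mem_iota; lia.
- by rewrite le.
- by rewrite mem_iota; lia.
- by rewrite le orbT.
Qed.

(** An element r of one state that is at least 2 above that of the other one
    gives a crossing just after the smaller of the two. *)
Lemma ifar_crossing x y : ifar x y -> crossing x y.
Proof.
have szE (z : istate n k) : size (ienum z) = k by rewrite size_map -cardE; exact: (eqP (valP z)).
have srt (z : istate n k) : sorted ltn (ienum z).
  rewrite /ienum sorted_map /=.
  rewrite /enum_mem -enumT; apply: sorted_filter; first by move=> a b c; exact: ltn_trans.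
  by have := iota_ltn_sorted 0 n.+1; rewrite -val_enum_ord sorted_map.
have cnt (z : istate n k) p : count (fun a => a <= p)%N (ienum z) = (k - ht z p.+1)%N.
  have := count_predC (fun a => a <= p)%N (ienum z); rewrite szE.
  suff -> : count (predC (fun a => a <= p)%N) (ienum z) = ht z p.+1.
    by move=> e; rewrite -[X in (X - _)%N]e addnK.
  rewrite count_map /ht cardE -size_filter; congr size.
  rewrite /enum_mem -filter_predI.
  by apply: eq_filter => j; rewrite /= inE andbC -ltnNge.
have H (z z' : istate n k) (r : 'I_k) : (nth 0%N (ienum z') r + 2 <= nth 0%N (ienum z) r)%N ->
    exists i, (0 < i < n)%N /\ (ht z' i < ht z i.+1)%N.
  have [sz sz'] : (r < size (ienum z))%N /\ (r < size (ienum z'))%N by rewrite !szE.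
  set b := nth _ (ienum z') r => le.
  have : (nth 0%N (ienum z') r <= b)%N by [].
  rewrite sorted_nth_leq // cnt => h1.
  have : ~~ (nth 0%N (ienum z) r <= b.+1)%N by lia.
  rewrite sorted_nth_leq // cnt => h2; have rk := ltn_ord r.
  exists b.+1; split; last by lia.
  have [bn|bn] := leqP b.+2 n; first by lia.
  by move: h2; rewrite ht_end //; lia.
case/existsP => r hr.
have [le|lt] := leqP (nth 0%N (ienum x) r) (nth 0%N (ienum y) r).
  have /H[i [hi lt]] : (nth 0%N (ienum x) r + 2 <= nth 0%N (ienum y) r)%N by lia.
  by exists i; split=> //; right.
have /H[i [hi lt']] : (nth 0%N (ienum y) r + 2 <= nth 0%N (ienum x) r)%N by lia.
by exists i; split=> //; left.
Qed.

(** On the interval from alpha_j to beta_j both paths have seen exactly j vees,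
    so they coincide there, and descend at each step in between; at the ends one
    of them has a vee. *)
Lemma interval_mono_eq0 la mu j : (0 < j <= n - k)%N ->
  rcls (@Brel n k) (fel (st mu) (st la)
    (\prod_(i < n | (alpha_pos la mu j <= i.+1 <= beta_pos la mu j)%N) 'X_i)) = 0.
Proof.
move=> hj; have [/dfar_crossing/crossingC/crossing_eq0 -> //|nfar] := boolP (dfar la mu).
have /andP[l0 ln] := vee_pos_range la hj; have /andP[m0 mn] := vee_pos_range mu hj.
set a := alpha_pos la mu j; set b := beta_pos la mu j.
have a0 : (0 < a)%N by rewrite /a /alpha_pos; lia.
have an : (a <= n)%N by rewrite /a /alpha_pos; lia.
have bn : (b <= n)%N.
  rewrite /b /beta_pos; case: ifP => // lt.
  have hj1 : (0 < j.+1 <= n - k)%N by lia.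
  by have := vee_pos_range la hj1; lia.
have ab : (a <= b)%N.
  rewrite /b /beta_pos; case: ifP => // lt.
  have hj1 : (0 < j.+1 <= n - k)%N by lia.
  have h (nu : wedgeseq n k) : (vee_pos nu j < vee_pos nu j.+1)%N.
    have /andP[p0 pn] := vee_pos_range nu hj1.
    have : ~~ (vee_pos nu j.+1 <= (vee_pos nu j.+1).-1)%N by lia.
    have : (vee_pos nu j.+1 <= vee_pos nu j.+1)%N by [].
    rewrite {1}vee_pos_le // vee_pos_le; [|by []|by lia] => h1 h2.
    have : (vee_pos nu j <= (vee_pos nu j.+1).-1)%N; last by lia.
    rewrite vee_pos_le //; last by lia.
    by have := ht_step (st nu) (vee_pos nu j.+1).-1; rewrite prednK //; lia.
  move/hasPn: nfar => /(_ j); rewrite mem_iota => nfar.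
  have {}nfar : ~~ ((vee_pos la j.+1 <= vee_pos mu j) || (vee_pos mu j.+1 <= vee_pos la j))%N.
    by apply: nfar; lia.
  by have := h la; have := h mu; rewrite /a /alpha_pos; lia.
have ge (nu : wedgeseq n k) m : (vee_pos nu j <= m <= n)%N -> (j + k <= m + ht (st nu) m)%N.
  by move=> /andP[le mn']; rewrite -vee_pos_le.
have lt (nu : wedgeseq n k) m : (m < vee_pos nu j)%N -> (m + ht (st nu) m < j + k)%N.
  move=> lt; rewrite ltnNge -vee_pos_le //; first by lia.
  by have := vee_pos_range nu hj; lia.
have up m nu : nu = la \/ nu = mu -> (m <= b)%N -> (m + ht (st nu) m <= j + k)%N.
  move=> hnu; rewrite /b /beta_pos; case: ifP => lt' mb; last first.
    by have := vees_bound nu mb; lia.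
  have hj1 : (0 < j.+1 <= n - k)%N by lia.
  have /andP[v0 vn] := vee_pos_range nu hj1.
  have : ~~ (vee_pos nu j.+1 <= m)%N by case: hnu mb v0 => ->; lia.
  by rewrite vee_pos_le //; case: hnu mb vn => ->; lia.
have ein nu m : nu = la \/ nu = mu -> (a <= m <= b)%N -> (m + ht (st nu) m = j + k)%N.
  move=> hnu /andP[am mb]; apply/eqP; rewrite eqn_leq up // ge //.
  by case: hnu => ->; move: am; rewrite /a /alpha_pos; lia.
apply: interval_eq0 => //; first by rewrite ab bn.
- move=> m hm; have := ein la m (or_introl erefl) hm; have := ein mu m (or_intror erefl) hm; lia.
- move=> m hm; have hm1 : (a <= m <= b)%N by lia.
  have hm2 : (a <= m.+1 <= b)%N by lia.
  have := ein mu m (or_intror erefl) hm1; have := ein mu m.+1 (or_intror erefl) hm2; lia.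
- have haa : (a <= a <= b)%N by rewrite leqnn.
  have := ein mu a (or_intror erefl) haa; have := ein la a (or_introl erefl) haa.
  have Sl := ht_step (st la) a.-1; have Sm := ht_step (st mu) a.-1; rewrite prednK // in Sl Sm.
  have [eq|eq] : a = vee_pos la j \/ a = vee_pos mu j by rewrite /a /alpha_pos; lia.
    have : (a.-1 < vee_pos la j)%N by rewrite -eq; lia.
    by move/lt; lia.
  have : (a.-1 < vee_pos mu j)%N by rewrite -eq; lia.
  by move/lt; lia.
- have hbb : (a <= b <= b)%N by rewrite leqnn andbT.
  have := ein mu b (or_intror erefl) hbb; have := ein la b (or_introl erefl) hbb.
  have Sl := ht_step (st la) b; have Sm := ht_step (st mu) b.
  move: Sl Sm hbb; rewrite /b /beta_pos; case: ifP => lt'; last first.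
    by rewrite !ht_left ht_end //; lia.
  have hj1 : (0 < j.+1 <= n - k)%N by lia.
  have /andP[vl0 vln] := vee_pos_range la hj1; have /andP[vm0 vmn] := vee_pos_range mu hj1.
  set v := minn _ _; have v0 : (0 < v)%N by rewrite /v; lia.
  rewrite prednK // => Sl Sm _.
  have vn : (v <= n)%N by rewrite /v; lia.
  have [eq|eq] : v = vee_pos la j.+1 \/ v = vee_pos mu j.+1 by rewrite /v; lia.
    have : (vee_pos la j.+1 <= v)%N by rewrite eq.
    by rewrite vee_pos_le //; lia.
  have : (vee_pos mu j.+1 <= v)%N by rewrite eq.
  by rewrite vee_pos_le //; lia.
Qed.

End Sequences.

(** * Maps between the cyclic modules R_b *)

Lemma span_sum (V : zmodType) (S : V -> Prop) I (r : seq I) (P : pred I) (F : I -> V) :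
  (forall i, P i -> span S (F i)) -> span S (\sum_(i <- r | P i) F i).
Proof. by move=> h; elim/big_ind: _ => //; [exact: span0 | exact: spanD]. Qed.

Section CyclicHoms.
Variable n : nat.
Local Notation R := {mpoly int[n]}.
Implicit Types (b : 'I_n -> nat) (p q : R).

Lemma IbP b (p : R^o) : span (lgen (Ib_gen b)) p <-> in_gens predT (hgen b) p.
Proof.
split=> [|[a ->]].
  elim=> [|_ [r [_ [[l ->] ->]]]|q r _ IHq _ IHr].
  - exact: in_gens0.
  - by apply: in_gensMl; exact: (in_gens_gen (hgen b)).
  - exact: in_gensB.
apply: span_sum => l _.
by apply: span_gen; exists (a l), (hgen b l); split=> //; exists l.
Qed.

Lemma Rbcls_eq b p q : Rbcls b p = Rbcls b q <-> in_gens predT (hgen b) (p - q).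
Proof. by rewrite -IbP; exact: clsP. Qed.

Lemma RbclsD b p q : Rbcls b (p + q) = Rbcls b p + Rbcls b q.
Proof. exact: (raddfD (mcls (Ib_gen b))). Qed.

Lemma RbclsZ b p q : p *: Rbcls b q = Rbcls b (p * q).
Proof. exact: mscaleE. Qed.

Lemma Rbcls_surj b (z : Rb b) : exists q, z = Rbcls b q.
Proof. by exists (crep z); rewrite [RHS]crepK. Qed.

Lemma maps_okP b b' p : maps_ok b b' p <->
  forall q, in_gens predT (hgen b) q -> in_gens predT (hgen b') (q * p).
Proof.
split=> h q; first by move=> /IbP /h /IbP.
by move=> /IbP /h /IbP.
Qed.

Lemma maps_okMl b b' p q : maps_ok b b' p -> maps_ok b b' (q * p).
Proof.
move=> /maps_okP h; apply/maps_okP => r /h.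
by rewrite mulrCA; apply: in_gensMl.
Qed.

Lemma maps_okD b b' p q : maps_ok b b' p -> maps_ok b b' q -> maps_ok b b' (p + q).
Proof.
by move=> /maps_okP hp /maps_okP hq; apply/maps_okP => r br; rewrite mulrDr; apply: in_gensD; auto.
Qed.

Lemma maps_okN b b' p : maps_ok b b' p -> maps_ok b b' (- p).
Proof. by rewrite -mulN1r; exact: maps_okMl. Qed.

Lemma maps_ok_ideal b b' p : in_gens predT (hgen b') p -> maps_ok b b' p.
Proof. by move=> h; apply/maps_okP => q _; exact: in_gensMl. Qed.

Lemma mapstoE b b' p q : maps_ok b b' p -> lapp (mapsto b b' p) (Rbcls b q) = Rbcls b' (q * p).
Proof. exact: mapsto_funE. Qed.

Lemma mapstoD b b' p q : maps_ok b b' p -> maps_ok b b' q ->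
  mapsto b b' (p + q) = mapsto b b' p + mapsto b b' q.
Proof.
move=> hp hq; apply: lhomP => z; have [r ->] := Rbcls_surj z.
rewrite mapstoE; last exact: maps_okD.
by rewrite mulrDr RbclsD -(mapstoE _ hp) -(mapstoE _ hq).
Qed.

Lemma mapstoN b b' p : maps_ok b b' p -> mapsto b b' (- p) = - mapsto b b' p.
Proof.
move=> hp; apply/eqP; rewrite -addr_eq0 -mapstoD ?addNr ?mapsto0 //.
exact: maps_okN.
Qed.

Lemma mapstoB b b' p q : maps_ok b b' p -> maps_ok b b' q ->
  mapsto b b' (p - q) = mapsto b b' p - mapsto b b' q.
Proof. by move=> hp hq; rewrite mapstoD ?mapstoN //; exact: maps_okN. Qed.

Lemma mapstoZ b b' p q : maps_ok b b' p -> mapsto b b' (q * p) = q *: mapsto b b' p.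
Proof.
move=> hp; apply: lhomP => z; have [r ->] := Rbcls_surj z.
rewrite mapstoE; last exact: maps_okMl.
by rewrite mulrCA -RbclsZ -(mapstoE _ hp).
Qed.

Lemma mapsto_eq0 b b' p : maps_ok b b' p -> mapsto b b' p = 0 <-> in_gens predT (hgen b') p.
Proof.
move=> hp; split=> [h|bp].
  have := mapstoE 1 hp; rewrite h mul1r.
  have -> : lapp (0 : lhom (Rb b) (Rb b')) (Rbcls b 1) = Rbcls b' 0 by rewrite [RHS](raddf0 (mcls _)).
  by move/esym/Rbcls_eq; rewrite subr0.
apply: lhomP => z; have [r ->] := Rbcls_surj z; rewrite mapstoE //.
have -> : lapp (0 : lhom (Rb b) (Rb b')) (Rbcls b r) = Rbcls b' 0 by rewrite [RHS](raddf0 (mcls _)).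
by apply/Rbcls_eq; rewrite subr0; exact: in_gensMl.
Qed.

Lemma mapsto_sum b b' I (r : seq I) (P : pred I) (F : I -> R) :
  (forall i, P i -> maps_ok b b' (F i)) ->
  mapsto b b' (\sum_(i <- r | P i) F i) = \sum_(i <- r | P i) mapsto b b' (F i).
Proof.
move=> ok; have : mapsto b b' (\sum_(i <- r | P i) F i) = \sum_(i <- r | P i) mapsto b b' (F i) /\
    maps_ok b b' (\sum_(i <- r | P i) F i); last by case.
elim/big_rec2: _ => [|i f p Pi [e okp]].
  by split; [exact: mapsto0 | apply: maps_ok_ideal; exact: in_gens0].
by split; [rewrite mapstoD ?e //; exact: ok | apply: maps_okD => //; exact: ok].
Qed.

Lemma mapsto_comp b b' b'' p q : maps_ok b b' p -> maps_ok b' b'' q ->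
  lcomp (mapsto b' b'' q) (mapsto b b' p) = mapsto b b'' (p * q).
Proof.
move=> hp hq; apply: lhomP => z; have [r ->] := Rbcls_surj z.
rewrite -[LHS]/(lapp (mapsto b' b'' q) (lapp (mapsto b b' p) (Rbcls b r))).
rewrite mapstoE // mapstoE // mapstoE ?mulrA //.
apply/maps_okP => s /(proj1 (maps_okP _ _ _) hp)/(proj1 (maps_okP _ _ _) hq).
by rewrite mulrA.
Qed.

(** A map out of a cyclic module is determined by the image of 1. *)
Lemma mapsto_surj b b' (f : lhom (Rb b) (Rb b')) :
  exists2 p, maps_ok b b' p & f = mapsto b b' p.
Proof.
have [p fp] := Rbcls_surj (lapp f (Rbcls b 1)).
have fE q : lapp f (Rbcls b q) = Rbcls b' (q * p).
  by rewrite -RbclsZ -fp -[q in LHS]mulr1 -RbclsZ linearZ.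
have okp : maps_ok b b' p.
  apply/maps_okP => q bq; have := fE q.
  have -> : Rbcls b q = 0.
    rewrite -[RHS](raddf0 (mcls (Ib_gen b))); apply/Rbcls_eq; by rewrite subr0.
  rewrite raddf0 -[LHS](raddf0 (mcls (Ib_gen b'))) => /esym/Rbcls_eq.
  by rewrite subr0.
exists p => //; apply: lhomP => z; have [r ->] := Rbcls_surj z.
by rewrite fE mapstoE.
Qed.

End CyclicHoms.

(** * The kernel of Xi *)

Section Kernel.
Variables n k : nat.
Local Notation polyU := {mpoly int[n]}.
Implicit Types (x y : istate n k) (la mu : wedgeseq n k) (a : B0 n k) (p q : polyU).

Local Notation cexp la mu := (fun i => (bseq mu i - bseq la i)%N).

Definition left_supported a : Prop :=
  forall x y, ~~ (left_istate x && left_istate y) -> a (x, y) = 0.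

(** The common lift of the two algebras: a matrix a of polynomials gives an
    element of the left algebra, ... *)
Definition toB a : BlOSz n k := cproj (el_left n k) (rcls (@Brel n k) a).

(** ... and the family of maps 1 |-> a x^c. *)
Definition toH a : Hring n k := fun la mu =>
  mapsto (bseq la) (bseq mu) (a (st mu, st la) * mono (cexp la mu)).

Lemma ok_mono la mu p : maps_ok (bseq la) (bseq mu) (p * mono (cexp la mu)).
Proof.
apply: maps_okMl; apply/maps_okP => q.
exact: (mono_hom (bseq_step la) (bseq_step mu)).
Qed.

Arguments ok_mono : clear implicits.

Lemma toHB a b : toH (a - b) = toH a - toH b.
Proof.
apply: HringP => la mu; rewrite [LHS]/toH !ffunE mulrBl.
by rewrite mapstoB //; exact: ok_mono.
Qed.

Lemma toBB a b : toB (a - b) = toB a - toB b.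
Proof.
apply: val_inj; rewrite [RHS](raddfB val) /=.
by rewrite (raddfB (rcls (@Brel n k))) mulrBr mulrBl.
Qed.

HB.instance Definition _ := GRing.isZmodMorphism.Build _ _ toH toHB.
HB.instance Definition _ := GRing.isZmodMorphism.Build _ _ toB toBB.

Lemma left_supported_fel mu la p : left_supported (fel (st mu) (st la) p).
Proof.
by move=> x y nl; rewrite felE; case: ifP => // /andP[/eqP ex /eqP ey]; rewrite ex ey !st_left in nl.
Qed.

Lemma left_supported_sum a : left_supported a ->
  a = \sum_mu \sum_la fel (st mu) (st la) (a (st mu, st la)).
Proof.
move=> al; apply/ffunP => -[x y]; rewrite sum_ffunE.
under eq_bigr do rewrite sum_ffunE.
have [/andP[/left_st[mu ->] /left_st[la ->]]|nl] := boolP (left_istate x && left_istate y).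
  rewrite (bigD1 mu) //= [X in _ + X]big1 => [|mu' mm]; last first.
    by rewrite big1 // => la' _; rewrite felE (inj_eq (@st_inj n k)) eq_sym (negbTE mm).
  rewrite addr0 (bigD1 la) //= big1 => [|la' ll]; first by rewrite felE !eqxx addr0.
  by rewrite felE !(inj_eq (@st_inj n k)) [la == _]eq_sym (negbTE ll) andbF.
rewrite al // big1 // => mu _; rewrite big1 // => la _.
exact: left_supported_fel.
Qed.

Lemma left_supportedP a : left_supported a <->
  isum (@left_istate n k) * a = a /\ a * isum (@left_istate n k) = a.
Proof.
have L x y : (isum (@left_istate n k) * a) (x, y) = if left_istate x then a (x, y) else 0.
  rewrite B0_mulE (bigD1 x) //= big1 => [|z zx]; last by rewrite isumE eq_sym (negbTE zx) !mul0r.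
  by rewrite isumE eqxx gmonoxx mulr1 addr0; case: ifP => _; rewrite ?mul1r ?mul0r.
have Rt x y : (a * isum (@left_istate n k)) (x, y) = if left_istate y then a (x, y) else 0.
  rewrite B0_mulE (bigD1 y) //= big1 => [|z zx]; last by rewrite isumE (negbTE zx) mulr0 mul0r.
  by rewrite isumE eqxx gmonozz mulr1 addr0; case: ifP => _; rewrite ?mulr1 ?mulr0.
split=> [al|[el er] x y].
  split; apply/ffunP => -[x y]; rewrite (L, Rt); case: ifP => // nl; rewrite al ?nl ?andbF //.
by rewrite negb_and => /orP[] /negbTE nl; [rewrite -el L nl | rewrite -er Rt nl].
Qed.

Lemma toB_val a : left_supported a -> cval (toB a) = rcls (@Brel n k) a.
Proof.
move=> /left_supportedP[el er].
by rewrite -[LHS]/(rcls _ _ * rcls _ _ * rcls _ _) -!rmorphM el er.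
Qed.

Lemma toB_mul a b : left_supported a -> left_supported b -> toB (a * b) = toB a * toB b.
Proof.
move=> al bl; apply: val_inj; rewrite [RHS]cvalM -[LHS]/(cval _) !toB_val //.
  exact: rmorphM.
have [ea _] := (left_supportedP a).1 al; have [_ eb] := (left_supportedP b).1 bl.
by apply/left_supportedP; split; rewrite ?mulrA ?ea // -mulrA eb.
Qed.

Lemma toB_surj (b : BlOSz n k) : exists2 a, left_supported a & b = toB a.
Proof.
pose a := isum (@left_istate n k) * crep (cval b) * isum (@left_istate n k).
have al : left_supported a.
  have ee : isum (@left_istate n k) * isum (@left_istate n k) = isum (@left_istate n k).
    by rewrite isumM; apply: eq_bigl => x; rewrite /= andbb.
  by apply/left_supportedP; rewrite /a -!mulrA ee !mulrA ee.
exists a => //; apply: val_inj; rewrite -[RHS]/(cval _) toB_val //.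
have hb : rcls (@Brel n k) (crep (cval b)) = cval b by exact: crepK.
rewrite -[LHS](eqP (cvalP b)) -{1}hb /a.
by rewrite [RHS]rmorphM (rmorphM (rcls (@Brel n k)) (isum _)).
Qed.

Lemma toH_fel mu la p : toH (fel (st mu) (st la) p) = hel la mu (p * mono (cexp la mu)).
Proof.
apply: HringP => la' mu'; rewrite /toH /hel felE !(inj_eq (@st_inj n k)) andbC.
have [/andP[/eqP -> /eqP ->] //|_] := boolP (_ && _).
by rewrite mul0r mapsto0.
Qed.

Definition fel_matrix (F : wedgeseq n k * wedgeseq n k -> polyU) : B0 n k :=
  \sum_mu \sum_la fel (st mu) (st la) (F (la, mu)).

Lemma fel_matrixE F la mu : fel_matrix F (st mu, st la) = F (la, mu).
Proof.
rewrite /fel_matrix sum_ffunE (bigD1 mu) //= [X in _ + X]big1 => [|mu' mm]; last first.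
  by rewrite sum_ffunE big1 // => la' _; rewrite felE (inj_eq (@st_inj n k)) eq_sym (negbTE mm).
rewrite addr0 sum_ffunE (bigD1 la) //= big1 => [|la' ll]; first by rewrite felE !eqxx addr0.
by rewrite felE !(inj_eq (@st_inj n k)) [la == _]eq_sym (negbTE ll) andbF.
Qed.

Lemma left_supported_matrix F : left_supported (fel_matrix F).
Proof.
move=> x y nl; rewrite /fel_matrix sum_ffunE big1 // => mu _; rewrite sum_ffunE big1 // => la _.
exact: left_supported_fel.
Qed.

(** This is [mono_gen]. *)
Lemma toH_surj (h : Hring n k) : exists2 a, left_supported a & h = toH a.
Proof.
have ex la mu : exists q, h la mu = mapsto (bseq la) (bseq mu) (q * mono (cexp la mu)).
  have [p okp hp] := mapsto_surj (h la mu).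
  have [q pq] := mono_gen (bseq_step la) (bseq_step mu)
    (fun l => eq_ind_r _ ((maps_okP _ _ _).1 okp _ (in_gens_gen (hgen (bseq la)) isT)) (mulrC p (hgen (bseq la) l))).
  exists q; rewrite hp; apply/eqP; rewrite -subr_eq0 -mapstoB //; last exact: ok_mono.
  by apply/eqP/mapsto_eq0 => //; apply: maps_ok_ideal.
have [F hF] := choice (fun u : wedgeseq n k * wedgeseq n k => ex u.1 u.2).
exists (fel_matrix F); first exact: left_supported_matrix.
by apply: HringP => la mu; rewrite /toH fel_matrixE (hF (la, mu)).
Qed.

(** The factor U^g in the product of B_0 is the failure of the monomials x^c to
    be multiplicative; hence [toH] respects products. *)
Lemma mono_cocycle la mu nu :
  mono (cexp mu nu) * mono (cexp la mu) = gmono (st nu) (st mu) (st la) * mono (cexp la nu).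
Proof.
rewrite gmono_ht /mono -!big_split /=; apply: eq_bigr => i _; rewrite -!exprD; congr (_ ^+ _).
rewrite !bseqE; set u := ht _ _; set v := ht _ _; set w := ht _ _; lia.
Qed.

Lemma toH_mul a b : left_supported a -> left_supported b -> toH (a * b) = toH a * toH b.
Proof.
move=> al bl; apply: HringP => la nu.
rewrite -[RHS]/(\sum_mu lcomp (toH a mu nu) (toH b la mu)) [LHS]/toH B0_mulE.
have -> : \sum_y a (st nu, y) * b (y, st la) * gmono (st nu) y (st la) =
          \sum_mu a (st nu, st mu) * b (st mu, st la) * gmono (st nu) (st mu) (st la).
  rewrite (bigID (@left_istate n k)) /= addrC big1 => [|y nl]; last first.
    by rewrite al ?(negbTE nl) ?andbF // !mul0r.
  rewrite add0r; transitivity (\sum_(y in [set st mu | mu in [set: wedgeseq n k]])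
      a (st nu, y) * b (y, st la) * gmono (st nu) y (st la)).
    apply: eq_bigl => y; apply/idP/imsetP => [/left_st[mu ->]|[mu _ ->]]; last exact: st_left.
    by exists mu; rewrite ?inE.
  rewrite big_imset /=; last by move=> ? ? _ _ /st_inj.
  by apply: eq_bigl => mu; rewrite inE.
rewrite mulr_suml.
have ok mu : maps_ok (bseq la) (bseq nu)
    (b (st mu, st la) * mono (cexp la mu) * (a (st nu, st mu) * mono (cexp mu nu))).
  apply/maps_okP => q /((maps_okP _ _ _).1 (ok_mono la mu _))/((maps_okP _ _ _).1 (ok_mono mu nu _)).
  by move=> h; rewrite [q * _]mulrA; exact: h.
have E mu : a (st nu, st mu) * b (st mu, st la) * gmono (st nu) (st mu) (st la) * mono (cexp la nu) =
    b (st mu, st la) * mono (cexp la mu) * (a (st nu, st mu) * mono (cexp mu nu)).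
  rewrite -[LHS]mulrA -mono_cocycle; set u := mono _; set v := mono _.
  by rewrite [a _ * b _]mulrC [RHS]mulrACA [v * u]mulrC.
have -> : \sum_mu lcomp (toH a mu nu) (toH b la mu) = \sum_mu mapsto (bseq la) (bseq nu)
    (b (st mu, st la) * mono (cexp la mu) * (a (st nu, st mu) * mono (cexp mu nu))).
  by apply: eq_bigr => mu _; rewrite mapsto_comp //; exact: ok_mono.
under eq_bigr do rewrite E.
by apply: mapsto_sum => mu _; exact: ok.
Qed.

Lemma left_supportedB a b : left_supported a -> left_supported b -> left_supported (a - b).
Proof. by move=> al bl x y nl; rewrite !ffunE al // bl // subrr. Qed.

(** Xi kills these because h_(b_i) is a relation of R_b; they turn out to
    generate its kernel. *)
Definition symm_gen (c : BlOSz n k) : Prop :=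
  exists mu (i : 'I_n), c = toB (fel (st mu) (st mu) (hgen (bseq mu) i)).

Local Notation inJ := (span (tgen symm_gen)).

Lemma in_gens_J mu la nu p q r :
  in_gens predT (hgen (bseq nu)) p ->
  inJ (toB (fel (st mu) (st nu) q) * toB (fel (st nu) (st la) (p * r))).
Proof.
move=> [c ->]; rewrite mulr_suml fel_sum raddf_sum mulr_sumr /=.
apply: span_sum => l _.
have -> : fel (st nu) (st la) (c l * hgen (bseq nu) l * r) =
    fel (st nu) (st nu) (hgen (bseq nu) l) * fel (st nu) (st la) (c l * r).
  by rewrite fel_mul gmonoxx mulr1 [in RHS]mulrCA !mulrA.
rewrite toB_mul; [|exact: left_supported_fel|exact: left_supported_fel].
rewrite mulrA; apply: span_gen; eexists _, _, _; split; last by [].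
by exists nu, l.
Qed.

(** By [mono_ann] p lies in the ideal of min(b^la, b^mu), each of whose
    generators is a relation at one of the two ends of f_xy. *)
Lemma span_ann_J la mu p :
  in_gens predT (hgen (bseq mu)) (p * mono (cexp la mu)) ->
  inJ (toB (fel (st mu) (st la) p)).
Proof.
move=> /(mono_ann (bseq_step la) (bseq_step mu))[c ->].
rewrite fel_sum raddf_sum /=; apply: span_sum => l _.
rewrite /hgen; have [le|le] := leqP (bseq la l) (bseq mu l).
  have -> : fel (st mu) (st la) (c l * hsym n (bseq la l) l.+1) =
      fel (st mu) (st la) (c l) * fel (st la) (st la) (hgen (bseq la) l * 1).
    by rewrite fel_mul gmonozz !mulr1.
  rewrite toB_mul; [|exact: left_supported_fel|exact: left_supported_fel].
  by apply: in_gens_J; exact: (in_gens_gen (hgen (bseq la))).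
have -> : fel (st mu) (st la) (c l * hsym n (bseq mu l) l.+1) =
    fel (st mu) (st mu) 1 * fel (st mu) (st la) (hgen (bseq mu) l * c l).
  by rewrite fel_mul gmonoxx mul1r mulr1 mulrC.
rewrite toB_mul; [|exact: left_supported_fel|exact: left_supported_fel].
by apply: in_gens_J; exact: (in_gens_gen (hgen (bseq mu))).
Qed.

Lemma toH_eq0_J a : left_supported a -> toH a = 0 -> inJ (toB a).
Proof.
move=> al h; rewrite (left_supported_sum al) raddf_sum /=.
apply: span_sum => mu _.
rewrite raddf_sum /=.
apply: span_sum => la _.
apply: span_ann_J; apply/(mapsto_eq0 (ok_mono la mu _)).
exact: (congr1 (fun h : Hring n k => h la mu) h).
Qed.

Lemma toB_eq0 x y p : rcls (@Brel n k) (fel x y p) = 0 -> toB (fel x y p) = 0.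
Proof. by move=> h; apply: val_inj; rewrite /= h mulr0 mul0r. Qed.

(** The generators of W lift to multiples of interval elements, which are zero,
    and so do all maps between sequences that are too far. *)
Lemma Wfam_J a : left_supported a -> Wfam (toH a) -> inJ (toB a).
Proof.
move=> al Wa; rewrite (left_supported_sum al) raddf_sum /=.
apply: span_sum => mu _.
rewrite raddf_sum /=.
apply: span_sum => la _.
have := Wa la mu; rewrite /Wsub; case: ifP => [far _|_ W].
  rewrite toB_eq0; first exact: span0.
  by apply: crossing_eq0; apply: crossingC; exact: dfar_crossing.
have H (f : homR la mu) : span (lgen (Wgen (la := la) (mu := mu))) f ->
    exists q, f = mapsto (bseq la) (bseq mu) (q * mono (cexp la mu)) /\
      rcls (@Brel n k) (fel (st mu) (st la) q) = 0.
  elim=> [|_ [r [_ [[j [hj ->]] ->]]]|f1 f2 _ [p [-> p0]] _ [q [-> q0]]].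
  - by exists 0; rewrite mul0r mapsto0 fel0 raddf0.
  - exists (r * \prod_(i < n | (alpha_pos la mu j <= i.+1 <= beta_pos la mu j)%N) 'X_i).
    split; first by rewrite -mulrA -mapstoZ //; exact: ok_mono.
    by apply: fel_scale_eq0; exact: interval_mono_eq0.
  - exists (p - q); rewrite mulrBl mapstoB; [|exact: ok_mono|exact: ok_mono].
    by split=> //; rewrite felB raddfB /= p0 q0 subrr.
have [q [eq q0]] := H _ W.
rewrite -(subrK q (a _)) felD raddfD /= (toB_eq0 q0) addr0.
apply: span_ann_J; apply/(mapsto_eq0 (ok_mono la mu _)).
by rewrite mulrBl mapstoB; [|exact: ok_mono|exact: ok_mono]; apply/eqP; rewrite subr_eq0 -eq.
Qed.

(** Two lifts of the same family differ by a lift of zero, so it is enough to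
    lift products by products. *)
Lemma span_Wfam_J h : span (tgen (@Wfam n k)) h ->
  forall a, left_supported a -> toH a = h -> inJ (toB a).
Proof.
elim=> [|_ [u [s [v [Ws ->]]]]|h1 h2 _ IH1 _ IH2] a al ah; first exact: toH_eq0_J.
  have [au aul uE] := toH_surj u; have [av avl vE] := toH_surj v.
  have [as_ asl sE] := toH_surj s; rewrite sE in Ws.
  have ml (c d : B0 n k) : left_supported c -> left_supported d -> left_supported (c * d).
    move=> /left_supportedP[ec _] /left_supportedP[_ ed].
    by apply/left_supportedP; split; rewrite ?mulrA ?ec // -mulrA ed.
  have l1 := ml _ _ aul asl; have l2 := ml _ _ l1 avl.
  have H : toH (a - au * as_ * av) = 0 by rewrite raddfB /= !toH_mul // ah uE sE vE subrr.
  rewrite -(subrK (au * as_ * av) a) raddfD /=; apply: spanD.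
    by apply: toH_eq0_J => //; exact: left_supportedB.
  by rewrite !toB_mul //; apply/span_tgenMr/span_tgenMl/Wfam_J.
have [a1 a1l h1E] := toH_surj h1; have [a2 a2l h2E] := toH_surj h2.
rewrite -(subrK (a1 - a2) a) raddfD /=; apply: spanD; last first.
  by rewrite raddfB; apply: spanB; [exact: IH1 | exact: IH2].
apply: toH_eq0_J; first by do 2?apply: left_supportedB.
by rewrite (raddfB toH) (raddfB toH) /= ah h1E h2E subrr.
Qed.

Section Xi.
Variable Xi : {rmorphism BlOSz n k -> AZ n k}.
Hypothesis hXi : is_Xi Xi.

Lemma Xi_toB a : left_supported a -> Xi (toB a) = rcls (@Wfam n k) (toH a).
Proof.
move=> al; rewrite (left_supported_sum al) !raddf_sum /=; apply: eq_bigr => mu _.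
rewrite !raddf_sum /=; apply: eq_bigr => la _.
rewrite -[toB _]/(fBl _ _ _) (hXi _ (st_corresp mu) (st_corresp la)) toH_fel.
have -> : \prod_(i < n) 'X_i ^+ (iv (st mu) i - iv (st la) i) = mono (cexp la mu) :> polyU.
  by apply: eq_bigr => i _; rewrite !bseq_iv subSS.
case: ifP => // far; apply/esym; apply: cls_gen.
eexists 1, _, 1; split; last by rewrite mul1r mulr1.
move=> la' mu'; rewrite /hel /Wsub; case: ifP => // nf; case: ifP => [/andP[/eqP el /eqP em]|_].
  have : dfar la mu by apply/crossing_dfar/crossingC/ifar_crossing.
  by rewrite -el -em nf.
exact: span0.
Qed.

Lemma Xi_surj (u : AZ n k) : exists b, u = Xi b.
Proof.
have [a al aE] := toH_surj (crep (u : rquot (@Wfam n k))).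
exists (toB a); rewrite Xi_toB // -aE; exact/esym/crepK.
Qed.

(** An element of the kernel has a lift whose family of maps lies in the ideal
    of the W's. *)
Lemma Xi_ker b : Xi b = 0 -> inJ b.
Proof.
have [a al ->] := toB_surj b; rewrite Xi_toB // => h.
apply: (span_Wfam_J _ al erefl).
have /clsP : cls (tgen (@Wfam n k)) (toH a) = cls (tgen (@Wfam n k)) 0.
  by rewrite raddf0.
by rewrite subr0.
Qed.

End Xi.
End Kernel.

(** * Gradings as families of projections *)

Section Gradings.
Variable V : zmodType.
Implicit Types (deg : int -> V -> Prop) (c : int -> V -> V).

Definition homog_subgroups deg : Prop :=
  forall d, deg d 0 /\ forall x y, deg d x -> deg d y -> deg d (x - y).

Definition homog_spanning deg : Prop :=
  forall x, exists (s : seq int) (h : int -> V),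
    (forall d, deg d (h d)) /\ x = \sum_(d <- s) h d.

Definition homog_free deg : Prop :=
  forall (s : seq int) (h : int -> V), uniq s -> (forall d, deg d (h d)) ->
    \sum_(d <- s) h d = 0 -> forall d, d \in s -> h d = 0.

Definition is_grading deg : Prop :=
  [/\ homog_subgroups deg, homog_spanning deg & homog_free deg].

(** Projections onto the homogeneous parts, as far as they are determined by
    their values on homogeneous elements: this suffices for a grading
    ([components_grading]) and is easier to transport than uniqueness of
    decompositions. *)
Definition components deg c : Prop :=
  [/\ forall d, zmod_morphism (c d),
      forall d x, deg d x -> c d x = x
    & forall d d' x, deg d x -> d' != d -> c d' x = 0].

Lemma homogD deg d x y : homog_subgroups deg -> deg d x -> deg d y -> deg d (x + y).
Proof.
move=> H dx dy; rewrite -[y]opprK -[- y]sub0r; apply: (H d).2 => //.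
by apply: (H d).2 => //; exact: (H d).1.
Qed.

Lemma homog_sum deg d I (r : seq I) (P : pred I) (F : I -> V) :
  homog_subgroups deg -> (forall i, P i -> deg d (F i)) -> deg d (\sum_(i <- r | P i) F i).
Proof.
move=> H dF; elim/big_ind: _ => // [|x y]; first exact: (H d).1.
exact: homogD.
Qed.

(** All but finitely many h d are zero, so that decompositions with different
    supports can be compared. *)
Definition decomposes deg x (h : int -> V) : Prop :=
  (forall d, deg d (h d)) /\
  exists s, [/\ uniq s, forall d, d \notin s -> h d = 0 & x = \sum_(d <- s) h d].

Lemma sum_widen (h : int -> V) s t : uniq s -> uniq t -> {subset s <= t} ->
  (forall d, d \notin s -> h d = 0) -> \sum_(d <- s) h d = \sum_(d <- t) h d.
Proof.
move=> us ut st h0; rewrite [RHS](bigID (mem s)) /= [X in _ + X]big1 ?addr0; last first.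
  by move=> d /h0.
rewrite -[RHS]big_filter; apply: perm_big; apply: uniq_perm; rewrite ?filter_uniq // => d.
by rewrite mem_filter andb_idr // => /st.
Qed.

Lemma decomposesB deg x y h g : homog_subgroups deg ->
  decomposes deg x h -> decomposes deg y g -> decomposes deg (x - y) (fun d => h d - g d).
Proof.
move=> H [hd [s [us h0 ->]]] [gd [t [ut g0 ->]]]; split=> [d|]; first exact: (H d).2.
have uu : uniq (undup (s ++ t)) by exact: undup_uniq.
exists (undup (s ++ t)); split=> // [d|].
  by rewrite mem_undup mem_cat negb_or => /andP[ds dt]; rewrite h0 // g0 // subrr.
rewrite sumrB; congr (_ - _); apply: sum_widen => // d ds;
  by rewrite mem_undup mem_cat ds ?orbT.
Qed.

Lemma decomposes_homog deg d x : homog_subgroups deg -> deg d x ->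
  decomposes deg x (fun d' => if d' == d then x else 0).
Proof.
move=> H dx; split=> [d'|]; first by case: eqP => [->|_] //; exact: (H d').1.
exists [:: d]; split=> // [d'|]; first by rewrite inE => /negbTE ->.
by rewrite big_seq1 eqxx.
Qed.

Lemma span_decomposes deg x : homog_subgroups deg ->
  span (fun y => exists d, deg d y) x -> exists h, decomposes deg x h.
Proof.
move=> H; elim=> [|y [d dy]|y z _ [h hh] _ [g gg]].
- by eexists; apply: (@decomposes_homog _ 0) => //; exact: (H 0).1.
- by eexists; exact: (decomposes_homog H dy).
- by eexists; exact: (decomposesB H hh gg).
Qed.

Lemma span_spanning deg : homog_subgroups deg ->
  (forall x, span (fun y => exists d, deg d y) x) -> homog_spanning deg.
Proof.
move=> H sp x; have [h [hd [s [_ _ ->]]]] := span_decomposes H (sp x).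
by exists s, h.
Qed.

Lemma spanning_span deg : homog_spanning deg ->
  forall x, span (fun y => exists d, deg d y) x.
Proof.
move=> sp x; have [s [h [hd ->]]] := sp x.
apply: span_sum => d _.
by apply: span_gen; exists d.
Qed.

(** Uniqueness of the decompositions makes the projections additive. *)
Lemma grading_components deg : is_grading deg ->
  exists c, components deg c /\ forall d x, deg d (c d x).
Proof.
move=> [H sp fr].
have [c cP] := choice (fun x => span_decomposes H (spanning_span sp x)).
have U x h g : decomposes deg x h -> decomposes deg x g -> h =1 g.
  move=> hh gg d; have [kd [s [us k0]]] := decomposesB H hh gg.
  rewrite subrr => /esym sk; apply/eqP; rewrite -subr_eq0; apply/eqP.
  have [ds|nds] := boolP (d \in s); last exact: k0.
  exact: (fr s _ us kd sk).
exists (fun d x => c x d); split=> [|d x]; last exact: (cP x).1.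
split=> [d x y|d x dx|d d' x dx dd].
- exact: (U _ _ _ (cP (x - y)) (decomposesB H (cP x) (cP y))).
- by rewrite (U _ _ _ (cP x) (decomposes_homog H dx)) eqxx.
- by rewrite (U _ _ _ (cP x) (decomposes_homog H dx)) (negbTE dd).
Qed.

Lemma components_sum deg c d I (r : seq I) (P : pred I) F : components deg c ->
  c d (\sum_(i <- r | P i) F i) = \sum_(i <- r | P i) c d (F i).
Proof.
move=> [cB _ _]; have c0 : c d 0 = 0 by rewrite -(subrr 0) cB !subrr.
apply: (big_morph (c d)) => // x y.
by have := cB d (x + y) y; rewrite addrK => ->; rewrite subrK.
Qed.

Lemma components_grading deg c : homog_subgroups deg ->
  (forall x, span (fun y => exists d, deg d y) x) -> components deg c -> is_grading deg.
Proof.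
move=> H sp cc; split=> //; first exact: span_spanning.
move=> s h us hd s0 d ds; case: (cc) => [cB cid c0].
have := congr1 (c d) s0; rewrite (components_sum _ _ _ _ cc).
rewrite (bigD1_seq d) //= cid // big1 ?addr0 => [->|d' dd].
  by rewrite -(subrr 0) cB !subrr.
by rewrite (c0 d') // eq_sym.
Qed.

End Gradings.

Lemma span_ext (V W : zmodType) (S : V -> Prop) (f g : V -> W) :
  zmod_morphism f -> zmod_morphism g -> (forall x, S x -> f x = g x) ->
  forall x, span S x -> f x = g x.
Proof.
move=> fB gB fg x; elim=> [|y /fg //|y z _ IHy _ IHz]; last by rewrite fB gB IHy IHz.
by rewrite -(subrr 0) fB gB !subrr.
Qed.

Lemma sub_span (V : zmodType) (S T : V -> Prop) x :
  (forall y, S y -> span T y) -> span S x -> span T x.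
Proof.
by move=> ST; elim=> [|y /ST //|y z _ yT _ zT]; [exact: span0 | exact: spanB].
Qed.

Lemma homog_span (V : zmodType) (S : int -> V -> Prop) :
  homog_subgroups (fun d => span (S d)).
Proof. by move=> d; split; [exact: span0 | move=> x y; exact: spanB]. Qed.

Lemma cvalB (R : pzRingType) (e : idem R) (x y : corner e) : cval (x - y) = cval x - cval y.
Proof. exact: (raddfB val). Qed.

Lemma lvalB (R : pzRingType) (e : idem R) (x y : lideal e) : lval (x - y) = lval x - lval y.
Proof. exact: (raddfB val). Qed.

Section GradedRings.

(** The projections of W are those of V followed by p. *)
Lemma grading_retract (V W : zmodType) (deg : int -> V -> Prop) (i : W -> V) (p : V -> W) :
  zmod_morphism i -> zmod_morphism p -> cancel i p ->
  (forall d x, deg d x -> deg d (i (p x))) ->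
  is_grading deg -> is_grading (fun d x => deg d (i x)).
Proof.
move=> iB pB iK ip G; have [c [cc cd]] := grading_components G; have [H sp fr] := G.
have [cB cid c0] := cc.
apply: (components_grading (c := fun d x => p (c d (i x)))) => [d|x|].
- split; first by rewrite -(subrr 0) iB !subrr; exact: (H d).1.
  by move=> x y dx dy; rewrite iB; exact: (H d).2.
- rewrite -[x]iK; apply: span_morph (spanning_span sp (i x)) => // y [d dy].
  by apply: span_gen; exists d; exact: ip.
- split=> [d x y|d x dx|d d' x dx dd].
  + by rewrite iB cB pB.
  + by rewrite cid ?iK.
  + by rewrite (c0 _ _ _ dx dd) -(subrr 0) pB !subrr.
Qed.

Definition gmulr (R : gring) : Prop :=
  forall i j (a b : R), gdeg i a -> gdeg j b -> gdeg (i + j) (a * b).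

Definition ggrading (R : gring) : Prop := is_grading (@gdeg R).

(** The projections preserve an ideal with homogeneous generators, so they
    descend to the quotient. *)
Lemma grading_rquot (R : pzRingType) (deg : int -> R -> Prop) (S : R -> Prop) :
  is_grading deg ->
  (forall i j a b, deg i a -> deg j b -> deg (i + j) (a * b)) ->
  (forall s, S s -> exists d, deg d s) ->
  is_grading (fun d (q : rquot S) => exists a, deg d a /\ q = rcls S a).
Proof.
move=> G M hS; have [c [cc cd]] := grading_components G; have [H sp fr] := G.
have [cB cid c0] := cc.
have cS d z : span (tgen S) z -> span (tgen S) (c d z).
  apply: span_morph; first exact: cB.
  move=> _ [a [s [b [Ss ->]]]].
  move: (spanning_span sp a) (spanning_span sp b); have [e es] := hS _ Ss.
  move=> sa sb; elim: sa => [|{}a [i ai]|u v _ IHu _ IHv].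
  - by rewrite !mul0r -(subrr 0) cB subrr; exact: span0.
  - elim: sb => [|{}b [j bj]|u v _ IHu _ IHv].
    + by rewrite mulr0 -(subrr 0) cB subrr; exact: span0.
    + have D := M _ _ _ _ (M _ _ _ _ ai es) bj.
      have [->|ne] := eqVneq d (i + e + j); last by rewrite (c0 _ _ _ D ne); exact: span0.
      by rewrite cid //; apply: span_gen; exists a, s, b.
    + by rewrite mulrBr cB; exact: spanB.
  - by rewrite !mulrBl cB; exact: spanB.
pose c' d (q : rquot S) : rquot S := rcls S (c d (crep q)).
have c'E d a : c' d (rcls S a) = rcls S (c d a).
  by apply/clsP; rewrite -cB; apply: cS; exact: crep_cls.
have surj (q : rquot S) : exists a, q = rcls S a by exists (crep q); rewrite [RHS]crepK.
apply: (components_grading (c := c')) => [d|q|].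
- split; first by exists 0; rewrite raddf0; split=> //; exact: (H d).1.
  move=> _ _ [a [ad ->]] [b [bd ->]]; exists (a - b); rewrite raddfB.
  by split=> //; exact: (H d).2.
- have [a ->] := surj q; apply: span_morph (spanning_span sp a) => [x y|x [d dx]].
    exact: raddfB.
  by apply: span_gen; exists d, x.
- split=> [d p q|d _ [a [ad ->]]|d d' _ [a [ad ->]] dd].
  + have [a ->] := surj p; have [b ->] := surj q.
    by rewrite -raddfB /= !c'E cB raddfB.
  + by rewrite c'E cid.
  + by rewrite c'E (c0 _ _ _ ad dd) raddf0.
Qed.

Lemma grading_corner (R : gring) (e : idem R) :
  ggrading R -> gmulr R -> gdeg 0 (idv e) -> ggrading (gcorner e).
Proof.
move=> G M e0; apply: (@grading_retract _ _ _ (@cval _ e) (cproj e)) G => [x y|x y|x|d x dx].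
- exact: cvalB.
- by apply: val_inj; rewrite [RHS](raddfB val) /= mulrBr mulrBl.
- by apply: val_inj; exact/eqP/(cvalP x).
- by rewrite -[d]addr0 -[X in (X + _)%R]add0r; apply: (M) => //; exact: M.
Qed.

Lemma gmulr_corner (R : gring) (e : idem R) : gmulr R -> gmulr (gcorner e).
Proof.
move=> M i j a b ai bj; suff : gdeg (g := R) (i + j) (cval (a * b)) by [].
by rewrite cvalM; exact: M.
Qed.

Lemma grading_lideal (R : gring) (e : idem R) :
  ggrading R -> gmulr R -> gdeg 0 (idv e) -> is_grading (fun d (p : lideal e) => gdeg d (lval p)).
Proof.
move=> G M e0; have lp (x : R) : x * idv e * idv e == x * idv e by rewrite -mulrA idemP.
apply: (@grading_retract _ _ _ (@lval _ e) (fun x => LIdeal (lp x))) G => [x y|x y|x|d x dx].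
- exact: lvalB.
- by apply: val_inj; rewrite [RHS](raddfB val) /= mulrBl.
- by apply: val_inj; exact/eqP/(lvalP x).
- by rewrite -[d]addr0; exact: M.
Qed.

Lemma tensK_span (K : fieldType) (X : zmodType) (t : tensK K X) :
  span (fun u => exists x (k : K), u = pureK x k) t.
Proof.
elim/tens_ind: t => [|x k|t u]; [exact: span0 | | exact: spanD].
by apply: span_gen; exists x, k.
Qed.

Lemma pureK_B (K : fieldType) (X : zmodType) (x y : X) (k : K) :
  pureK (x - y) k = pureK x k - pureK y k.
Proof. by apply/esym/eqP; rewrite subr_eq -[_ + _]pureDl subrK. Qed.

Lemma grading_tensK (K : fieldType) (X : zmodType) (deg : int -> X -> Prop) :
  is_grading deg ->
  is_grading (fun d => span (fun t : tensK K X => exists x c, deg d x /\ t = pureK x c)).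
Proof.
move=> G; have [c [cc cd]] := grading_components G; have [H sp fr] := G.
have [cB cid c0] := cc.
have cD d x y : c d (x + y) = c d x + c d y.
  apply/eqP; rewrite -subr_eq -cB; apply/eqP; congr (c d _); exact: addrK.
pose c' d (t : tensK K X) : tensK K X := tlift (fun x k => pureK (c d x) k) t.
have bal d : balanced (@zract X) (@zlact K) (fun x k => pureK (c d x) k).
  apply: biadditive_bal; split=> [x x' k|x k k']; last exact: pureDr.
  by rewrite cD; exact: pureDl.
have c'B d : zmod_morphism (c' d) by exact: (tliftB (bal d)).
have c'E d x k : c' d (pureK x k) = pureK (c d x) k by exact: (tliftE (bal d)).
have c'0 d : c' d 0 = 0 by rewrite -(subrr 0) c'B !subrr.
apply: (components_grading (c := c')) => [|t|].
- exact: homog_span.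
- move: (tensK_span t); apply: sub_span => _ [x [k ->]].
  apply: (@span_morph _ _ _ (fun x => pureK x k)) (spanning_span sp x) => [y z|y [d dy]].
    exact: pureK_B.
  by apply: span_gen; exists d; apply: span_gen; exists y, k.
- split=> [//|d t|d d' t + dd].
    elim=> [|_ [x [k [dx ->]]]|u v _ IHu _ IHv]; first exact: c'0.
      by rewrite c'E cid.
    by rewrite c'B IHu IHv.
  elim=> [|_ [x [k [dx ->]]]|u v _ IHu _ IHv]; first exact: c'0.
    by rewrite c'E (c0 _ _ _ dx dd); exact: pure0l.
  by rewrite c'B IHu IHv subrr.
Qed.

End GradedRings.

(** * Tensor products and finite-dimensional graded modules *)

Section TensorModules.
Variables (K : fieldType) (R S : gring) (P : bimod R S).
Local Notation PK := (ext_bimod K P).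

Lemma ext_scaleE (r : R) (p : P) (c d : K) :
  (pureK r c : gext K R) *: (pureK p d : PK) = pureK (r *: p) (c * d).
Proof. exact: (extopE (scale_biadditive P)). Qed.

Lemma ext_bactE (p : P) (s : S) (c d : K) :
  bact (pureK p c : PK) (pureK s d : gext K S) = pureK (bact p s) (c * d).
Proof. exact: (extopE (bact_biadditive P)). Qed.

(** Scalars may be moved across the tensor product, although it is taken over
    the extended rings. *)
Lemma escal_bact (c : K) (x : PK) :
  (escal R c : gext K R) *: x = bact x (escal S c : gext K S).
Proof.
move: x; apply: (@additive_ext K P (tensK K P)) => [t u|t u|p d].
- exact: (scalerDr (escal R c : gext K R) (t : PK) u).
- exact: (bactDl (t : PK) u (escal S c : gext K S)).
- rewrite [RHS]ext_bactE; apply: etrans (ext_scaleE _ _ _ _) _.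
  by rewrite scale1r bact1 mulrC.
Qed.

Hypothesis scale_deg : forall i j (r : R) (p : P), gdeg i r -> bdeg j p -> bdeg (i + j) (r *: p).

Lemma ext_scale_deg i j (a : gext K R) (x : PK) :
  gdeg i a -> bdeg j x -> bdeg (i + j) (a *: x).
Proof.
move=> ai xj; elim: ai => [|_ [r [c [ri ->]]]|u v _ IHu _ IHv].
- by rewrite scale0r; exact: span0.
- elim: xj => [|_ [p [d [pj ->]]]|y z _ IHy _ IHz].
  + by rewrite scaler0; exact: span0.
  + by rewrite ext_scaleE; apply: span_gen; eexists _, _; split; last by []; exact: scale_deg.
  + by rewrite scalerBr; exact: spanB.
- by rewrite scalerBl; exact: spanB.
Qed.

Variable M : gmod (gext K S).
Local Notation T := (tens_obj PK M).

Lemma tpureBr (x : PK) (m m' : M) : tpure (M := M) x (m - m') = tpure x m - tpure x m'.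
Proof. by apply/esym/eqP; rewrite subr_eq -[_ + _]pureDr subrK. Qed.

Lemma tpureDl (x y : PK) (m : M) : tpure (M := M) (x + y) m = tpure x m + tpure y m.
Proof. exact: pureDl. Qed.

Lemma tpureBl (x y : PK) (m : M) : tpure (M := M) (x - y) m = tpure x m - tpure y m.
Proof. exact: pureBl. Qed.

Lemma tpure0r (x : PK) : tpure (M := M) x 0 = 0.
Proof. by rewrite -(subrr 0) tpureBr subrr. Qed.

Lemma tpure_sumr (x : PK) I (r : seq I) (Q : pred I) (F : I -> M) :
  tpure x (\sum_(i <- r | Q i) F i) = \sum_(i <- r | Q i) tpure x (F i).
Proof. by apply: (big_morph (tpure x)) => [y z|]; [exact: pureDr | exact: tpure0r]. Qed.

Lemma tpure_suml (m : M) I (r : seq I) (Q : pred I) (F : I -> PK) :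
  tpure (\sum_(i <- r | Q i) F i) m = \sum_(i <- r | Q i) tpure (F i) m.
Proof.
by apply: (big_morph (fun x => tpure x m)) => [y z|]; [exact: pureDl | exact: pure0l].
Qed.

Lemma tpureA (x : PK) (s : gext K S) (m : M) : tpure (bact x s) m = tpure x (s *: m).
Proof. exact: pureA. Qed.

Lemma tscaleE (a : gext K R) (x : PK) (m : M) : a *: (tpure x m : T) = tpure (a *: x) m.
Proof. exact: tm_scaleE. Qed.

Lemma tpure_escal (x : PK) (c : K) (m : M) :
  tpure x ((escal S c : gext K S) *: m) = (escal R c : gext K R) *: (tpure x m : T).
Proof. by rewrite -tpureA -escal_bact tscaleE. Qed.

Lemma tens_scale_deg i j (a : gext K R) (t : T) :
  gdeg i a -> hdeg j t -> hdeg (i + j) (a *: t).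
Proof.
move=> ai; elim=> [|_ [i' [j' [x [m [<- xi mj ->]]]]]|u v _ IHu _ IHv].
- by rewrite scaler0; exact: span0.
- rewrite tscaleE addrA; apply: span_gen; exists (i + i'), j', (a *: x), m.
  by split=> //; exact: ext_scale_deg.
- by rewrite scalerBr; exact: spanB.
Qed.

Lemma tens_span (t : T) : span (fun u => exists x m, u = tpure x m) t.
Proof.
elim/tens_ind: t => [|x m|t u]; [exact: span0 | | exact: spanD].
by apply: span_gen; exists x, m.
Qed.

End TensorModules.

Section FinitelySpanned.
Variables (K : fieldType) (R : gring).

Lemma finType_spanned (M : gmod (gext K R)) (I : finType) (m : I -> M) :
  (forall x, exists c : I -> K, x = \sum_i (escal R (c i) : gext K R) *: m i) ->
  exists (r : nat) (m' : 'I_r -> M), forall x : M,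
        exists c : 'I_r -> K, x = \sum_(i < r) (escal R (c i) : gext K R) *: m' i.
Proof.
move=> h; exists #|I|, (fun i => m (enum_val i)) => x.
have [c ->] := h x; exists (fun i => c (enum_val i)).
exact: (big_enum_val (fun i => (escal R (c i) : gext K R) *: m i)).
Qed.

Lemma escal0 : escal R (0 : K) = 0.
Proof. by rewrite /escal /pureK -[X in pure _ _ _ X](subrr 0) pureBr subrr. Qed.

Lemma escalB (a b : K) : escal R (a - b) = escal R a - escal R b.
Proof. exact: pureBr. Qed.

Lemma span_combinations (M : gmod (gext K R)) (I : finType) (m : I -> M) x :
  span (fun y => exists i (c : K), y = (escal R c : gext K R) *: m i) x ->
  exists c : I -> K, x = \sum_i (escal R (c i) : gext K R) *: m i.
Proof.
elim=> [|_ [i [c ->]]|y z _ [c ->] _ [d ->]].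
- exists (fun=> 0); rewrite big1 // => i _.
  by rewrite escal0 scale0r.
- exists (fun j => if j == i then c else 0).
  rewrite (bigD1 i) //= eqxx big1 ?addr0 // => j /negbTE ->.
  by rewrite escal0 scale0r.
- exists (fun i => c i - d i); rewrite -sumrB; apply: eq_bigr => i _.
  by rewrite escalB scalerBl.
Qed.

Lemma span_fmod_span (M : gmod (gext K R)) r (m : 'I_r -> M) :
  (forall x : M, exists c : 'I_r -> K, x = \sum_(i < r) (escal R (c i) : gext K R) *: m i) ->
  forall x, span (fun y => exists i (c : K), y = (escal R c : gext K R) *: m i) x.
Proof.
move=> h x; have [c ->] := h x.
apply: span_sum => i _.
by apply: span_gen; exists i, (c i).
Qed.

Lemma is_fmod_grading (M : gmod (gext K R)) : is_fmod M -> is_grading (@hdeg _ M).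
Proof. by case. Qed.

(** Only the degrees occurring in finitely many generators can be nonzero, as
    scalars have degree 0. *)
Lemma fmod_support (M : gmod (gext K R)) (c : int -> M -> M) :
  is_fmod M -> (forall k : K, gdeg 0 (escal R k : gext K R)) -> components (@hdeg _ M) c ->
  exists s : seq int, uniq s /\ forall d x, d \notin s -> c d x = 0.
Proof.
move=> [[r [m mP]] H act sp fr] e0 cc; have [cB cid c0] := cc.
have [s sP] := choice (fun i => sp (m i)).
exists (undup (flatten [seq s i | i <- enum 'I_r])); split; first exact: undup_uniq.
move=> d x; rewrite mem_undup => ds; have [k ->] := mP x.
rewrite (components_sum _ _ _ _ cc) big1 // => i _.
have [h [hd ->]] := sP i; rewrite scaler_sumr (components_sum _ _ _ _ cc) big_seq big1 // => d' d's.
apply: (c0 d'); first by have := act 0 d' _ _ (e0 (k i)) (hd d'); rewrite add0r.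
apply: contraNneq ds => ->; apply/flattenP; exists (s i) => //.
by apply: map_f; rewrite mem_enum.
Qed.

End FinitelySpanned.

Section TensorFmod.
Variables (K : fieldType) (R S : gring) (P : bimod R S).
Local Notation PK := (ext_bimod K P).
Local Notation tp := (@tpure (gext K R) (gext K S) PK _).
Hypothesis scale_deg : forall i j (r : R) (p : P), gdeg i r -> bdeg j p -> bdeg (i + j) (r *: p).
Hypothesis bact_deg : forall i j (p : P) (s : S), bdeg i p -> gdeg j s -> bdeg (i + j) (bact p s).
Hypothesis P_grading : is_grading (@bdeg _ _ P).
Hypothesis S_span : forall s : S, span (fun s => exists d, gdeg d s) s.
Hypothesis S1 : gdeg 0 (1 : S).
Hypothesis P_fg : exists (I : finType) (q : I -> P), forall p, exists s : I -> S,
  p = \sum_i bact (q i) (s i).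

Lemma ext_bact_deg i j (x : PK) (s : gext K S) :
  bdeg i x -> gdeg j s -> bdeg (i + j) (bact x s).
Proof.
move=> xi sj; elim: xi => [|_ [p [c [pi ->]]]|u v _ IHu _ IHv].
- have -> : bact (0 : PK) s = 0 by apply: (addIr (bact 0 s)); rewrite -bactDl !add0r.
  exact: span0.
- elim: sj => [|_ [t [d [tj ->]]]|y z _ IHy _ IHz].
  + have -> : bact (pureK p c : PK) (0 : gext K S) = 0.
      by apply: (addIr (bact (pureK p c : PK) 0)); rewrite -bactDr !add0r.
    exact: span0.
  + by rewrite ext_bactE; apply: span_gen; eexists _, _; split; last by []; exact: bact_deg.
  + have -> : bact (pureK p c : PK) (y - z) = bact (pureK p c : PK) y - bact (pureK p c : PK) z.
      by apply/esym/eqP; rewrite subr_eq -bactDr subrK.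
    exact: spanB.
- have -> : bact (u - v : PK) s = bact (u : PK) s - bact (v : PK) s.
    by apply/esym/eqP; rewrite subr_eq -bactDl subrK.
  exact: spanB.
Qed.

Lemma ext_span (s : gext K S) : span (fun s => exists d, gdeg d s) s.
Proof.
move: (tensK_span s); apply: sub_span => _ [t [k ->]].
apply: (@span_morph _ _ _ (fun x => pureK x k)) (S_span t) => [y z|y [d dy]].
  exact: pureK_B.
by apply: span_gen; exists d; apply: span_gen; exists y, k.
Qed.

Lemma escal_deg0 (k : K) : gdeg 0 (escal S k : gext K S).
Proof. by apply: span_gen; exists 1, k. Qed.

Section Projections.
Variables (M : gmod (gext K S)) (hM : is_fmod M).
Local Notation T := (tens_obj PK M).

(** The component of degree d of x (x) m is the sum over j of x_(d-j) (x) m_j;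
    only finitely many j matter, since M lives in finitely many degrees. *)
Lemma tens_components : exists c, components (@hdeg _ T) c.
Proof.
have PG := grading_tensK K P_grading; have [pc [pcc pcd]] := grading_components PG.
have [pB pid p0] := pcc.
have MG := is_fmod_grading hM; have [mc [mcc mcd]] := grading_components MG.
have [mB mid m0] := mcc; have [Hm spm frm] := MG; have [Hp spp frp] := PG.
have act : forall i j (a : gext K S) (x : M), gdeg i a -> hdeg j x -> hdeg (i + j) (a *: x).
  by case: hM.
have [s [us sP]] := fmod_support hM escal_deg0 mcc.
pose f d (x : PK) (m : M) : T := \sum_(j <- s) tp (pc (d - j) x) (mc j m).
have fDl d (x x' : PK) (m : M) : f d (x + x') m = f d x m + f d x' m.
  rewrite -big_split /=; apply: eq_bigr => j _.
  have -> : pc (d - j) (x + x') = pc (d - j) x + pc (d - j) x'.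
    by have := pB (d - j) (x + x') x'; rewrite addrK => ->; rewrite subrK.
  exact: tpureDl.
have fDr d (x : PK) (m m' : M) : f d x (m + m') = f d x m + f d x m'.
  rewrite -big_split /=; apply: eq_bigr => j _.
  have -> : mc j (m + m') = mc j m + mc j m'.
    by have := mB j (m + m') m'; rewrite addrK => ->; rewrite subrK.
  exact: pureDr.
have fBl d (x x' : PK) (m : M) : f d (x - x') m = f d x m - f d x' m.
  by apply/esym/eqP; rewrite subr_eq -fDl subrK.
have fBr d (x : PK) (m m' : M) : f d x (m - m') = f d x m - f d x m'.
  by apply/esym/eqP; rewrite subr_eq -fDr subrK.
have fhom d i j (x : PK) (m : M) : bdeg i x -> hdeg j m -> f d x m = if d == i + j then tp x m else 0.
  move=> xi mj; have [js|js] := boolP (j \in s); last first.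
    have -> : m = 0 by rewrite -(mid _ _ mj) sP.
    rewrite tpure0r if_same; apply: big1 => j' _.
    have -> : mc j' 0 = 0 by rewrite -(subrr 0) mB !subrr.
    exact: tpure0r.
  rewrite /f (bigD1_seq j) //= big1 ?addr0 => [|j' jj]; last first.
    by rewrite (m0 _ _ _ mj jj) tpure0r.
  rewrite (mid _ _ mj); have [->|ne] := eqVneq d (i + j); first by rewrite addrK pid.
  rewrite (p0 i _ x xi); first exact: pure0l.
  by apply: contraNneq ne => <-; rewrite subrK.
have bal d : balanced (bact (b := PK)) *:%R (f d).
  split=> // x t m; move: x t m.
  have H (x : PK) (t : gext K S) (m : M) : (exists i, bdeg i x) -> (exists i, gdeg i t) ->
      (exists i, hdeg i m) -> f d (bact (b := PK) x t) m = f d x (t *: m).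
    move=> [i xi] [j tj] [l ml].
    rewrite (fhom _ _ _ _ _ (ext_bact_deg xi tj) ml) (fhom _ _ _ _ _ xi (act _ _ _ _ tj ml)).
    by rewrite addrA tpureA.
  move=> x t m; move: (spanning_span spp x); move: x.
  apply: span_ext => [x y|x y|x hx].
  - have -> : bact (b := PK) (x - y) t = bact (b := PK) x t - bact (b := PK) y t.
      by apply/esym/eqP; rewrite subr_eq -bactDl subrK.
    exact: fBl.
  - exact: fBl.
  move: (ext_span t); move: t; apply: span_ext => [t u|t u|t ht].
  - have -> : bact (b := PK) x (t - u) = bact (b := PK) x t - bact (b := PK) x u.
      by apply/esym/eqP; rewrite subr_eq -bactDr subrK.
    exact: fBl.
  - by rewrite scalerBl; exact: fBr.
  move: (spanning_span spm m); move: m; apply: span_ext => [m m'|m m'|m hm].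
  - exact: fBr.
  - by rewrite scalerBr; exact: fBr.
  exact: H.
exists (fun d t => tlift (f d) t); split=> [d|d t|d d' t + dd].
- exact: (tliftB (bal d)).
- elim=> [|_ [i [j [x [m [<- xi mj ->]]]]]|u v _ IHu _ IHv]; first exact: (tlift0 (bal d)).
    by rewrite [LHS](tliftE (bal _)) (fhom _ _ _ _ _ xi mj) eqxx.
  by rewrite (tliftB (bal d)) IHu IHv.
- elim=> [|_ [i [j [x [m [ij xi mj ->]]]]]|u v _ IHu _ IHv]; first exact: (tlift0 (bal d')).
    by rewrite [LHS](tliftE (bal _)) (fhom _ _ _ _ _ xi mj) ij (negbTE dd).
  by rewrite (tliftB (bal d')) IHu IHv subrr.
Qed.

End Projections.

(** If the q_i generate P as a right module and the m_j span M, then the q_i (x)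
    m_j span the tensor product. *)
Lemma tens_preserves_fmod : preserves_fmod (tens_functor (ext_bimod K P)).
Proof.
move=> [M hM] /=; have [c cc] := tens_components hM.
have PG := grading_tensK K P_grading; have [Hp spp frp] := PG.
have [Hm spm frm] := is_fmod_grading hM.
have H : homog_subgroups (@hdeg _ (tens_obj PK M)) by exact: homog_span.
have sp t : span (fun u => exists d, hdeg (g := tens_obj PK M) d u) t.
  move: (tens_span t); apply: sub_span => _ [x [m ->]].
  apply: (@span_morph _ _ _ (fun x => tp x m)) (spanning_span spp x) => [y z|y [i yi]].
    exact: tpureBl.
  apply: (@span_morph _ _ _ (fun m => tp y m)) (spanning_span spm m) => [u v|u [j uj]].
    exact: tpureBr.
  apply: span_gen; exists (i + j); apply: span_gen; exists i, j, y, u; by split.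
have [_ sp' fr'] := components_grading H sp cc.
split=> //; last exact: tens_scale_deg.
have [I [q qP]] := P_fg; have [[r [m mP]] _ _ _ _] := hM.
apply: (@finType_spanned K R (tens_obj PK M) (I * 'I_r)%type
  (fun u => tp (pureK (q u.1) 1 : PK) (m u.2))) => t.
apply: span_combinations; move: (tens_span t); apply: sub_span => _ [x [y ->]].
apply: (@span_morph _ _ _ (fun x => tp x y)) (tensK_span x) => [u v|_ [p [k ->]]].
  exact: tpureBl.
have [s ->] := qP p.
have -> : pureK (\sum_i bact (q i) (s i)) k = \sum_i pureK (bact (q i) (s i)) k.
  by apply: (big_morph (fun p => pureK p k)) => [u v|]; [exact: pureDl | exact: pure0l].
rewrite tpure_suml; apply: span_sum => i _.
have -> : pureK (bact (q i) (s i)) k = bact (pureK (q i) 1 : PK) (pureK (s i) k : gext K S).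
  by rewrite ext_bactE mul1r.
rewrite tpureA.
apply: (@span_morph _ _ _ (fun m => tp (pureK (q i) 1 : PK) m)) (span_fmod_span mP _) => [u v|_ [j [l ->]]].
  exact: tpureBr.
rewrite tpure_escal; apply: span_gen; by exists (i, j), l.
Qed.

End TensorFmod.

(** * Inflation, and evaluation of the dual of a left ideal *)

Section Isomorphisms.
Variables (K : fieldType) (R : gring).

(** Surjectivity is also asked degree by degree, so that the inverse map is
    graded. *)
Definition graded_bij (M N : gmod R) (f : M -> N) : Prop :=
  [/\ forall x, f x = 0 -> x = 0, forall y, exists x, f x = y
    & forall d y, hdeg d y -> exists2 x, hdeg d x & f x = y].

Lemma graded_bij_inv (M N : gmod R) (f : gmor M N) : graded_bij f ->
  exists g : gmor N M, cancel f g /\ cancel g f.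
Proof.
move=> [inj sur surd]; have [g gK] := choice sur.
have injf x y : f x = f y -> x = y.
  by move=> e; apply/eqP; rewrite -subr_eq0; apply/eqP/inj; rewrite raddfB /= e subrr.
have gB : zmod_morphism g by move=> x y; apply: injf; rewrite [RHS]raddfB /= !gK.
have gZ : scalable g by move=> a x; apply: injf; rewrite [RHS]linearZ /= !gK.
pose gl : {linear N -> M} := HB.pack g
  (GRing.isZmodMorphism.Build _ _ g gB) (GRing.isScalable.Build R N M *:%R g gZ).
have gd d x : hdeg d x -> hdeg d (gl x).
  by move=> /surd[y yd <-]; have -> : gl (f y) = y by apply: injf; exact: gK.
exists (GMor gd); split=> x; last exact: gK.
by apply: injf; exact: gK.
Qed.

End Isomorphisms.

Lemma graded_bij_nat_iso (K : fieldType) (R S : gring)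
    (F G : gfunctor (gext K R) (gext K S))
    (eta : forall M : fmod K R, gmor (F M) (G M)) :
  (forall M, graded_bij (eta M)) ->
  (forall (M N : fmod K R) (f : gmor M N) x, eta N (fmap F f x) = fmap G f (eta M x)) ->
  nat_iso F G.
Proof.
move=> bij nat; exists eta, (fun M => sval (cid (graded_bij_inv (bij M)))); split=> // M.
exact: (svalP (cid (graded_bij_inv (bij M)))).
Qed.

Lemma graded_bij_fmod (K : fieldType) (R : gring) (M N : gmod (gext K R)) (f : gmor M N) :
  graded_bij f -> homog_subgroups (@hdeg _ N) -> is_fmod M -> is_fmod N.
Proof.
move=> bij H [[r [m mP]] Hm act sp fr]; have [inj sur surd] := bij.
split=> //.
- exists r, (fun i => f (m i)) => y; have [x <-] := sur y; have [c ->] := mP x.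
  by exists c; rewrite raddf_sum; apply: eq_bigr => i _; exact: linearZZ.
- by move=> i j a y ai /surd[x xj <-]; rewrite -linearZZ; apply: mfunP; exact: act.
- move=> y; have [x <-] := sur y; have [s [h [hd ->]]] := sp x.
  exists s, (fun d => f (h d)); split; first by move=> d; exact: mfunP.
  by rewrite raddf_sum.
- move=> s h us hd h0.
  have [g gK] := choice (fun d => let: ex_intro2 x xd fx := surd d (h d) (hd d) in
    ex_intro (fun x => hdeg d x /\ f x = h d) x (conj xd fx)).
  move=> d ds; rewrite -(gK d).2 (fr s g us) ?raddf0 //; first by move=> d'; exact: (gK d').1.
  apply: inj; rewrite raddf_sum -[RHS]h0; apply: eq_bigr => d' _; exact: (gK d').2.
Qed.

Section InflationFmod.
Variables (K : fieldType) (R S : gring) (f : {rmorphism R -> S}).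
Local Notation fK := (extmor (K := K) f).
Hypothesis f_deg : forall d r, gdeg d r -> gdeg d (f r).

Lemma extmor_deg d (a : gext K R) : gdeg d a -> gdeg d (fK a : gext K S).
Proof.
apply: span_morph; first exact: (extmapB f).
move=> _ [r [c [rd ->]]]; apply: span_gen; exists (f r), c; split; first exact: f_deg.
exact: extmapE.
Qed.

Lemma extmor_escal c : fK (escal R c) = escal S c.
Proof. by rewrite [LHS]extmapE; congr pureK; exact: rmorph1. Qed.

Local Notation infl := (@infl (gext K R) (gext K S) fK).

Lemma inflE (M : gmod (gext K S)) (a : gext K R) (x : M) :
  a *: (x : infl M) = (fK a : gext K S) *: x :> M.
Proof. by []. Qed.

Lemma infl_preserves_fmod : preserves_fmod infl.
Proof.
move=> [M [[r [m mP]] H act sp fr]] /=; split=> //.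
- exists r, m => x; have [c ->] := mP x; exists c; apply: eq_bigr => i _.
  by rewrite inflE extmor_escal.
- by move=> i j a x ai xj; rewrite inflE; apply: act => //; exact: extmor_deg.
Qed.

Hypothesis f_surj : forall d s, gdeg d s -> exists2 r, gdeg d r & f r = s.

Lemma extmor_surj d (a : gext K S) : gdeg d a -> exists2 b : gext K R, gdeg d b & fK b = a.
Proof.
elim=> [|_ [s [c [sd ->]]]|u v _ [u' ud <-] _ [v' vd <-]].
- by exists 0; [exact: span0 | exact: raddf0].
- have [r rd <-] := f_surj sd; exists (pureK r c); last exact: extmapE.
  by apply: span_gen; exists r, c.
- by exists (u' - v'); [exact: spanB | exact: raddfB].
Qed.

(** Dimension and degrees do not see the ring that acts; that the action
    respects degrees is checked on lifts. *)
Lemma infl_reflects_fmod (M : gmod (gext K S)) : is_fmod (infl M) -> is_fmod M.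
Proof.
move=> [[r [m mP]] H act sp fr]; split=> //.
- exists r, m => x; have [c ->] := mP x; exists c; apply: eq_bigr => i _.
  by rewrite inflE extmor_escal.
- by move=> i j a x /extmor_surj[b bi <-] xj; rewrite -inflE; exact: act.
Qed.

End InflationFmod.

Section DualBimodule.
Variables (K : fieldType) (R S : gring) (e : idem R) (chi : {rmorphism S -> corner e}).
Local Notation P := (ideal_bimod chi).
Local Notation E := (hom_bimod P).
Local Notation EK := (ext_bimod K E).

Hypothesis R_mul : gmulr R.
Hypothesis e_deg : gdeg 0 (idv e).
Hypothesis chi_deg : forall d s, gdeg d s -> gdeg d (cval (chi s)).

Fact idem_lideal : idv e * idv e == idv e. Proof. exact/eqP/idemP. Qed.
Definition lideal1 : P := LIdeal idem_lideal.

Lemma lideal1E (p : P) : p = lval p *: lideal1.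
Proof. by apply: val_inj; rewrite /= lidealP. Qed.

(** A left module map out of R e is determined by its value at e. *)
Lemma dual_value (phi : E) (p : P) : lapp phi p = lval p * lapp phi lideal1.
Proof. by rewrite {1}(lideal1E p) linearZ. Qed.

Definition lideal_incl (p : P) : (R : pzRingType)^o := lval p.
Lemma lideal_incl_B : zmod_morphism lideal_incl.
Proof. by move=> x y; exact: (@lvalB R e x y). Qed.
Lemma lideal_incl_Z : scalable lideal_incl.
Proof. by []. Qed.
HB.instance Definition _ := GRing.isZmodMorphism.Build _ _ lideal_incl lideal_incl_B.
HB.instance Definition _ :=
  GRing.isScalable.Build R P (R : pzRingType)^o *:%R lideal_incl lideal_incl_Z.

(** Every element of the dual is the inclusion of the left ideal followed by the
    right multiplication by its value at e. *)
Definition dual1 : E := (lideal_incl : homb P).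

Lemma dual1_act (phi : E) : bact dual1 (lapp phi lideal1) = phi.
Proof. by apply: lhomP => p; rewrite [RHS]dual_value. Qed.

Lemma dual1_scale (s : S) : s *: dual1 = bact dual1 (cval (chi s)).
Proof. by apply: lhomP. Qed.

Lemma dual_scale_value (s : S) (phi : E) :
  lapp (s *: phi) lideal1 = cval (chi s) * lapp phi lideal1.
Proof.
rewrite -[LHS]/(lapp phi (lmulr lideal1 (chi s))) dual_value; congr (_ * _).
exact: (cornerP (chi s)).1.
Qed.

Lemma dual_value_idem (phi : E) : idv e * lapp phi lideal1 = lapp phi lideal1.
Proof. exact/esym/dual_value. Qed.

Lemma dual1_deg : bdeg 0 dual1.
Proof. by move=> j p; rewrite addr0. Qed.

Lemma dual_scale_deg i j (s : S) (phi : E) : gdeg i s -> bdeg j phi -> bdeg (i + j) (s *: phi).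
Proof.
move=> si phij d p pd; rewrite addrA; apply: phij.
exact: (R_mul pd (chi_deg si)).
Qed.

(** The identification of the dual of R e with e R, after extension of scalars. *)
Definition evK (x : EK) : gext K R :=
  tlift (fun (phi : E) k => pureK (lapp phi lideal1 : R) k) x.

Lemma evK_bal : balanced (@zract E) (@zlact K) (fun (phi : E) k => pureK (lapp phi lideal1 : R) k).
Proof. by apply: biadditive_bal; split=> [phi psi k|phi k l]; [exact: pureDl | exact: pureDr]. Qed.

Lemma evKE (phi : E) k : evK (pureK phi k) = pureK (lapp phi lideal1 : R) k.
Proof. exact: (tliftE evK_bal). Qed.
Lemma evKD x y : evK (x + y) = evK x + evK y.
Proof. exact: (tliftD evK_bal). Qed.
Lemma evKB x y : evK (x - y) = evK x - evK y.
Proof. exact: (tliftB evK_bal). Qed.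

Lemma evK_act x (a : gext K R) : evK (bact x a) = evK x * a.
Proof.
move: x; apply: (@additive_ext K E (tensK K R)) => [x y|x y|phi k].
- exact: etrans (congr1 evK (bactDl (x : EK) y a)) (evKD _ _).
- exact: etrans (congr1 ( *%R^~ a) (evKD x y)) (mulrDl _ _ _).
move: a; apply: (@additive_ext K R (tensK K R)) => [a b|a b|r l].
- exact: etrans (congr1 evK (bactDr (pureK phi k : EK) a b)) (evKD _ _).
- exact: (mulrDr (evK (pureK phi k)) a b).
by rewrite ext_bactE !evKE extmulE.
Qed.

Definition chiK (s : gext K S) : gext K R := tlift (fun (s : S) k => pureK (cval (chi s)) k) s.

Lemma chiK_bal : balanced (@zract S) (@zlact K) (fun (s : S) k => pureK (cval (chi s)) k).
Proof.
apply: biadditive_bal; split=> [s t k|s k l]; last exact: pureDr.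
by rewrite rmorphD cvalD; exact: pureDl.
Qed.
Lemma chiKE (s : S) k : chiK (pureK s k) = pureK (cval (chi s)) k.
Proof. exact: (tliftE chiK_bal). Qed.
Lemma chiKD s t : chiK (s + t) = chiK s + chiK t.
Proof. exact: (tliftD chiK_bal). Qed.

Lemma evK_scale (s : gext K S) x : evK (s *: x) = chiK s * evK x.
Proof.
move: x; apply: (@additive_ext K E (tensK K R)) => [x y|x y|phi k].
- exact: etrans (congr1 evK (scalerDr s (x : EK) y)) (evKD _ _).
- exact: etrans (congr1 ( *%R (chiK s)) (evKD x y)) (mulrDr _ _ _).
move: s; apply: (@additive_ext K S (tensK K R)) => [s t|s t|s l].
- exact: etrans (congr1 evK (scalerDl (pureK phi k : EK) (s : gext K S) t)) (evKD _ _).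
- exact: etrans (congr1 ( *%R^~ _) (chiKD s t)) (mulrDl _ _ _).
by rewrite ext_scaleE !evKE chiKE extmulE dual_scale_value.
Qed.

Definition dualK : EK := pureK dual1 1.
Definition eK : gext K R := pureK (idv e) 1.

Lemma evK_idem x : eK * evK x = evK x.
Proof.
move: x; apply: (@additive_ext K E (tensK K R)) => [x y|x y|phi k].
- exact: etrans (congr1 ( *%R eK) (evKD x y)) (mulrDr _ _ _).
- exact: evKD.
by rewrite evKE extmulE dual_value_idem mul1r.
Qed.

Lemma evK_dual1 : evK dualK = eK.
Proof. exact: evKE. Qed.

Lemma dualK_act x : bact dualK (evK x) = x.
Proof.
move: x; apply: (@additive_ext K E (tensK K E)) => [x y|//|phi k].
- exact: etrans (congr1 (bact dualK) (evKD x y)) (bactDr _ _ _).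
by rewrite evKE ext_bactE dual1_act mul1r.
Qed.

Lemma dualK_scale (s : gext K S) : s *: dualK = bact dualK (chiK s).
Proof.
move: s; apply: (@additive_ext K S (tensK K E)) => [s t|s t|s k].
- exact: (scalerDl dualK (s : gext K S) t).
- exact: etrans (congr1 (bact dualK) (chiKD s t)) (bactDr _ _ _).
by rewrite chiKE ext_scaleE ext_bactE dual1_scale mulrC.
Qed.

Lemma dualK_deg : bdeg 0 dualK.
Proof. by apply: span_gen; exists dual1, 1; split=> //; exact: dual1_deg. Qed.

Lemma evK_deg d x : bdeg d x -> gdeg d (evK x).
Proof.
apply: span_morph; first exact: evKB.
move=> _ [phi [k [phid ->]]]; apply: span_gen; exists (lapp phi lideal1 : R), k.
by split; [have := phid 0 lideal1 e_deg; rewrite add0r | exact: evKE].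
Qed.

Section Evaluation.
Variable M : gmod (gext K R).
Local Notation T := (tens_obj EK M).

(** Evaluation at e identifies the tensor product with e M. *)
Definition teval (t : T) : M := tlift (fun (x : EK) (m : M) => evK x *: m) t.

Lemma teval_bal : balanced (bact (b := EK)) *:%R (fun (x : EK) (m : M) => evK x *: m).
Proof.
split=> [x y m|x m m'|x a m]; first by rewrite evKD scalerDl.
- exact: scalerDr.
- by rewrite evK_act scalerA.
Qed.

Lemma tevalE x m : teval (tpure (P := EK) x m) = evK x *: m.
Proof. exact: (tliftE teval_bal). Qed.
Lemma tevalB : zmod_morphism teval.
Proof. exact: (tliftB teval_bal). Qed.

Lemma teval0 : teval 0 = 0.
Proof. exact: (tlift0 teval_bal). Qed.
Lemma teval_sum I (r : seq I) (Q : pred I) (F : I -> T) :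
  teval (\sum_(i <- r | Q i) F i) = \sum_(i <- r | Q i) teval (F i).
Proof. by apply: (big_morph teval) => [x y|]; [exact: (tliftD teval_bal) | exact: teval0]. Qed.

(** A tensor x (x) m equals dualK (x) evK(x) m, since x = dualK evK(x). *)
Lemma teval_inv (t : T) : tpure (P := EK) dualK (teval t) = t.
Proof.
move: t (tens_span t); apply: span_ext => [t u|//|_ [x [m ->]]].
  by rewrite tevalB tpureBr.
by rewrite tevalE -tpureA dualK_act.
Qed.

Lemma teval_idem (t : T) : eK *: teval t = teval t.
Proof.
move: t (tens_span t); apply: span_ext => [t u|t u|_ [x [m ->]]].
- by rewrite tevalB scalerBr.
- exact: tevalB.
by rewrite tevalE scalerA evK_idem.
Qed.

Lemma teval_scale (s : gext K S) (t : T) : teval (s *: t) = chiK s *: teval t.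
Proof.
move: t (tens_span t); apply: span_ext => [t u|t u|_ [x [m ->]]].
- by rewrite scalerBr tevalB.
- by rewrite tevalB scalerBr.
by rewrite tscaleE !tevalE evK_scale scalerA.
Qed.

Lemma teval_dualK m : teval (tpure (P := EK) dualK m) = eK *: m.
Proof. by rewrite tevalE evK_dual1. Qed.

Hypothesis act_deg : forall i j (a : gext K R) (x : M), gdeg i a -> hdeg j x -> hdeg (i + j) (a *: x).
Hypothesis M_homog : homog_subgroups (@hdeg _ M).

Lemma teval_deg d (t : T) : hdeg d t -> hdeg d (teval t).
Proof.
elim=> [|_ [i [j [x [m [<- xi mj ->]]]]]|u v _ IHu _ IHv].
- have -> : teval 0 = 0 by rewrite -(subrr 0) tevalB !subrr.
  exact: (M_homog d).1.
- by rewrite tevalE; apply: act_deg => //; exact: evK_deg.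
- by rewrite tevalB; exact: (M_homog d).2.
Qed.

Lemma dualK_pure_deg d m : hdeg d m -> hdeg (g := T) d (tpure (P := EK) dualK m).
Proof.
move=> md; apply: span_gen; exists 0, d, dualK, m.
by split=> //; [rewrite add0r | exact: dualK_deg].
Qed.

End Evaluation.

(** The tensor product is e M, a graded direct summand of M. *)
Lemma dual_preserves_fmod : preserves_fmod (tens_functor EK).
Proof.
move=> [M hM] /=; case: (hM) => [[r [m mP]] H act sp fr].
split.
- exists r, (fun i => tpure (P := EK) dualK (m i)) => t.
  have [c tc] := mP (teval t); exists c; rewrite -[t]teval_inv tc tpure_sumr.
  by apply: eq_bigr => i _; exact: tpure_escal.
- exact: homog_span.
- by apply: tens_scale_deg => i j s phi; exact: dual_scale_deg.
- move=> t; have [s [h [hd th]]] := sp (teval t).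
  exists s, (fun d => tpure (P := EK) dualK (h d)); split.
    by move=> d; exact: dualK_pure_deg.
  by rewrite -[t]teval_inv th tpure_sumr.
- move=> s h us hd h0 d ds; rewrite -[h d]teval_inv.
  have -> : teval (h d) = 0.
    apply: (fr s (fun d => teval (h d)) us _ _ d ds); first by move=> d'; exact: teval_deg.
    by rewrite -teval_sum h0 teval0.
  exact: tpure0r.
Qed.

End DualBimodule.

(** * Intertwining for the dual of a left ideal and for the ideal itself *)

Section Intertwining.
Variables (K : fieldType) (R R' S S' : gring) (e : idem R) (e' : idem R').
Variables (chi : {rmorphism S -> corner e}) (chi' : {rmorphism S' -> corner e'}).
Variables (f : {rmorphism R -> R'}) (g : {rmorphism S -> S'}).
Hypothesis f_deg : forall d r, gdeg d r -> gdeg d (f r).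
Hypothesis f_idem : f (idv e) = idv e'.
Hypothesis f_chi : forall s, f (cval (chi s)) = cval (chi' (g s)).
Local Notation fK := (extmor (K := K) f).
Local Notation gK := (extmor (K := K) g).
Local Notation inflR := (@infl (gext K R) (gext K R') fK).
Local Notation inflS := (@infl (gext K S) (gext K S') gK).
Local Notation P := (ideal_bimod chi).
Local Notation P' := (ideal_bimod chi').

Section Dual.
Local Notation EK := (ext_bimod K (hom_bimod P)).
Local Notation EK' := (ext_bimod K (hom_bimod P')).
Hypothesis e_deg : gdeg 0 (idv e).

Lemma fK_chi (s : gext K S) : fK (chiK chi s) = chiK chi' (gK s).
Proof.
move: s; apply: (@additive_ext K S (tensK K R')) => [s t|s t|s k].
- by rewrite chiKD; exact: extmapD.
- by rewrite [gK _]extmapD; exact: chiKD.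
rewrite chiKE [gK _]extmapE chiKE [LHS]extmapE; congr pureK; exact: f_chi.
Qed.

Lemma fK_idem : fK (eK K e) = eK K e'.
Proof. by rewrite [LHS]extmapE; congr pureK; exact: f_idem. Qed.

Section Eta.
Variable M : gmod (gext K R').
Local Notation N := (inflR M).

(** Both tensor products are e M, so one evaluates at e and tensors with the
    inclusion of the other left ideal. *)
Definition dual_eta (t : tens_obj EK N) : inflS (tens_obj EK' M) :=
  tpure (P := EK') (M := M) (dualK K chi') (teval t : M).

Lemma dual_etaB : zmod_morphism dual_eta.
Proof. by move=> t u; rewrite /dual_eta tevalB; exact: tpureBr. Qed.

Lemma dual_etaZ : scalable dual_eta.
Proof.
move=> s t; rewrite /dual_eta teval_scale.
rewrite (inflE f) fK_chi.
apply: etrans (_ : (gK s : gext K S') *: (tpure (P := EK') (M := M) (dualK K chi') (teval t) : tens_obj EK' M) = _).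
  by rewrite tscaleE dualK_scale tpureA.
by [].
Qed.
HB.instance Definition _ := GRing.isZmodMorphism.Build _ _ dual_eta dual_etaB.
HB.instance Definition _ := GRing.isScalable.Build _ _ _ *:%R dual_eta dual_etaZ.

Hypothesis hM : is_fmod M.

Let act : forall i j (a : gext K R') (x : M), gdeg i a -> hdeg j x -> hdeg (i + j) (a *: x).
Proof. by case: hM. Qed.
Let Mh : homog_subgroups (@hdeg _ M).
Proof. by case: hM. Qed.

Lemma dual_eta_deg d t : hdeg d t -> hdeg d (dual_eta t).
Proof.
move=> td; apply: (@dualK_pure_deg _ _ _ _ chi' M).
apply: (teval_deg (M := N) e_deg _ _ td) => // i j a x ai xj.
by apply: act => //; exact: extmor_deg.
Qed.

Definition dual_eta_mor : gmor (tens_obj EK N) (inflS (tens_obj EK' M)) :=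
  GMor (mfun := dual_eta) dual_eta_deg.

Lemma dual_eta_bij : graded_bij dual_eta_mor.
Proof.
have eM (m : M) : (eK K e : gext K R) *: (m : N) = (eK K e' : gext K R') *: m :> M.
  exact: (congr1 (fun a : gext K R' => a *: m) fK_idem).
have ev1 (x : M) : @teval K R' S' e' chi' M (tpure (P := EK') (M := M) (dualK K chi') x) =
    (eK K e' : gext K R') *: x.
  exact: teval_dualK.
have inj (t : tens_obj EK N) : @teval K R' S' e' chi' M
    (tpure (P := EK') (M := M) (dualK K chi') (@teval K R S e chi N t : M)) = @teval K R S e chi N t.
  rewrite ev1; apply: etrans (esym (eM _)) _.
  exact: (@teval_idem K R S e chi N t).
have ev2 (x : N) : @teval K R S e chi N (tpure (P := EK) (M := N) (dualK K chi) x) =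
    (eK K e : gext K R) *: x.
  exact: teval_dualK.
have sur (u : tens_obj EK' M) : dual_eta (tpure (P := EK) (M := N) (dualK K chi) (@teval K R' S' e' chi' M u : M)) = u.
  rewrite /dual_eta ev2; apply: etrans (teval_inv u); congr (tpure _ _).
  apply: etrans (eM _) _; exact: (@teval_idem K R' S' e' chi' M u).
split=> [t h|u|d u ud].
- have t0 : @teval K R S e chi N t = 0.
    apply: etrans (esym (inj t)) _.
    have -> : tpure (P := EK') (M := M) (dualK K chi') (@teval K R S e chi N t : M) = 0 by exact: h.
    exact: teval0.
  by rewrite -[t]teval_inv t0; exact: tpure0r.
- by eexists; exact: sur.
- have e'_deg : gdeg 0 (idv e') by rewrite -f_idem; exact: f_deg.
  have ud' := @teval_deg K R' S' e' chi' e'_deg M act Mh d u ud.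
  by eexists; [exact: (@dualK_pure_deg K R S e chi N d _ ud') | exact: sur].
Qed.

End Eta.

Lemma dual_nat_iso :
  nat_iso (fcomp (tens_functor EK) inflR) (fcomp inflS (tens_functor EK')).
Proof.
apply: (@graded_bij_nat_iso K R' S (fcomp (tens_functor EK) inflR) (fcomp inflS (tens_functor EK'))
  (fun M : fmod K R' => dual_eta_mor (fm_prop M))).
  by move=> M; exact: dual_eta_bij.
move=> M N h t.
pose F1 (t : tens_obj EK (inflR M)) : tens_obj EK' N :=
  dual_eta (M := N) (@tm_fun _ _ EK _ _ (@infl_map (gext K R) (gext K R') fK _ _ h) t).
pose F2 (t : tens_obj EK (inflR M)) : tens_obj EK' N := @tm_fun _ _ EK' _ _ h (dual_eta (M := M) t).
suff : F1 t = F2 t by [].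
have F1B : zmod_morphism F1.
  by move=> u v; rewrite /F1 (@tm_funB _ _ EK _ _ (@infl_map (gext K R) (gext K R') fK _ _ h)); exact: dual_etaB.
have F2B : zmod_morphism F2.
  by move=> u v; rewrite /F2 dual_etaB; exact: (@tm_funB _ _ EK' _ _ h).
apply: (span_ext F1B F2B _ (tens_span t)) => _ [x [m ->]].
rewrite /F1 /F2 (@tm_funE _ _ EK _ _ (@infl_map (gext K R) (gext K R') fK _ _ h)) /dual_eta !tevalE.
apply: esym; apply: etrans (@tm_funE _ _ EK' _ _ h _ _) _.
congr (tpure _ _); exact: (linearZZ h).
Qed.

End Dual.

Section Ideal.
Local Notation PK := (ext_bimod K P).
Local Notation PK' := (ext_bimod K P').

Fact lideal_map_subproof (p : P) : f (lval p) * idv e' == f (lval p).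
Proof. by rewrite -f_idem -rmorphM lidealP. Qed.
Definition lideal_map (p : P) : P' := LIdeal (lideal_map_subproof p).

Lemma lideal_mapB : zmod_morphism lideal_map.
Proof.
move=> p q; apply: val_inj.
apply: etrans (congr1 f (lvalB (p : lideal e) q)) _; apply: etrans (rmorphB f _ _) _.
exact: (esym (lvalB (lideal_map p : lideal e') (lideal_map q))).
Qed.
HB.instance Definition _ := GRing.isZmodMorphism.Build _ _ lideal_map lideal_mapB.

Lemma lideal_map_act (p : P) (s : S) : lideal_map (bact p s) = bact (lideal_map p) (g s).
Proof. by apply: val_inj; rewrite /= rmorphM f_chi. Qed.

Lemma lideal_map_scale (r : R) (p : P) : lideal_map (r *: p) = f r *: lideal_map p.
Proof. by apply: val_inj; rewrite /= rmorphM. Qed.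

Definition imapK (x : PK) : PK' := extmap lideal_map x.

Lemma imapKE p k : imapK (pureK p k) = pureK (lideal_map p) k.
Proof. exact: extmapE. Qed.
Lemma imapKD x y : imapK (x + y) = imapK x + imapK y.
Proof. exact: extmapD. Qed.

Lemma imapK0 : imapK 0 = 0.
Proof. by apply: (addIr (imapK 0)); rewrite -imapKD !add0r. Qed.
Lemma imapKB x y : imapK (x - y) = imapK x - imapK y.
Proof. exact: (extmapB lideal_map). Qed.

Lemma imapK_act (x : PK) (s : gext K S) : imapK (bact x s) = bact (imapK x) (gK s : gext K S').
Proof.
move: x; apply: (@additive_ext K P (tensK K P')) => [x y|x y|p k].
- exact: etrans (congr1 imapK (bactDl (x : PK) y s)) (imapKD _ _).
- exact: etrans (congr1 (fun u : PK' => bact u (gK s : gext K S')) (imapKD x y)) (bactDl _ _ _).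
move: s; apply: (@additive_ext K S (tensK K P')) => [s t|s t|s l].
- exact: etrans (congr1 imapK (bactDr (pureK p k : PK) (s : gext K S) t)) (imapKD _ _).
- exact: etrans (congr1 (fun u : gext K S' => bact (imapK (pureK p k)) u) (extmapD g s t)) (bactDr _ _ _).
rewrite ext_bactE !imapKE [gK _]extmapE lideal_map_act.
exact/esym/ext_bactE.
Qed.

Lemma imapK_scale (r : gext K R) (x : PK) : imapK (r *: x) = (fK r : gext K R') *: imapK x.
Proof.
move: x; apply: (@additive_ext K P (tensK K P')) => [x y|x y|p k].
- exact: etrans (congr1 imapK (scalerDr r (x : PK) y)) (imapKD _ _).
- exact: etrans (congr1 (fun u : PK' => (fK r : gext K R') *: u) (imapKD x y)) (scalerDr _ _ _).
move: r; apply: (@additive_ext K R (tensK K P')) => [r t|r t|r l].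
- exact: etrans (congr1 imapK (scalerDl (pureK p k : PK) (r : gext K R) t)) (imapKD _ _).
- exact: etrans (congr1 (fun u : gext K R' => u *: imapK (pureK p k)) (extmapD f r t)) (scalerDl _ _ _).
rewrite ext_scaleE !imapKE [fK _]extmapE lideal_map_scale.
exact/esym/ext_scaleE.
Qed.

Hypothesis f_surj : forall d r', gdeg d r' -> exists2 r, gdeg d r & f r = r'.
Hypothesis f_onto : forall r', exists r, f r = r'.
Hypothesis g_onto : forall s', exists s, g s = s'.
Hypothesis R_mul : gmulr R.
Hypothesis e_deg : gdeg 0 (idv e).

(** This is what makes the comparison of the two tensor products injective. *)
Hypothesis f_ker : forall p : P, f (lval p) = 0 ->
  span (fun p : P => exists (q : P) s, g s = 0 /\ p = bact q s) p.

Lemma lideal_map_onto (p' : P') : exists p, lideal_map p = p'.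
Proof.
have [r fr] := f_onto (lval p').
have re : r * idv e * idv e == r * idv e by rewrite -mulrA idemP.
exists (LIdeal re); apply: val_inj; rewrite /= rmorphM fr f_idem.
exact: lidealP.
Qed.

Lemma lideal_map_surj d (p' : P') : bdeg d p' -> exists2 p : P, bdeg d p & lideal_map p = p'.
Proof.
move=> /f_surj[r rd fr].
have re : r * idv e * idv e == r * idv e by rewrite -mulrA idemP.
exists (LIdeal re); first by have := R_mul rd e_deg; rewrite addr0.
apply: val_inj; rewrite /= rmorphM fr f_idem.
exact: lidealP.
Qed.

Section Eta.
Variable M : gmod (gext K S').
Local Notation N := (inflS M).
Local Notation T := (tens_obj PK N).
Local Notation T' := (tens_obj PK' M).

Definition ideal_eta (t : T) : inflR T' :=
  tlift (fun (x : PK) (m : N) => tpure (P := PK') (M := M) (imapK x) m : tens _ _) t.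

Lemma ideal_eta_bal : balanced (bact (b := PK)) *:%R
  (fun (x : PK) (m : N) => tpure (P := PK') (M := M) (imapK x) m : tens _ _).
Proof.
split=> [x y m|x m m'|x s m]; first by rewrite imapKD; exact: pureDl.
- exact: pureDr.
- by rewrite imapK_act; exact: tpureA.
Qed.

Lemma ideal_etaE x m : ideal_eta (tpure (P := PK) (M := N) x m) = tpure (P := PK') (M := M) (imapK x) m.
Proof. exact: (tliftE ideal_eta_bal). Qed.

Lemma ideal_etaB : zmod_morphism ideal_eta.
Proof. exact: (tliftB ideal_eta_bal). Qed.

Lemma ideal_etaZ : scalable ideal_eta.
Proof.
move=> r t; move: t (tens_span t); apply: span_ext => [t u|t u|_ [x [m ->]]].
- by rewrite scalerBr ideal_etaB.
- by rewrite ideal_etaB scalerBr.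
apply: etrans (congr1 ideal_eta (@tscaleE K R S P N r x m)) _.
apply: etrans (ideal_etaE _ _) _.
apply: etrans (congr1 (fun y : PK' => tpure (P := PK') (M := M) y m) (imapK_scale r x)) _.
apply: etrans (esym (@tscaleE K R' S' P' M (fK r) (imapK x) m)) _.
exact: (congr1 (fun y : T' => (fK r : gext K R') *: y) (esym (ideal_etaE x m))).
Qed.
HB.instance Definition _ := GRing.isZmodMorphism.Build _ _ ideal_eta ideal_etaB.
HB.instance Definition _ := GRing.isScalable.Build _ _ _ *:%R ideal_eta ideal_etaZ.

Lemma imapK_deg d x : bdeg d x -> bdeg d (imapK x).
Proof.
apply: span_morph; first exact: (extmapB lideal_map).
move=> _ [p [k [pd ->]]]; apply: span_gen; exists (lideal_map p), k.
by split; [exact: f_deg | exact: imapKE].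
Qed.

Lemma ideal_eta_deg d t : hdeg d t -> hdeg d (ideal_eta t).
Proof.
apply: span_morph; first exact: ideal_etaB.
move=> _ [i [j [x [m [ij xi mj ->]]]]]; apply: span_gen; exists i, j, (imapK x), m.
by split=> //; [exact: imapK_deg | exact: ideal_etaE].
Qed.

Definition ideal_eta_mor : gmor T (inflR T') := GMor (mfun := ideal_eta) ideal_eta_deg.

Let sec (p' : P') : P := sval (cid (lideal_map_onto p')).
Let secK p' : lideal_map (sec p') = p' := svalP (cid (lideal_map_onto p')).

Let tp (p : P) (k : K) (m : M) : T := tpure (P := PK) (M := N) (pureK p k) m.

(** By the kernel hypothesis it is enough to treat p = q s with g s = 0, and q s
    (x) m = q (x) (g s) m. *)
Lemma tp_ker p k m : f (lval p) = 0 -> tp p k m = 0.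
Proof.
have tpB q q' : tp (q - q') k m = tp q k m - tp q' k m.
  by rewrite /tp pureK_B; exact: tpureBl.
move=> /f_ker; elim=> [|_ [q [s [gs ->]]]|q q' _ IH _ IH'].
- by rewrite -(subrr 0) tpB subrr.
- rewrite /tp; have -> : pureK (bact q s) k = bact (pureK q k : PK) (pureK s 1 : gext K S).
    by rewrite ext_bactE mulr1.
  have g0 : gK (pureK s 1) = 0.
    apply: etrans (extmapE g s 1) _; apply: etrans (congr1 (fun z => pureK z _) gs) _.
    exact: pure0l.
  rewrite tpureA (inflE g) g0 scale0r; exact: tpure0r.
- by rewrite tpB IH IH' subrr.
Qed.

Lemma tp_eq p q k m : f (lval p) = f (lval q) -> tp p k m = tp q k m.
Proof.
move=> h; apply/eqP; rewrite -subr_eq0; apply/eqP.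
have <- : tp (p - q) k m = tp p k m - tp q k m by rewrite /tp pureK_B; exact: tpureBl.
by apply: tp_ker; rewrite lvalB rmorphB h subrr.
Qed.

Lemma secE p : f (lval (sec (lideal_map p))) = f (lval p).
Proof. exact: (congr1 (fun p' : P' => lval p') (secK (lideal_map p))). Qed.

Lemma secE' p' : f (lval (sec p')) = lval p'.
Proof. exact: (congr1 (fun p' : P' => lval p') (secK p')). Qed.

Let inv1 (m : M) (x : PK') : T := tlift (fun (p' : P') k => tp (sec p') k m) x.

Lemma inv1_bal m : balanced (@zract P') (@zlact K) (fun (p' : P') k => tp (sec p') k m).
Proof.
apply: biadditive_bal; split=> [p q k|p k l].
  have -> : tp (sec p) k m + tp (sec q) k m = tp (sec p + sec q) k m.
    by rewrite /tp [pureK (_ + _) k]pureDl; exact/esym/tpureDl.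
  apply: tp_eq; have -> : lval (sec p + sec q) = lval (sec p) + lval (sec q) by exact: lvalD.
  by rewrite rmorphD !secE'; exact: lvalD.
by rewrite /tp [pureK _ (k + l)]pureDr; exact: tpureDl.
Qed.

Lemma inv1E m p' k : inv1 m (pureK p' k) = tp (sec p') k m.
Proof. exact: (tliftE (inv1_bal m)). Qed.
Lemma inv1D m x y : inv1 m (x + y) = inv1 m x + inv1 m y.
Proof. exact: (tliftD (inv1_bal m)). Qed.

(** The inverse is defined by a set-theoretic section [sec] of the surjection R
    e -> R' e'; by [tp_eq] the choice does not matter, which makes it additive
    and balanced. *)
Lemma inv_bal : balanced (bact (b := PK')) *:%R (fun (x : PK') (m : M) => inv1 m x).
Proof.
split=> [x y m|x m m'|x s m]; first exact: inv1D.
- move: x; apply: (@additive_ext K P' T) => [x y|x y|p k]; first exact: inv1D.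
    by rewrite !inv1D addrACA.
  by rewrite !inv1E; exact: pureDr.
move: x; apply: (@additive_ext K P' T) => [x y|x y|p k].
- exact: etrans (congr1 (inv1 m) (bactDl (x : PK') y s)) (inv1D _ _ _).
- exact: inv1D.
move: s; apply: (@additive_ext K S' T) => [s t|s t|s l].
- exact: etrans (congr1 (inv1 m) (bactDr (pureK p k : PK') (s : gext K S') t)) (inv1D _ _ _).
- rewrite !inv1E /tp.
  exact: etrans (congr1 (tpure (P := PK) (M := N) _) (scalerDl m (s : gext K S') t)) (pureDr _ _ _ _ _).
have [s0 gs0] := g_onto s.
rewrite ext_bactE !inv1E.
have -> : tp (sec p) k ((pureK s l : gext K S') *: m) = tp (bact (sec p) s0) (k * l) m.
  have gE : gK (pureK s0 l) = pureK s l.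
    by apply: etrans (extmapE g s0 l) _; congr pureK.
  by rewrite /tp -(ext_bactE (sec p) s0 k l) tpureA (inflE g) gE.
apply: tp_eq; rewrite secE' /= rmorphM f_chi gs0 secE'.
by [].
Qed.

Lemma ideal_eta_bij : graded_bij ideal_eta_mor.
Proof.
pose inv (u : T') : T := tlift (fun (x : PK') (m : M) => inv1 m x) u.
have invB : zmod_morphism inv by exact: (tliftB inv_bal).
have invE x m : inv (tpure (P := PK') (M := M) x m) = inv1 m x by exact: (tliftE inv_bal).
have invK (t : T) : inv (ideal_eta t) = t.
  have B1 : zmod_morphism (fun t : T => inv (ideal_eta t)).
    by move=> u v; rewrite ideal_etaB; exact: invB.
  elim: (tens_span t) => [|_ [x [m ->]]|u v _ IHu _ IHv].
  - exact: (etrans (congr1 inv (tlift0 ideal_eta_bal)) (tlift0 inv_bal)).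
  - apply: etrans (congr1 inv (ideal_etaE x m)) _; apply: etrans (invE _ _) _; move: x.
    apply: (@additive_ext K P T) => [x y|x y|p k].
    + exact: etrans (congr1 (inv1 m) (imapKD x y)) (inv1D _ _ _).
    + exact: (@tpureDl K R S P N x y m).
    + apply: etrans (congr1 (inv1 m) (imapKE p k)) _; apply: etrans (inv1E _ _ _) _.
      by apply: tp_eq; exact: secE.
  - exact: (etrans (B1 u v) (f_equal2 (fun a b : T => a - b) IHu IHv)).
have bdeg_surj d (x : PK') : bdeg d x -> exists2 y : PK, bdeg d y & imapK y = x.
  elim=> [|_ [p' [k [pd ->]]]|u v _ [u' ud <-] _ [v' vd <-]].
  - by exists 0; [exact: span0 | exact: imapK0].
  - have [p pd' <-] := lideal_map_surj pd; exists (pureK p k); last exact: imapKE.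
    by apply: span_gen; exists p, k.
  - by exists (u' - v'); [exact: spanB | exact: imapKB].
have inv0 : inv 0 = 0 by exact: (tlift0 inv_bal).
have eta0 : ideal_eta 0 = 0 :> T' by exact: (tlift0 ideal_eta_bal).
have etaB u v : ideal_eta (u - v) = (ideal_eta u : T') - ideal_eta v by exact: ideal_etaB.
split=> [t h|u|d u].
- exact: (etrans (esym (invK t)) (etrans (congr1 inv (h : ideal_eta t = 0)) inv0)).
- suff [t tu] : exists t, ideal_eta t = u by exists t.
  elim: (tens_span (u : T')) => [|_ [x [m ->]]|v w _ [v' <-] _ [w' <-]].
  + by exists 0.
  + have [y <-] : exists y, imapK y = x.
      elim: (tensK_span x) => [|_ [p' [k ->]]|v w _ [v' <-] _ [w' <-]].
      * by exists 0; exact: imapK0.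
      * by have [p <-] := lideal_map_onto p'; exists (pureK p k); exact: imapKE.
      * by exists (v' - w'); exact: imapKB.
    by exists (tpure (P := PK) (M := N) y m); exact: ideal_etaE.
  + by exists (v' - w'); exact: etaB.
- move=> ud; suff [t td tu] : exists2 t : T, hdeg d t & ideal_eta t = u by exists t.
  elim: (ud : hdeg (g := T') d u) => [|_ [i [j [x [m [ij /bdeg_surj[y yi <-] mj ->]]]]]|v w _ [v' vd <-] _ [w' wd <-]].
  + by exists 0; [exact: span0 | exact: eta0].
  + exists (tpure (P := PK) (M := N) y m); last exact: ideal_etaE.
    apply: span_gen; exists i, j, y, m.
    by split; [exact: ij | exact: yi | exact: mj | exact: erefl].
  + exists (v' - w'); [exact: spanB | exact: etaB].
Qed.

End Eta.

Lemma ideal_nat_iso :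
  nat_iso (fcomp (tens_functor PK) inflS) (fcomp inflR (tens_functor PK')).
Proof.
apply: (@graded_bij_nat_iso K S' R (fcomp (tens_functor PK) inflS) (fcomp inflR (tens_functor PK'))
  (fun M : fmod K S' => ideal_eta_mor M)).
  by move=> M; exact: ideal_eta_bij.
move=> M N h t.
pose F1 (t : tens_obj PK (inflS M)) : tens_obj PK' N :=
  ideal_eta (M := N) (@tm_fun _ _ PK _ _ (@infl_map (gext K S) (gext K S') gK _ _ h) t).
pose F2 (t : tens_obj PK (inflS M)) : tens_obj PK' N := @tm_fun _ _ PK' _ _ h (ideal_eta (M := M) t).
suff : F1 t = F2 t by [].
have F1B : zmod_morphism F1.
  by move=> u v; rewrite /F1 (@tm_funB _ _ PK _ _ (@infl_map (gext K S) (gext K S') gK _ _ h)); exact: ideal_etaB.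
have F2B : zmod_morphism F2.
  by move=> u v; rewrite /F2 ideal_etaB; exact: (@tm_funB _ _ PK' _ _ h).
apply: (span_ext F1B F2B _ (tens_span t)) => _ [x [m ->]].
rewrite /F1 /F2 (@tm_funE _ _ PK _ _ (@infl_map (gext K S) (gext K S') gK _ _ h)) !ideal_etaE.
exact/esym/(@tm_funE _ _ PK' _ _ h).
Qed.

(** Transport along the isomorphism from the side of R, followed by forgetting
    the inflation. *)
Lemma ideal_preserves_fmod :
  preserves_fmod inflS -> preserves_fmod (tens_functor PK) -> preserves_fmod (tens_functor PK').
Proof.
move=> hi hP M; apply: (infl_reflects_fmod f_surj).
apply: (graded_bij_fmod (ideal_eta_bij M)); first exact: homog_span.
exact: (hP (FMod (hi M))).
Qed.

End Ideal.
End Intertwining.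

(** * The grading of the Ozsvath-Szabo algebra *)

Section PolynomialDegree.
Variable n : nat.
Local Notation R := {mpoly int[n]}.
Implicit Types (p q : R) (d e : int).

Lemma poly_deg_subgroups : homog_subgroups (@poly_deg n).
Proof.
move=> d; split=> [|p q]; first by left.
move=> [->|[m [-> pm]]] [->|[m' [e qm]]]; rewrite ?subr0 ?sub0r.
- by left.
- by right; exists m'; rewrite dhomogN.
- by right; exists m.
- right; exists m; split=> //; have em : m = m' by lia.
  by rewrite -em in qm; apply: dhomogD; rewrite ?dhomogN.
Qed.

Lemma poly_degM d e p q : poly_deg d p -> poly_deg e q -> poly_deg (d + e) (p * q).
Proof.
move=> [->|[m [-> pm]]]; first by left; rewrite mul0r.
move=> [->|[m' [-> qm]]]; first by left; rewrite mulr0.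
right; exists (m + m')%N; split; first by rewrite mulnDr PoszD.
exact: dhomogM.
Qed.

Lemma poly_deg1 : poly_deg 0 (1 : R).
Proof. by right; exists 0%N; split=> //; exact: dhomog1. Qed.

Lemma poly_degX (i : 'I_n) : poly_deg 2 ('X_i : R).
Proof. by right; exists 1%N; split=> //; rewrite dhomogX /= mdeg1. Qed.

Lemma poly_deg_mono (c : 'I_n -> nat) : poly_deg (2 * (\sum_i c i)%N%:Z) (mono c).
Proof.
right; exists (\sum_i c i)%N; split; first by lia.
rewrite /mono; elim/big_rec2: _ => [|i m p _ pm]; first exact: dhomog1.
have X1 : ('X_i : R) \is 1.-homog by rewrite dhomogX /= mdeg1.
by apply: dhomogM => //; have := dhomogMn (c i) X1; rewrite mul1n.
Qed.

(** The degree of x_i is 2, so there is nothing in odd or negative degrees. *)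
Definition poly_comp d p : R :=
  if d is Posz m then if odd m then 0 else pihomog mdeg m./2 p else 0.

Lemma poly_components : components (@poly_deg n) poly_comp.
Proof.
split=> [[m|m] p q|d p [->|[m [-> pm]]]|d d' p [->|[m [-> pm]]]] /=.
- by case: odd; [rewrite subrr | exact: raddfB].
- by rewrite subrr.
- by rewrite /poly_comp; case: d => m //; case: odd => //; exact: raddf0.
- by rewrite mul2n odd_double doubleK pihomog_dE.
- by rewrite /poly_comp => _; case: d' => m //; case: odd => //; exact: raddf0.
- rewrite /poly_comp; case: d' => m' //; have [//|ev] := boolP (odd m') => ne.
  rewrite (pihomog_ne0 _ pm) //; apply: contraNneq ne => ->.
  by rewrite mul2n; have := odd_double_half m'; rewrite (negbTE ev) add0n => ->.
Qed.

Lemma poly_span p : span (fun q => exists d, poly_deg d q) p.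
Proof.
rewrite (pihomog_partitionE (leqnn (mmeasure mdeg p))).
apply: span_sum => i _.
apply: span_gen; exists (2 * i)%N%:Z; right; exists i; split=> //.
exact: pihomogP.
Qed.

Lemma poly_compM d e p q : poly_deg e q -> poly_comp d (p * q) = poly_comp (d - e) p * q.
Proof.
move=> qe; have [cB cid c0] := poly_components.
move: p (poly_span p); apply: span_ext => [p r|p r|p [d' pd]].
- by rewrite mulrBl cB.
- by rewrite cB mulrBl.
have [->|ne] := eqVneq d (d' + e); first by rewrite addrK !cid //; exact: poly_degM.
rewrite (c0 _ _ _ (poly_degM pd qe) ne) (c0 _ _ _ pd) ?mul0r //.
by apply: contraNneq ne => <-; rewrite subrK.
Qed.

Lemma poly_comp_deg d p : poly_deg d (poly_comp d p).
Proof.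
have [cB cid c0] := poly_components.
elim: (poly_span p) => [|q [d' qd]|q r _ IHq _ IHr].
- by left; have := cB d 0 0; rewrite !subrr.
- have [->|ne] := eqVneq d d'; first by rewrite cid.
  by left; exact: (c0 _ _ _ qd ne).
- by rewrite cB; exact: (poly_deg_subgroups d).2.
Qed.

(** Taking components commutes with multiplication by the homogeneous
    generators. *)
Lemma in_gens_comp (b : 'I_n -> nat) d p :
  in_gens predT (hgen b) p -> in_gens predT (hgen b) (poly_comp d p).
Proof.
move=> [a ->]; rewrite (components_sum _ _ _ _ poly_components).
apply: in_gens_sum => l _; rewrite (@poly_compM d (2 * b l)%N%:Z).
  by apply: in_gensMl; exact: (in_gens_gen (hgen b)).
by right; exists (b l); split=> //; exact: hsym_homog.
Qed.

End PolynomialDegree.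

Section GradedB.
Variables n k : nat.
Local Notation polyU := {mpoly int[n]}.
Implicit Types (x y z : istate n k) (a b : B0 n k).

(** The degree of f_xy. *)
Definition idist x y : nat := (\sum_(i < n) `|iv x i - iv y i|)%N.

Lemma B0_subgroups : homog_subgroups (@B0_deg n k).
Proof.
move=> d; split=> [x y|a b ad bd x y]; rewrite !ffunE; first by left.
by apply: (poly_deg_subgroups n _).2; [exact: ad | exact: bd].
Qed.

Lemma fel_deg d x y (p : polyU) : poly_deg (d - (idist x y)%:Z) p -> B0_deg d (fel x y p).
Proof.
move=> pd u v; rewrite felE; case: ifP => [/andP[/eqP -> /eqP ->] //|_].
by left.
Qed.

Definition B0_comp d a : B0 n k := [ffun u => poly_comp (d - (idist u.1 u.2)%:Z) (a u)].

Lemma B0_grading : is_grading (@B0_deg n k).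
Proof.
have [cB cid c0] := poly_components n.
apply: (components_grading (c := B0_comp)); first exact: B0_subgroups.
  move=> a; rewrite (B0_sum a).
  apply: span_sum => x _.
  apply: span_sum => y _.
  apply: (@span_morph _ _ _ (fel x y)) (poly_span _) => [p q|p [d pd]]; first exact: felB.
  by apply: span_gen; exists (d + (idist x y)%:Z); apply: fel_deg; rewrite addrK.
split=> [d a b|d a ad|d d' a ad ne]; apply/ffunP => -[x y]; rewrite !ffunE /=.
- exact: cB.
- exact: (cid _ _ (ad x y)).
- apply: (c0 _ _ _ (ad x y)); apply: contraNneq ne.
  by move/(congr1 (fun t => t + (idist x y)%:Z)); rewrite !subrK => ->.
Qed.

Lemma gmono_deg x y z :
  poly_deg ((idist x y)%:Z + (idist y z)%:Z - (idist x z)%:Z) (gmono x y z).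
Proof.
have := poly_deg_mono (gexp x y z); rewrite -[mono _]/(gmono x y z).
suff -> : 2 * (\sum_i gexp x y z i)%N%:Z = (idist x y)%:Z + (idist y z)%:Z - (idist x z)%:Z by [].
suff : (2 * (\sum_i gexp x y z i) + idist x z = idist x y + idist y z)%N by lia.
rewrite /idist big_distrr /= -!big_split /=; apply: eq_bigr => i _.
rewrite /gexp; set u := iv x i; set v := iv y i; set w := iv z i; lia.
Qed.

Lemma B0_degM i j a b : B0_deg i a -> B0_deg j b -> B0_deg (i + j) (a * b).
Proof.
move=> ai bj x z; rewrite B0_mulE; apply: homog_sum => [|y _]; first exact: poly_deg_subgroups.
have := poly_degM (poly_degM (ai x y) (bj y z)) (gmono_deg x y z).
by congr poly_deg; rewrite -!/(idist _ _); lia.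
Qed.

Lemma isum_deg (Q : pred (istate n k)) : B0_deg 0 (isum Q).
Proof.
move=> x y; rewrite isumE; have [->|_] := eqVneq x y; last by left.
rewrite /= big1 => [|i _]; last by lia.
by case: (Q y); [exact: poly_deg1 | left].
Qed.

Lemma ht_setU1 (A : {set 'I_n.+1}) (u : 'I_n.+1) (m : nat) : u \notin A ->
  #|[set j in u |: A | (m <= j)%N]| = ((m <= u) + #|[set j in A | (m <= j)%N]|)%N.
Proof.
move=> uA; rewrite (cardsD1 u) !inE eqxx /=; congr (_ + _)%N.
apply: eq_card => j; rewrite !inE; have [->|] := eqVneq j u; last by [].
by rewrite (negbTE uA).
Qed.

(** Moving one element by one place changes a single v_i, by 1. *)
Lemma idist_move (i : 'I_n) x y : ilo i \in val x -> ihi i \notin val x ->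
  val y = ihi i |: (val x :\ ilo i) -> idist x y = 1%N /\ idist y x = 1%N.
Proof.
move=> lx hx yE; have lohi := ilo_ihi i.
have ly : ilo i \notin val y by rewrite yE !inE negb_or lohi eqxx.
have E : ilo i |: val y = ihi i |: val x.
  apply/setP => j; rewrite yE !inE; have [->|jl] := eqVneq j (ilo i); last by [].
  by rewrite lx orbT.
have H m : ((m <= i) + ht y m = (m <= i.+1) + ht x m)%N.
  by rewrite -(ht_setU1 m ly) E (ht_setU1 m hx).
have ivd (l : 'I_n) : (iv y l = iv x l + (l == i))%N.
  rewrite !ivE; have := H l.+1; rewrite -(inj_eq val_inj) /=.
  by lia.
have S : (\sum_(l < n) (l == i) = 1)%N.
  by rewrite (bigD1 i) //= eqxx big1 ?addn0 // => l /negbTE ->.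
by rewrite -S; split; apply: eq_bigr => l _; rewrite ivd; case: (l == i); lia.
Qed.

Lemma Rgen_deg (i : 'I_n) : B0_deg 1 (Rgen k i).
Proof.
move=> x y; rewrite RgenE; case E: [&& _, _ & _]; last by left.
case/and3P: E => lx hx /eqP yE.
rewrite -/(idist x y); have [-> _] := idist_move lx hx yE.
rewrite subrr; exact: poly_deg1.
Qed.

Lemma Lgen_deg (i : 'I_n) : B0_deg 1 (Lgen k i).
Proof.
move=> x y; rewrite LgenE; case E: [&& _, _ & _]; last by left.
case/and3P: E => hx lx /eqP yE; have lohi := @ilo_ihi n i.
have ly : ilo i \in val y by rewrite yE !inE eqxx.
have hy : ihi i \notin val y by rewrite yE !inE negb_or eq_sym lohi eqxx.
have xE : val x = ihi i |: (val y :\ ilo i).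
  apply/setP => j; rewrite yE !inE; have [->|jl] := eqVneq j (ilo i).
    by rewrite (negbTE lohi) (negbTE lx).
  by have [->|jh] := eqVneq j (ihi i); rewrite ?hx.
rewrite -/(idist x y); have [_ ->] := idist_move ly hy xE.
rewrite subrr; exact: poly_deg1.
Qed.

Lemma Brel_deg a : Brel a -> exists d, B0_deg d a.
Proof.
case=> [i j _|i j _|i x _].
- by exists (1 + 1); apply: B0_degM; exact: Rgen_deg.
- by exists (1 + 1); apply: B0_degM; exact: Lgen_deg.
- exists 2; apply: fel_deg; rewrite /idist big1 ?subr0; last by move=> l _; lia.
  exact: poly_degX.
Qed.

Lemma gBOSz_grading : ggrading (gBOSz n k).
Proof. exact: (grading_rquot B0_grading B0_degM Brel_deg). Qed.

Lemma gBOSz_mul : gmulr (gBOSz n k).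
Proof.
move=> i j _ _ [a [ai ->]] [b [bj ->]]; exists (a * b).
by split; [exact: B0_degM | rewrite rmorphM].
Qed.

Lemma el_left_deg : gdeg 0 (idv (el_left n k)).
Proof. by exists (isum (@left_istate n k)); split=> //; exact: isum_deg. Qed.

Lemma BlOSz_grading : ggrading (BlOSz n k).
Proof. exact: (grading_corner gBOSz_grading gBOSz_mul el_left_deg). Qed.

Lemma BlOSz_mul : gmulr (BlOSz n k).
Proof. exact: (gmulr_corner gBOSz_mul). Qed.

Lemma BlOSz1_deg : gdeg 0 (1 : BlOSz n k).
Proof.
suff : gdeg (g := gBOSz n k) 0 (cval (1 : BlOSz n k)) by [].
by rewrite cval1; exact: el_left_deg.
Qed.

Lemma toB_deg d a : B0_deg d a -> gdeg d (toB a).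
Proof.
move=> ad; have el := el_left_deg; have h := gBOSz_mul.
have ra : gdeg (g := gBOSz n k) d (rcls (@Brel n k) a) by exists a.
by have := h _ _ _ _ (h _ _ _ _ el ra) el; rewrite addr0 add0r.
Qed.

Lemma toB_lift d (b : BlOSz n k) : gdeg d b ->
  exists a, [/\ B0_deg d a, left_supported a & b = toB a].
Proof.
move=> [a [ad ba]]; pose eL : B0 n k := isum (@left_istate n k).
have ee : eL * eL = eL by rewrite isumM; apply: eq_bigl => x; rewrite /= andbb.
exists (eL * a * eL); split.
- by have := B0_degM (B0_degM (isum_deg (@left_istate n k)) ad) (isum_deg (@left_istate n k)); rewrite addr0 add0r.
- by apply/left_supportedP; rewrite -!mulrA ee !mulrA ee.
- apply: val_inj; rewrite -[RHS]/(rcls _ _ * rcls _ _ * rcls _ _) -!rmorphM.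
  have -> : eL * (eL * a * eL) * eL = eL * a * eL by rewrite -!mulrA ee !mulrA ee.
  rewrite !rmorphM -[LHS](eqP (cvalP b)).
  by rewrite ba.
Qed.

Lemma eBvee_deg : gdeg 0 (idv (eBvee n k)).
Proof. by apply: toB_deg; exact: isum_deg. Qed.

End GradedB.

(** * Xi as a morphism of graded rings *)

Section XiDegree.
Variables n k : nat.
Local Notation polyU := {mpoly int[n]}.
Local Notation cexp la mu := (fun i : 'I_n => (bseq mu i - bseq la i)%N).
Implicit Types (la mu : wedgeseq n k).

(** From |v - w| = 2 max(v - w, 0) - (v - w): the map (1 |-> p x^c) has the
    degree of p f_xy. *)
Lemma hom_degree la mu (d : int) :
  d - (idist (st mu) (st la))%:Z + 2 * (\sum_i cexp la mu i)%N%:Z =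
  d + \sum_(i < n) ((bseq mu i)%:Z - (bseq la i)%:Z).
Proof.
have -> : \sum_(i < n) ((bseq mu i)%:Z - (bseq la i)%:Z) =
    2 * (\sum_i cexp la mu i)%N%:Z - (idist (st mu) (st la))%:Z.
  rewrite /idist !(big_morph Posz PoszD (erefl 0%:Z)) mulr_sumr -sumrB.
  apply: eq_bigr => i _; rewrite !bseq_iv.
  by set u := iv _ i; set v := iv _ i; lia.
by rewrite -addrA [- _ + _]addrC.
Qed.

Lemma toH_deg d (a : B0 n k) : B0_deg d a -> H_deg d (toH a).
Proof.
move=> ad la mu; exists (a (st mu, st la) * mono (cexp la mu)); split=> //.
rewrite -hom_degree; apply: poly_degM; first exact: ad.
exact: poly_deg_mono.
Qed.

(** The polynomial given by [mono_gen] may be replaced by its homogeneous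
    component, because the ideals I_b are homogeneous. *)
Lemma toH_lift d (h : Hring n k) : H_deg d h ->
  exists a, [/\ B0_deg d a, left_supported a & toH a = h].
Proof.
move=> hd.
have ex la mu : exists q, h la mu = mapsto (bseq la) (bseq mu) (q * mono (cexp la mu)) /\
    poly_deg (d - (idist (st mu) (st la))%:Z) q.
  have [p [hp pd]] := hd la mu; have [okp|nok] := pselect (maps_ok (bseq la) (bseq mu) p); last first.
    (* By convention (1 |-> p) is zero when there is no such map. *)
    exists 0; split; last by left.
    by rewrite mul0r mapsto0 hp; apply: lhomP => z; rewrite /lapp /= /mapsto_fun asboolF.
  have pb l : in_gens predT (hgen (bseq mu)) (p * hgen (bseq la) l).
    rewrite mulrC; apply: ((maps_okP _ _ _).1 okp).
    exact: (in_gens_gen (hgen (bseq la))).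
  have [q pq] := mono_gen (bseq_step la) (bseq_step mu) pb.
  set d1 := d - _; set c := 2 * (\sum_i cexp la mu i)%N%:Z.
  have pd' : poly_deg (d1 + c) p by rewrite /d1 /c hom_degree.
  exists (poly_comp d1 q); split; last exact: poly_comp_deg.
  have := in_gens_comp (d1 + c) pq; have [cB cid c0] := poly_components n.
  rewrite cB (cid _ _ pd') (poly_compM _ _ (poly_deg_mono (cexp la mu))) -/c addrK => pq'.
  rewrite hp; apply/eqP; rewrite -subr_eq0 -mapstoB //; last exact: ok_mono.
  by apply/eqP/mapsto_eq0 => //; apply: maps_ok_ideal.
have [F hF] := choice (fun u : wedgeseq n k * wedgeseq n k => ex u.1 u.2).
exists (fel_matrix F); split.
- apply: homog_sum => [|mu _]; first exact: B0_subgroups.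
  apply: homog_sum => [|la _]; first exact: B0_subgroups.
  by apply: fel_deg; exact: (hF (la, mu)).2.
- exact: left_supported_matrix.
- by apply: HringP => la mu; rewrite /toH fel_matrixE (hF (la, mu)).1.
Qed.

Variable Xi : {rmorphism BlOSz n k -> AZ n k}.
Hypothesis hXi : is_Xi Xi.

Lemma Xi_deg d b : gdeg d b -> gdeg d (Xi b).
Proof.
move=> /toB_lift[a [ad al ->]]; exists (toH a); split; first exact: toH_deg.
exact: Xi_toB.
Qed.

Lemma Xi_surj_deg d u : gdeg d u -> exists2 b, gdeg d b & Xi b = u.
Proof.
move=> [h [/toH_lift[a [ad al <-]] ->]]; exists (toB a); first exact: toB_deg.
exact: Xi_toB.
Qed.

(** Products of homogeneous elements are computed in the left Ozsvath-Szabo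
    algebra: homogeneous elements lift along Xi. *)
Lemma AZ_mul : gmulr (AZ n k).
Proof.
move=> i j u v /Xi_surj_deg[a ai <-] /Xi_surj_deg[b bj <-]; rewrite -rmorphM.
by apply: Xi_deg; exact: BlOSz_mul.
Qed.

Lemma Xi_isumBl (Q : pred (istate n k)) (Q' : pred (wedgeseq n k)) :
  (forall mu, Q (st mu) = Q' mu) -> Xi (isumBl Q) = hsumA Q'.
Proof.
move=> QQ; rewrite -[isumBl Q]/(toB (isum (predI (@left_istate n k) Q))) (Xi_toB hXi); last first.
  by move=> x y; rewrite isumE; have [->|//] := eqVneq x y; rewrite andbb /= => /negbTE ->.
congr (rcls _ _); apply: HringP => la mu; rewrite /toH /hsum isumE (inj_eq (@st_inj n k)) eq_sym /=.
rewrite st_left QQ /=; have [<-|_] := eqVneq la mu; last by rewrite mul0r mapsto0.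
by case: (Q' la); rewrite ?mul0r ?mapsto0 // mul1r mono_eq0.
Qed.

Lemma has0_st mu : has0 (st mu) = first_wedge mu.
Proof. by rewrite /has0 st_mem. Qed.

Lemma Xi_eBvee : Xi (idv (eBvee n k)) = idv (eAvee n k).
Proof. by apply: Xi_isumBl => mu; rewrite /= has0_st. Qed.

Lemma Xi_eBwedge : Xi (idv (eBwedge n k)) = idv (eAwedge n k).
Proof. by apply: Xi_isumBl => mu; rewrite has0_st. Qed.

End XiDegree.

(** * The maps chi, and the kernel of Xi in the left ideal *)

Lemma sandwich (R S : pzRingType) (f : {rmorphism R -> S}) (e b : R) (e' : S) :
  f e = e' -> e' * f b * e' = f (e * b * e).
Proof. by move=> <-; rewrite !rmorphM. Qed.

Lemma mul_assoc4 (R : pzRingType) (a b c d : R) : a * b * c * d = a * (b * (c * d)).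
Proof. by rewrite !mulrA. Qed.

Section Flips.
Variables n k : nat.
Implicit Types (la mu nu : wedgeseq n k.+1).

Lemma flips_exists la : first_wedge la -> exists la' : wedgeseq n k, flips_first la la'.
Proof.
case: la => -[[|[] s] sz] ct; rewrite /first_wedge //= => _.
have sz' : size (false :: s) == n by [].
have ct' : count id (Tuple sz') == k by move: ct; rewrite /= add1n eqSS add0n.
by exists (Sub (Tuple sz') ct' : wedgeseq n k); exists s.
Qed.

Lemma flips_exists_inv (la' : wedgeseq n k) : (0 < n)%N -> ~~ first_wedge la' -> exists la : wedgeseq n k.+1, flips_first la la'.
Proof.
case: la' => -[[|[] s] sz] ct n0; rewrite /first_wedge //= => _.
  by exfalso; move: n0; rewrite -(eqP sz).
have sz' : size (true :: s) == n by [].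
have ct' : count id (Tuple sz') == k.+1 by move: ct; rewrite /= add1n eqSS add0n.
by exists (Sub (Tuple sz') ct' : wedgeseq n k.+1); exists s.
Qed.

Lemma flips_first_wedge la (la' : wedgeseq n k) : flips_first la la' -> first_wedge la /\ ~~ first_wedge la'.
Proof. by move=> [s [e e']]; rewrite /first_wedge e e'. Qed.

Lemma flips_removes0 la (la' : wedgeseq n k) : flips_first la la' -> removes0 (st la) (st la').
Proof.
move=> [s [e e']]; split; first by rewrite st_mem e.
apply/setP => j; rewrite in_setD1 !st_mem e e' -(inj_eq val_inj) /=.
by case: (val j).
Qed.

(** The first symbol does not enter b_i. *)
Lemma flips_bseq la (la' : wedgeseq n k) : flips_first la la' -> bseq la =1 bseq la'.
Proof. by move=> [s [e e']] i; rewrite /bseq e e'. Qed.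

Lemma flips_idist la mu (la' mu' : wedgeseq n k) : flips_first la la' -> flips_first mu mu' ->
  idist (st mu) (st la) = idist (st mu') (st la').
Proof.
move=> fl fm; apply: eq_bigr => i _.
have := flips_bseq fl i; have := flips_bseq fm i; rewrite !bseq_iv => -[->] [->].
by [].
Qed.

End Flips.

Section Idempotents.
Variables n k : nat.
Implicit Types (la mu : wedgeseq n k) (Q : pred (istate n k)) (p : {mpoly int[n]}).

Lemma isum_fel Q x y p : isum Q * fel x y p = if Q x then fel x y p else 0.
Proof.
rewrite /isum mulr_suml big_mkcond (bigD1 x) //= big1 ?addr0 => [|u ux].
  by rewrite fel_mul gmonoxx mul1r mulr1.
by rewrite fel_mul0 // if_same.
Qed.

Lemma fel_isum Q x y p : fel x y p * isum Q = if Q y then fel x y p else 0.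
Proof.
rewrite /isum mulr_sumr big_mkcond (bigD1 y) //= big1 ?addr0 => [|v vy].
  by rewrite fel_mulr1.
by rewrite fel_mul0 1?eq_sym // if_same.
Qed.

Lemma left_supported_isum Q : left_supported (isum (predI (@left_istate n k) Q)).
Proof. by move=> x y; rewrite isumE; have [->|//] := eqVneq x y; rewrite andbb /= => /negbTE ->. Qed.

Lemma isumBl_mull Q mu la p : isumBl Q * toB (fel (st mu) (st la) p) =
  if Q (st mu) then toB (fel (st mu) (st la) p) else 0.
Proof.
rewrite -[isumBl Q]/(toB (isum (predI (@left_istate n k) Q))) -toB_mul.
- by rewrite isum_fel /= st_left; case: (Q _) => //; exact: raddf0.
- exact: left_supported_isum.
- exact: left_supported_fel.
Qed.

Lemma isumBl_mulr Q mu la p : toB (fel (st mu) (st la) p) * isumBl Q =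
  if Q (st la) then toB (fel (st mu) (st la) p) else 0.
Proof.
rewrite -[isumBl Q]/(toB (isum (predI (@left_istate n k) Q))) -toB_mul.
- by rewrite fel_isum /= st_left; case: (Q _) => //; exact: raddf0.
- exact: left_supported_fel.
- exact: left_supported_isum.
Qed.

Lemma toB_fel_mul mu nu la p q : toB (fel (st mu) (st nu) p) * toB (fel (st nu) (st la) q) =
  toB (fel (st mu) (st la) (p * q * gmono (st mu) (st nu) (st la))).
Proof.
by rewrite -toB_mul ?fel_mul //; exact: left_supported_fel.
Qed.

(** Additive identities on the left algebra may be checked on the p f_xy. *)
Lemma BlOSz_span (b : BlOSz n k) :
  span (fun b => exists mu la p, b = toB (fel (st mu) (st la) p)) b.
Proof.
have [a al ->] := toB_surj b; rewrite (left_supported_sum al) raddf_sum /=.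
apply: span_sum => mu _.
rewrite raddf_sum /=; apply: span_sum => la _.
by apply: span_gen; exists mu, la, (a (st mu, st la)).
Qed.

Lemma BlOSz_span_deg d (b : BlOSz n k) : gdeg d b ->
  span (fun b => exists mu la p, poly_deg (d - (idist (st mu) (st la))%:Z) p /\
    b = toB (fel (st mu) (st la) p)) b.
Proof.
move=> /toB_lift[a [ad al ->]]; rewrite (left_supported_sum al) raddf_sum /=.
apply: span_sum => mu _.
rewrite raddf_sum /=; apply: span_sum => la _.
by apply: span_gen; exists mu, la, (a (st mu, st la)); split=> //; exact: ad.
Qed.

End Idempotents.

Section Chi.
Variables n k : nat.
Hypothesis n_gt0 : (0 < n)%N.
Variables (Xi0 : {rmorphism BlOSz n k -> AZ n k}) (Xi1 : {rmorphism BlOSz n k.+1 -> AZ n k.+1}).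
Hypotheses (hXi0 : is_Xi Xi0) (hXi1 : is_Xi Xi1).
Variable PsiB : {rmorphism corner (eBwedge n k.+1) -> corner (eBvee n k)}.
Hypothesis hPsiB : is_PsiB PsiB.
Variable chiB : {rmorphism BlOSz n k.+1 -> corner (eBvee n k)}.
Hypothesis hchiB : forall b, chiB b = PsiB (cproj (eBwedge n k.+1) b).
Variable PsiA : {rmorphism corner (eAwedge n k.+1) -> corner (eAvee n k)}.
Hypothesis hPsiA : is_PsiA PsiA.
Variable chiA : {rmorphism AZ n k.+1 -> corner (eAvee n k)}.
Hypothesis hchiA : forall a, chiA a = PsiA (cproj (eAwedge n k.+1) a).

Implicit Types (la mu nu : wedgeseq n k.+1) (p q r : {mpoly int[n]}).

Lemma predC_has0_st (mu' : wedgeseq n k) : predC (@has0 n k) (st mu') = ~~ first_wedge mu'.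
Proof. by rewrite /= has0_st. Qed.

Lemma eB_vee (mu' la' : wedgeseq n k) p : ~~ first_wedge mu' -> ~~ first_wedge la' ->
  idv (eBvee n k) * toB (fel (st mu') (st la') p) * idv (eBvee n k) = toB (fel (st mu') (st la') p).
Proof.
move=> m0 l0; apply: etrans (congr1 ( *%R^~ _) (isumBl_mull (predC (@has0 n k)) mu' la' p)) _.
rewrite predC_has0_st m0; apply: etrans (isumBl_mulr (predC (@has0 n k)) mu' la' p) _.
by rewrite predC_has0_st l0.
Qed.

Lemma fel_eBvee (mu' la' : wedgeseq n k) p : toB (fel (st mu') (st la') p) * idv (eBvee n k) =
  if first_wedge la' then 0 else toB (fel (st mu') (st la') p).
Proof.
apply: etrans (isumBl_mulr (predC (@has0 n k)) mu' la' p) _.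
by rewrite predC_has0_st if_neg.
Qed.

Lemma chiB_flips mu la (mu' la' : wedgeseq n k) p : flips_first mu mu' -> flips_first la la' ->
  cval (chiB (toB (fel (st mu) (st la) p))) = toB (fel (st mu') (st la') p).
Proof.
move=> fm fl; rewrite hchiB -[toB _]/(fBl _ _ _).
rewrite (hPsiB p (st_left mu) (st_left la) (flips_removes0 fm) (flips_removes0 fl)).
apply: eB_vee; [exact: (flips_first_wedge fm).2 | exact: (flips_first_wedge fl).2].
Qed.

Lemma eB_wedge0 mu la p : ~~ (first_wedge mu && first_wedge la) ->
  idv (eBwedge n k.+1) * toB (fel (st mu) (st la) p) * idv (eBwedge n k.+1) = 0.
Proof.
move=> h; apply: etrans (congr1 ( *%R^~ _) (isumBl_mull (@has0 n k.+1) mu la p)) _.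
rewrite has0_st; case: ifP => m0; last exact: mul0r.
apply: etrans (isumBl_mulr (@has0 n k.+1) mu la p) _.
by rewrite has0_st; move: h; rewrite m0 /= => /negbTE ->.
Qed.

Lemma chiB0 mu la p : ~~ (first_wedge mu && first_wedge la) -> chiB (toB (fel (st mu) (st la) p)) = 0.
Proof.
move=> h; rewrite hchiB.
have -> : cproj (eBwedge n k.+1) (toB (fel (st mu) (st la) p)) = 0.
  by apply: val_inj; exact: eB_wedge0.
exact: raddf0.
Qed.

Lemma chiB_deg d (s : BlOSz n k.+1) : gdeg d s -> gdeg d (cval (chiB s)).
Proof.
have H := BlOSz_grading n k; case: (H) => Hs _ _.
move/BlOSz_span_deg; elim=> [|_ [mu [la [p [pd ->]]]]|u v _ IHu _ IHv].
- by rewrite raddf0; exact: (Hs d).1.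
- have [/andP[/flips_exists[mu' fm] /flips_exists[la' fl]]|h] := boolP (first_wedge mu && first_wedge la).
    rewrite (chiB_flips p fm fl); apply: toB_deg; apply: fel_deg.
    by rewrite -(flips_idist fl fm).
  by rewrite chiB0 //; exact: (Hs d).1.
- by rewrite raddfB cvalB; exact: (Hs d).2.
Qed.

(** Both sides erase the f_xy unless x and y contain 0, and otherwise change the
    first symbols; the monomials x^c stay the same by [flips_bseq]. *)
Lemma Xi_chi s : Xi0 (cval (chiB s)) = cval (chiA (Xi1 s)).
Proof.
move: s (BlOSz_span s); apply: span_ext => [s t|s t|_ [mu [la [p ->]]]].
- by rewrite raddfB cvalB rmorphB.
- by rewrite rmorphB raddfB cvalB.
have [/andP[/flips_exists[mu' fm] /flips_exists[la' fl]]|h] := boolP (first_wedge mu && first_wedge la); last first.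
  rewrite chiB0 // hchiA.
  have -> : cproj (eAwedge n k.+1) (Xi1 (toB (fel (st mu) (st la) p))) = 0.
    apply: val_inj; apply: etrans (sandwich _ (Xi_eBwedge hXi1)) _.
    by rewrite eB_wedge0 //; exact: raddf0.
  by rewrite !raddf0.
rewrite (chiB_flips p fm fl) hchiA (Xi_toB hXi1); last exact: left_supported_fel.
rewrite toH_fel -[rcls _ _]/(Ael _ _ _) (hPsiA _ fl fm).
rewrite -(eB_vee p (flips_first_wedge fm).2 (flips_first_wedge fl).2).
apply: etrans (esym (sandwich _ (Xi_eBvee hXi0))) _.
congr (_ * _ * _); rewrite (Xi_toB hXi0); last exact: left_supported_fel.
rewrite toH_fel; congr (rcls _ (hel _ _ (_ * _))); apply: eq_bigr => i _.
by rewrite (flips_bseq fm) (flips_bseq fl).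
Qed.

(** Through a homogeneous lift along Xi1. *)
Lemma chiA_deg d (s : AZ n k.+1) : gdeg d s -> gdeg d (cval (chiA s)).
Proof.
by move=> /(Xi_surj_deg hXi1)[b bd <-]; rewrite -Xi_chi; apply: (Xi_deg hXi0); exact: chiB_deg.
Qed.

Lemma lval_sum (R : pzRingType) (e : idem R) I (r : seq I) (P : pred I) (F : I -> lideal e) :
  lval (\sum_(i <- r | P i) F i) = \sum_(i <- r | P i) lval (F i).
Proof. exact: (raddf_sum val). Qed.

Local Notation P := (ideal_bimod chiB).

Fact fel_lideal_subproof (u : wedgeseq n k * wedgeseq n k) :
  toB (fel (st u.1) (st u.2) 1) * idv (eBvee n k) * idv (eBvee n k) ==
  toB (fel (st u.1) (st u.2) 1) * idv (eBvee n k).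
Proof. by rewrite -mulrA idemP. Qed.
Definition fel_lideal u : P := LIdeal (fel_lideal_subproof u).

(** Each p f_xy e with 0 not in y is f_xy e times p f_yy, which comes from chi. *)
Lemma lideal_fg : exists (I : finType) (g : I -> P), forall x, exists s : I -> BlOSz n k.+1,
  x = \sum_i bact (g i) (s i).
Proof.
exists (wedgeseq n k * wedgeseq n k)%type, fel_lideal => x.
have [a al xa] := toB_surj (lval x).
have ex (u : wedgeseq n k * wedgeseq n k) : exists s : BlOSz n k.+1,
    lval (bact (fel_lideal u) s : P) = toB (fel (st u.1) (st u.2) (a (st u.1, st u.2))) * idv (eBvee n k).
  case: u => mu' la' /=; have [h|h] := boolP (first_wedge la').
    exists 0; rewrite [RHS]fel_eBvee h.
    have c0 : cval (chiB 0) = 0 by rewrite raddf0.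
    apply: etrans (congr1 ( *%R _) c0) _.
    exact: mulr0.
  have [la fl] := flips_exists_inv n_gt0 h.
  exists (toB (fel (st la) (st la) (a (st mu', st la')))).
  apply: etrans (congr1 ( *%R _) (chiB_flips _ fl fl)) _.
  apply: etrans (congr1 ( *%R^~ _) (fel_eBvee _ _ _)) _.
  by rewrite [RHS]fel_eBvee (negbTE h) toB_fel_mul mul1r gmonozz mulr1.
have [s sP] := choice ex; exists s; apply: val_inj.
rewrite -[LHS]lidealP -[RHS]/(lval _) lval_sum.
have -> : \sum_i lval (bact (fel_lideal i) (s i) : P) =
    \sum_i toB (fel (st i.1) (st i.2) (a (st i.1, st i.2))) * idv (eBvee n k).
  by apply: eq_bigr => i _; exact: sP.
rewrite xa {1}(left_supported_sum al) pair_bigA raddf_sum mulr_suml.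
by [].
Qed.

(** The part of Be that dies in the tensor product because the kernel of Xi1
    acts by zero. *)
Local Notation inY := (span (fun b : BlOSz n k => exists (x : P) s,
  Xi1 s = 0 /\ b = lval x * cval (chiB s))).

Lemma inYM (c b : BlOSz n k) : inY b -> inY (c * b).
Proof.
apply: (@span_morph _ _ _ ( *%R c)) => [u v|]; first exact: mulrBr.
move=> _ [x [s [s0 ->]]]; apply: span_gen; exists (c *: x), s; split=> //.
by rewrite /= mulrA.
Qed.

(** The relation at a state without 0 lifts along chi to the relation at the
    state with 0 added, because b does not change. *)
Lemma Y_between (mu' nu' la' : wedgeseq n k) p q : ~~ first_wedge nu' -> ~~ first_wedge la' ->
  in_gens predT (hgen (bseq nu')) p ->
  inY (toB (fel (st mu') (st nu') q) * toB (fel (st nu') (st la') p)).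
Proof.
move=> n0 l0 pI; apply: inYM.
have [nu fn] := flips_exists_inv n_gt0 n0; have [la fl] := flips_exists_inv n_gt0 l0.
have le : idv (eBvee n k) * idv (eBvee n k) == idv (eBvee n k) by apply/eqP; exact: idemP.
apply: span_gen; exists (LIdeal le : P), (toB (fel (st nu) (st la) p)); split; last first.
  by rewrite (chiB_flips p fn fl) /= isumBl_mull /= has0_st n0.
rewrite (Xi_toB hXi1); last exact: left_supported_fel.
rewrite toH_fel.
suff -> : hel la nu (p * mono (fun i => (bseq nu i - bseq la i)%N)) = 0 by exact: raddf0.
apply: HringP => la2 nu2; rewrite /hel; case: ifP => // /andP[/eqP -> /eqP ->].
refine (proj2 (mapsto_eq0 (@ok_mono n k.+1 la nu p)) _); rewrite mulrC; apply: in_gensMl.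
by apply: eq_hgen pI => i; rewrite (flips_bseq fn).
Qed.

Section Pair.
Variables (mu' la' : wedgeseq n k).
Hypothesis la_vee : ~~ first_wedge la'.
Let Yp p := inY (toB (fel (st mu') (st la') p)).

Lemma YpM p r : Yp p -> Yp (r * p).
Proof.
rewrite /Yp => h; have := inYM (toB (fel (st mu') (st mu') r)) h.
by rewrite toB_fel_mul gmonoxx mulr1.
Qed.

Lemma YpB p q : Yp p -> Yp q -> Yp (p - q).
Proof. by rewrite /Yp felB raddfB; exact: spanB. Qed.

Lemma Yp_sum I (s : seq I) (F : I -> {mpoly int[n]}) :
  (forall i, Yp (F i)) -> Yp (\sum_(i <- s) F i).
Proof.
move=> YF; rewrite /Yp fel_sum raddf_sum /=.
by apply: span_sum => i _; exact: YF.
Qed.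

Lemma Yp_right p : in_gens predT (hgen (bseq la')) p -> Yp p.
Proof.
move=> h; have := Y_between mu' 1 la_vee la_vee h.
by rewrite toB_fel_mul mul1r gmonozz mulr1.
Qed.

Lemma Yp_zero p : rcls (@Brel n k) (fel (st mu') (st la') p) = 0 -> Yp p.
Proof. by move=> h; rewrite /Yp toB_eq0 //; exact: span0. Qed.

Lemma Yp_vee p : ~~ first_wedge mu' -> in_gens predT (hgen (bseq mu')) p -> Yp p.
Proof.
move=> m0 h; have := Y_between mu' 1 m0 la_vee h.
by rewrite toB_fel_mul mul1r gmonoxx mulr1.
Qed.

Let X := ht (st mu').
Let Y := ht (st la').

Lemma Yp_hsym_right (i : 'I_n) d : (Y i.+1 < d)%N -> Yp (hsym n d i.+1).
Proof.
move=> h; apply: Yp_right; apply: hsym_in_gens; first exact: bseq_step.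
by rewrite bseqE.
Qed.

Section WedgeVee.
Hypothesis mu_wedge : first_wedge mu'.
Hypothesis near : ~ crossing (st mu') (st la').

Let X1 : (X 1 = k.-1 /\ 0 < k)%N.
Proof.
have : has0 (st mu') by rewrite has0_st.
by rewrite has0E; have := ht_step (st mu') 0; rewrite ht0 -/X; lia.
Qed.
Let Y1 : Y 1 = k.
Proof. by apply/eqP/negPn; rewrite -has0E has0_st. Qed.
Let Xn : X n = 0%N. Proof. exact: ht_left. Qed.
Let Yn : Y n = 0%N. Proof. exact: ht_left. Qed.
Let nearX i : (0 < i < n)%N -> (Y i.+1 <= X i)%N.
Proof. by move=> hi; rewrite leqNgt; apply/negP => h; apply: near; exists i; split=> //; right. Qed.

(** As 0 is in x but not in y and the paths do not cross, y is forced to follow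
    one step behind x until x has its first gap m. *)
Lemma first_gap : exists m, [/\ (0 < m < n)%N, X m.+1 = X m,
  forall i, (0 < i <= m)%N -> X i = (k - i)%N /\ (i <= k)%N
  & forall i, (0 < i <= m.+1)%N -> Y i = (k.+1 - i)%N].
Proof.
have ex : exists m, (0 < m)%N && (X m.+1 == X m).
  by exists n; rewrite n_gt0 /X ht_end // ht_left.
have [m /andP[m0 /eqP Xm] mmin] := ex_minnP ex.
have Xi i : (0 < i <= m)%N -> X i = (k - i)%N /\ (i <= k)%N.
  elim: i => // i IH im; have [->|i0] := posnP i; first by have := X1; lia.
  have im' : (0 < i <= m)%N by lia.
  have := IH im'; have := ht_step (st mu') i; rewrite -/X.
  have : X i.+1 != X i.
    by apply/negP => h; have := mmin i; rewrite i0 h => /(_ isT); lia.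
  lia.
have mn : (m <= n)%N.
  by apply: mmin; rewrite n_gt0 /X ht_end // ht_left.
have Yi i : (0 < i <= m.+1)%N -> (i <= n)%N -> Y i = (k.+1 - i)%N.
  elim: i => // i IH im i_n; have [->|i0] := posnP i; first by rewrite Y1 subn1.
  have im' : (0 < i <= m)%N by lia.
  have im2 : (0 < i <= m.+1)%N by lia.
  have i_n' : (i <= n)%N by lia.
  have hi : (0 < i < n)%N by lia.
  have := IH im2 i_n'; have := ht_step (st la') i; have := nearX hi; rewrite -/Y.
  by have := Xi i im'; lia.
have mn' : (m < n)%N.
  rewrite ltn_neqAle mn andbT; apply/eqP => e.
  have h1 : (0 < n <= m)%N by lia.
  have h2 : (0 < n <= m.+1)%N by lia.
  have := Xi n h1; have := Yi n h2 (leqnn n); rewrite Xn Yn; lia.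
exists m; split=> //; first by rewrite m0.
by move=> i hi; apply: Yi => //; lia.
Qed.

Local Notation run m i := (\prod_(j < n | (m.+1 <= j.+1 <= i)%N) 'X_j : {mpoly int[n]}).

Lemma run_recr m (i : 'I_n) : (m <= i)%N -> run m i.+1 = run m i * 'X_i.
Proof.
move=> mi; rewrite mulrC (bigD1 i) /=; last by rewrite ltnS mi leqnn.
congr (_ * _); apply: eq_bigl => j; rewrite -(inj_eq val_inj) /=; lia.
Qed.

Lemma hsym_up d (i : 'I_n) : hsym n d.+1 i = hsym n d.+1 i.+1 - 'X_i * hsym n d i.+1.
Proof. by rewrite hsymS addrK. Qed.

(** Induction from the right.  If one of the paths is level at i, the interval
    from m + 1 to i gives zero.  Otherwise both descend, and h_d(i) = h_d(i + 1)
    - U_(i+1) h_(d-1)(i + 1): the first term is a relation at y, the second one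
    is the next case. *)
Lemma Yp_run m : (0 < m < n)%N -> X m.+1 = X m -> Y m = (X m).+1 -> Y m.+1 = X m.+1 ->
  forall i, (m < i <= n)%N -> (forall j, (m < j <= i)%N -> X j = Y j) ->
    (forall j, (m < j < i)%N -> X j = (X j.+1).+1) -> Yp (run m i * hsym n (X i) i).
Proof.
move=> hm Xm Ym Ym1 i; have [d] := ubnP (n - i); elim: d i => // d IH i dn hi XY Xd.
have Xi := ht_step (st mu') i; have Yi := ht_step (st la') i; rewrite -/X -/Y in Xi Yi.
have XYi : X i = Y i by apply: XY; lia.
have [e|ne] := eqVneq (maxn (X i.+1) (Y i.+1)) (X i).
  rewrite mulrC; apply: YpM; apply: Yp_zero; apply: interval_eq0 => //.
  by rewrite /= -/X -/Y Xm Ym; lia.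
have i_n : (i < n)%N.
  rewrite ltn_neqAle; have /andP[_ ->] := hi; rewrite andbT; apply/eqP => e.
  by move: ne; rewrite e /X /Y !(ht_end _ (ltnSn n)) !ht_left.
pose o := Ordinal i_n.
have XS : X i = (X i.+1).+1 by lia.
have YS : Y i.+1 = X i.+1 by lia.
have IH1 : Yp (run m i.+1 * hsym n (X i.+1) i.+1).
  apply: IH => [||j hj|j hj]; try lia.
    by have [->|] := eqVneq j i.+1; [rewrite YS | move=> ?; apply: XY; lia].
  by have [->|] := eqVneq j i; [exact: XS | move=> ?; apply: Xd; lia].
have H : hsym n (X i) i = hsym n (X i) i.+1 - 'X_o * hsym n (X i.+1) i.+1.
  by rewrite XS; exact: (hsym_up _ o).
have R : run m i.+1 = run m i * 'X_o by apply: (@run_recr m o); rewrite /=; lia.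
rewrite H mulrBr mulrA -R; apply: YpB => //; apply: YpM.
by apply: (@Yp_hsym_right o); rewrite /= YS XS.
Qed.

(** The same recursion carries i up to m, the first term being a relation at y
    each time; there it is continued by [Yp_run]. *)
Lemma Yp_below m : (0 < m < n)%N -> X m.+1 = X m ->
  (forall i, (0 < i <= m)%N -> X i = (k - i)%N /\ (i <= k)%N) ->
  (forall i, (0 < i <= m.+1)%N -> Y i = (k.+1 - i)%N) ->
  forall i, (0 < i <= m)%N -> Yp (hsym n (X i).+1 i).
Proof.
move=> hm Xm Xi Yi i; have [d] := ubnP (m - i); elim: d i => // d IH i dm hi.
have i_n : (i < n)%N by lia.
pose o := Ordinal i_n.
have Yi1 : Y i.+1 = X i by rewrite Yi ?(Xi i hi).1; lia.
have H : hsym n (X i).+1 i = hsym n (X i).+1 i.+1 - 'X_o * hsym n (X i) i.+1.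
  exact: (hsym_up _ o).
rewrite H; apply: YpB; first by apply: (@Yp_hsym_right o); rewrite /= Yi1.
have [e|ne] := eqVneq i m.
  have hm1 : (0 < m <= m)%N by lia.
  have [Xmk mk] := Xi m hm1.
  have R : run m i.+1 = 'X_o.
    have -> : run m i.+1 = run m i * 'X_o by apply: (@run_recr m o); rewrite /=; lia.
    by rewrite big1 ?mul1r // => j; lia.
  have -> : 'X_o * hsym n (X i) i.+1 = run m i.+1 * hsym n (X i.+1) i.+1 by rewrite R e Xm.
  apply: Yp_run => //.
  - by rewrite Yi ?Xmk; lia.
  - by rewrite Yi ?Xm ?Xmk; lia.
  - by lia.
  - move=> j hj; have -> : j = m.+1 by lia.
    by rewrite Xm Yi ?Xmk; lia.
  - by move=> j hj; lia.
have hi1 : (0 < i.+1 <= m)%N by lia.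
have -> : X i = (X i.+1).+1 by rewrite (Xi i hi).1 (Xi _ hi1).1; have := (Xi _ hi1).2; lia.
by apply: YpM; apply: IH => //; lia.
Qed.

(** Up to the gap m this is [Yp_below].  After m the relation is moved to the
    state z that follows y up to m and x afterwards: z has no 0, lies between x
    and y, and has the height of x there. *)
Lemma Yp_wedge_vee p : in_gens predT (hgen (bseq mu')) p -> Yp p.
Proof.
have [m [hm Xm Xi Yi]] := first_gap.
have [||i i_n|z zE] := @ht_exists n k (fun i => if (i <= m)%N then Y i else X i).
- by rewrite leq0n /Y ht0.
- have -> : (n.+1 <= m)%N = false by lia.
  by rewrite /X ht_end.
- have Xs := ht_step (st mu') i; have Ys := ht_step (st la') i; rewrite -/X -/Y in Xs Ys.
  have [im|im] := leqP i.+1 m; first by rewrite (ltnW im).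
  have [im'|im'] := leqP i m; last by [].
  have {im im'}im : i = m by lia.
  have hm1 : (0 < m <= m)%N by lia.
  have hm2 : (0 < m <= m.+1)%N by lia.
  by rewrite im Xm (Xi m hm1).1 (Yi m hm2); have := (Xi m hm1).2; lia.
have zl : left_istate z.
  have nm : (n <= m)%N = false by lia.
  by rewrite left_istateE zE // nm Xn.
have [nu' zn] := left_st zl; rewrite zn in zE.
have nu_vee : ~~ first_wedge nu'.
  have m1 : (1 <= m)%N by lia.
  by rewrite -has0_st has0E negbK zE // m1 Y1.
move=> [c ->]; apply: Yp_sum => l; apply: YpM.
have lt := ltn_ord l; have [lm|lm] := leqP l.+1 m.
  have -> : hgen (bseq mu') l = hsym n (X l.+1).+1 l.+1 by rewrite /hgen bseqE.
  by apply: (Yp_below hm Xm Xi Yi); lia.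
have -> : hgen (bseq mu') l = hgen (bseq nu') l.
  rewrite /hgen !bseqE zE; last by lia.
  by rewrite leqNgt lm.
have := Y_between mu' 1 nu_vee la_vee (in_gens_gen (hgen (bseq nu')) (isT : predT l)).
rewrite toB_fel_mul mul1r gmono_between ?mulr1 // => i i_n; rewrite zE; last by lia.
by rewrite -/X -/Y; case: ifP => _; lia.
Qed.

End WedgeVee.

Lemma Yp_left p : in_gens predT (hgen (bseq mu')) p -> Yp p.
Proof.
have [cr|near] := pselect (crossing (st mu') (st la')).
  by move=> _; apply: Yp_zero; exact: crossing_eq0.
by have [mw|mv] := boolP (first_wedge mu'); [exact: Yp_wedge_vee | exact: Yp_vee].
Qed.

End Pair.

Lemma Y_gen (mu' : wedgeseq n k) (i : 'I_n) (b : BlOSz n k) :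
  inY (toB (fel (st mu') (st mu') (hgen (bseq mu') i)) * (b * idv (eBvee n k))).
Proof.
move: b (BlOSz_span b) => b; elim=> {b} [|_ [nu' [la' [p ->]]]|u v _ IHu _ IHv].
- by rewrite mul0r mulr0; exact: span0.
- rewrite fel_eBvee; case: ifP => l0; first by rewrite mulr0; exact: span0.
  have [e|ne] := eqVneq mu' nu'; last first.
    rewrite -(toB_mul (left_supported_fel _ _ _) (left_supported_fel _ _ _)) fel_mul0.
      by rewrite raddf0; exact: span0.
    by rewrite (inj_eq (@st_inj n k)).
  rewrite -e toB_fel_mul; apply: Yp_left; first by rewrite l0.
  by rewrite -mulrA mulrC; apply: in_gensMl; exact: (in_gens_gen (hgen (bseq mu'))).
- by rewrite mulrBl mulrBr; exact: spanB.
Qed.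

(** The generators of the kernel of Xi, multiplied from both sides into Be, are
    covered by [Yp_left] and the stability of these sums under left
    multiplication. *)
Lemma lideal_ker (x : P) : Xi0 (lval x) = 0 ->
  span (fun x : P => exists (q : P) s, Xi1 s = 0 /\ x = bact q s) x.
Proof.
move=> /(Xi_ker hXi0) h.
have Yx : inY (lval x).
  rewrite -lidealP; elim: h => [|_ [r [_ [b [[mu' [i ->]] ->]]]]|u v _ IHu _ IHv].
  - by rewrite mul0r; exact: span0.
  - rewrite mul_assoc4; apply: inYM; exact: Y_gen.
  - by rewrite mulrBl; exact: spanB.
have lp (b : BlOSz n k) : b * idv (eBvee n k) * idv (eBvee n k) == b * idv (eBvee n k).
  by rewrite -mulrA idemP.
have -> : x = LIdeal (lp (lval x)) by apply: val_inj; rewrite /= lidealP.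
apply: (@span_morph _ _ _ (fun b => LIdeal (lp b) : P)) Yx => [u v|_ [q [s [s0 ->]]]].
  apply: val_inj; apply: etrans (mulrBl _ _ _) _.
  exact: (esym (lvalB (LIdeal (lp u)) (LIdeal (lp v)))).
apply: span_gen; exists q, s; split=> //; apply: val_inj => /=.
by rewrite -mulrA (cornerP (chiB s)).2.
Qed.

End Chi.

(** * The intertwining isomorphisms *)

Lemma F_OSz_preserves_fmod (K : fieldType) (n k : nat) (n_gt0 : (0 < n)%N)
    (PsiB : {rmorphism corner (eBwedge n k.+1) -> corner (eBvee n k)}) (hPsiB : is_PsiB PsiB)
    (chiB : {rmorphism BlOSz n k.+1 -> corner (eBvee n k)})
    (hchiB : forall b, chiB b = PsiB (cproj (eBwedge n k.+1) b)) :
  preserves_fmod (F_OSz K chiB).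
Proof.
apply: tens_preserves_fmod.
- by move=> i j r p; exact: BlOSz_mul.
- by move=> i j p s dp ds; apply: (BlOSz_mul dp); exact: (chiB_deg hPsiB hchiB ds).
- exact: (grading_lideal (BlOSz_grading n k) (@BlOSz_mul n k) (eBvee_deg n k)).
- by case: (BlOSz_grading n k.+1) => _ Bspan _; exact: (spanning_span Bspan).
- exact: BlOSz1_deg.
- exact: (lideal_fg n_gt0 hPsiB hchiB).
Qed.

Lemma eAvee_deg (n k : nat) (Xi : {rmorphism BlOSz n k -> AZ n k}) : is_Xi Xi ->
  gdeg 0 (idv (eAvee n k)).
Proof. by move=> hXi; rewrite -(Xi_eBvee hXi); apply: (Xi_deg hXi); exact: eBvee_deg. Qed.

Theorem theorem1p4 (K : fieldType) (n k : nat) (hn : (1 <= n)%N) (hk : (k <= n - 1)%N)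
    (Xi0 : {rmorphism BlOSz n k -> AZ n k}) (hXi0 : is_Xi Xi0)
    (Xi1 : {rmorphism BlOSz n k.+1 -> AZ n k.+1}) (hXi1 : is_Xi Xi1)
    (PsiB : {rmorphism corner (eBwedge n k.+1) -> corner (eBvee n k)})
    (hPsiB : is_PsiB PsiB)
    (chiB : {rmorphism BlOSz n k.+1 -> corner (eBvee n k)})
    (hchiB : forall b, chiB b = PsiB (cproj (eBwedge n k.+1) b))
    (PsiA : {rmorphism corner (eAwedge n k.+1) -> corner (eAvee n k)})
    (hPsiA : is_PsiA PsiA)
    (chiA : {rmorphism AZ n k.+1 -> corner (eAvee n k)})
    (hchiA : forall a, chiA a = PsiA (cproj (eAwedge n k.+1) a)) :
  [/\ preserves_fmod (inflK K Xi0) /\ preserves_fmod (inflK K Xi1),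
      preserves_fmod (E_OSz K chiB) /\ preserves_fmod (F_OSz K chiB)
    & preserves_fmod (E_S K chiA) /\ preserves_fmod (F_S K chiA)] /\
  nat_iso (fcomp (E_OSz K chiB) (inflK K Xi0)) (fcomp (inflK K Xi1) (E_S K chiA)) /\
  nat_iso (fcomp (F_OSz K chiB) (inflK K Xi1)) (fcomp (inflK K Xi0) (F_S K chiA)).
Proof.
have n_gt0 : (0 < n)%N := hn.
have chi_deg := @chiB_deg _ _ _ hPsiB _ hchiB.
have chi_compat := Xi_chi hXi0 hXi1 hPsiB hchiB hPsiA hchiA.
have surj (m : nat) (Xi : {rmorphism BlOSz n m -> AZ n m}) :
    is_Xi Xi -> forall u, exists b, Xi b = u.
  by move=> hXi u; case: (Xi_surj hXi u) => b e; exact: (ex_intro _ b (esym e)).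
have ker := @lideal_ker _ _ n_gt0 _ _ hXi0 hXi1 _ hPsiB _ hchiB.
have lift := @Xi_surj_deg _ _ _ hXi0.
have infl0 : preserves_fmod (inflK K Xi0) := infl_preserves_fmod (@Xi_deg _ _ _ hXi0).
have infl1 : preserves_fmod (inflK K Xi1) := infl_preserves_fmod (@Xi_deg _ _ _ hXi1).
have FB := @F_OSz_preserves_fmod K _ _ n_gt0 _ hPsiB _ hchiB.
split; last split.
- split=> //; split=> //.
  + exact: (dual_preserves_fmod (@BlOSz_mul n k) (eBvee_deg n k) chi_deg).
  + apply: (dual_preserves_fmod (@AZ_mul _ _ _ hXi0) (eAvee_deg hXi0)).
    exact: (@chiA_deg _ _ _ _ hXi0 hXi1 _ hPsiB _ hchiB _ hPsiA _ hchiA).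
  + exact: (ideal_preserves_fmod (@Xi_deg _ _ _ hXi0) (Xi_eBvee hXi0) chi_compat
      lift (surj _ _ hXi0) (surj _ _ hXi1) (@BlOSz_mul n k) (eBvee_deg n k) ker infl1 FB).
- exact: (dual_nat_iso K (@Xi_deg _ _ _ hXi0) (Xi_eBvee hXi0) chi_compat (eBvee_deg n k)).
- exact: (ideal_nat_iso K (@Xi_deg _ _ _ hXi0) (Xi_eBvee hXi0) chi_compat
    lift (surj _ _ hXi0) (surj _ _ hXi1) (@BlOSz_mul n k) (eBvee_deg n k) ker).
Qed.
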